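(* Consider the stationary $M^X/SM2/1$ queue described in the context, with batch arrival rate $\lambda$, batch size $B$, $b_k=\mathbb P(B=k)$, and service transforms $\tilde{\mathbf G}(s)=[\tilde G_{ij}(s)]_{i,j=1}^N$ and $[\tilde G^*_{ij}(s)]_{i,j=1}^N$. Let $(\mathcal X^d,\mathcal J)$ have the stationary law of $(\mathcal X^d_{n-1},\mathcal J_n)$ and put $\mathcal X^{bs}=\max(\mathcal X^d-1,0)$. For $s=\lambda(1-z)$ with $|z|\le 1$, define $$a_i=\mathbb P(\mathcal X^d=0,\ \mathcal J=i),\qquad c_i(s)=\mathbb E\Big[\big(1-\tfrac{s}{\lambda}\big)^{\mathcal X^{d}-1}1_{\{\mathcal J=i\}}1_{\{\mathcal X^d\ge 1\}}\Big],\qquad i=1,\dots,N,$$ $$w_1(s)=\mathbb E\Big[\big(1-\tfrac{s}{\lambda}\big)^{\mathcal X^{bs}}\Big],$$ $$w_m(s)=\sum_{k=1}^N\sum_{j=1}^N\sum_{i=1}^N a_i\,\tilde G^*_{ik}(s)\,[\tilde{\mathbf G}(s)^{m-2}]_{kj}+\sum_{j=1}^N\sum_{i=1}^N c_i(s)\,[\tilde{\mathbf G}(s)^{m-1}]_{ij},\qquad m\ge 2.$$ Then: (1) the steady-state waiting time $\mathcal W^{sc}$ and sojourn time $\mathcal S^{sc}$ of a batch (super customer) satisfy $$\mathbb E[e^{-s\mathcal W^{sc}}]=\mathbb E\Big[\big(1-\tfrac{s}{\lambda}\big)^{\mathcal X^{bs}}\Big],\qquad \mathbb E[e^{-s\mathcal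 S^{sc}}]=\mathbb E\Big[\big(1-\tfrac{s}{\lambda}\big)^{\mathcal X^{d}}\Big];$$ (2) the steady-state waiting time $W^{(m)}$ and sojourn time $S^{(m)}$ of the $m$-th customer served in its batch satisfy $$\mathbb E[e^{-sW^{(m)}}]=w_m(s),\qquad \mathbb E[e^{-sS^{(m)}}]=w_{m+1}(s),\qquad m\ge 1;$$ (3) the steady-state waiting time $W$ and sojourn time $S$ of an arbitrary customer satisfy $$\mathbb E[e^{-sW}]=\sum_{m=1}^\infty r_m\,\mathbb E[e^{-sW^{(m)}}],\qquad \mathbb E[e^{-sS}]=\sum_{m=1}^\infty r_m\,\mathbb E[e^{-sS^{(m)}}],\qquad r_m=\frac1{\mathbb E[B]}\sum_{k=m}^\infty b_k .$$
   Context: The $M^X/SM2/1$ queue: customers arrive in batches at a single server according to a Poisson process with rate $\lambda$. Batch sizes are i.i.d. copies of $B\ge 1$, independent of everything else. Batches are served in order of arrival, and customers within a batch are served individually, one after the other. Customers have types in $\{1,\dots,N\}$. Let $J_n$ be the type of the $n$-th served customer, $G^{(n)}$ its service time, and $X_{n-1}$ the number of customers in the system just after the departure of the $(n-1)$-th customer. Services form a semi-Markov process with exceptional first service in each busy period: the law of $(G^{(n)},J_{n+1})$ given the past depends only on $J_n$ and on whether $X_{n-1}=0$ or $X_{n-1}\ge1$, through $$\tilde G_{ij}(s)=\mathbb E[e^{-sG^{(n)}}1_{\{J_{n+1}=j\}}\mid J_n=i,X_{n-1}\ge1],\qquad \tilde G^*_{ij}(s)=\mathbb E[e^{-sG^{(n)}}1_{\{J_{n+1}=j\}}\mid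 J_n=i,X_{n-1}=0],$$ and does not otherwise depend on the arrival process. $[M]_{ij}$ denotes the $(i,j)$ entry of a matrix $M$, and $\tilde{\mathbf G}(s)^0$ is the identity matrix. Super customers: all customers of a batch together are regarded as one super customer, whose service time is the total service time of the customers in the batch. $\mathcal J_n$ is the type of the $n$-th super customer, i.e. the type of the first customer served in the $n$-th batch. $\mathcal X^d_n$ is the number of super customers in the system just after the departure of the $n$-th super customer, and $\mathcal X^{bs}_n$ is the number of super customers waiting in the queue (excluding the one entering service) at the beginning of service of the $n$-th super customer. Thus $\mathcal X^{bs}_n=\mathcal X^d_{n-1}-1$ if $\mathcal X^d_{n-1}\ge1$ and $\mathcal X^{bs}_n=0$ if $\mathcal X^d_{n-1}=0$. The waiting time of a (super) customer is the time from its arrival until the start of its service, and the sojourn time is the time from its arrival until the end of its service. $\mathcal W^{sc},\mathcal S^{sc}$ are the limits in distribution, as $n\to\infty$, of the waiting and sojourn times of the $n$-th super customer. $W^{(m)},S^{(m)}$ refer to the $m$-th customer served in its batch, for $m$ with $\mathbb P(B\ge m)>0$. An arbitrary customer is one sampled uniformly from all customers in the long run; such a customer belongs to a batch of size $k$ with probability $k b_k/\mathbb E[B]$ and is equally likely to be in each position of that batch. Standing assumptions: $\mathbb E[B]<\infty$, and the system is stable, so that all the stationary limits above exist. *)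

(* Defs.v *)
From HB Require Import structures.
From mathcomp Require Import all_boot all_order all_algebra finmap.
From mathcomp Require Import complex.
From mathcomp Require Import all_classical all_reals all_analysis.

Set Implicit Arguments.
Unset Strict Implicit.
Unset Printing Implicit Defensive.

Import Order.TTheory GRing.Theory Num.Theory.
Import numFieldNormedType.Exports.

Local Open Scope classical_set_scope.
Local Open Scope ring_scope.

Section Complex.
Context {R : realType}.

Definition ofR (x : R) : R[i] := Complex x 0.

Definition cexp (u : R[i]) : R[i] :=
  Complex (expR (complex.Re u) * cos (complex.Im u))
          (expR (complex.Re u) * sin (complex.Im u)).

(* Componentwise integral; this is E[X] when mu is a probability. *)
Definition cintegral d (T : measurableType d)
    (mu : {measure set T -> \bar R}) (X : T -> R[i]) : R[i] :=
  Complex (\int[mu]_w complex.Re (X w)) (\int[mu]_w complex.Im (X w)).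

Definition lst d (T : measurableType d) (mu : {measure set T -> \bar R})
    (s : R[i]) (Y : T -> R) : R[i] :=
  cintegral mu (fun w => cexp (- (s * ofR (Y w)))).

End Complex.

Section Probability.
Context {R : realType} d (T : measurableType d) (P : probability T R).

Definition mutually_independent (I : choiceType) (F : I -> set (set T)) :=
  forall (s : seq I) (E : I -> set T), uniq s ->
    (forall i, i \in s -> F i (E i)) ->
    P (\bigcap_(i in [set` s]) E i) = (\prod_(i <- s) P (E i))%E.

Definition events_of d' (T' : measurableType d') (X : T -> T') : set (set T) :=
  preimage_set_system setT X measurable.

(* [L n f] is the integral of the test function [f] against the n-th law. *)
Definition cvg_in_law (L : nat -> (R -> R) -> R) (Y : T -> R) :=
  forall f : R -> R, continuous f -> bounded_fun f ->
    L n f @[n --> \oo] --> \int[P]_w f (Y w).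

End Probability.

(* Batches and customers are numbered from 0 in order of service, so batch n
   and customer k are the (n+1)-st super customer and the (k+1)-st customer;
   [ctype k] and [service k] are the type and the service time of customer k.
   At time 0 the server is about to start and [init_batches] batches are
   present. They are the batches n < init_batches and are given arrival time 0;
   for n >= init_batches, [interarrival n] is the time between the arrival of
   batch n and the preceding one (or time 0 if n = init_batches). *)
Record queue {R : realType} d (T : measurableType d) (P : probability T R)
    (N : nat) := Queue {
  interarrival : nat -> {RV P >-> R};
  batch_size : nat -> {RV P >-> nat};
  init_batches : {RV P >-> nat};
  service : nat -> {RV P >-> R};
  ctype : nat -> T -> 'I_N
}.

Section Dynamics.
Context {R : realType} d (T : measurableType d) (P : probability T R) (N : nat).
Variable q : queue P N.
Implicit Types (n k m : nat) (w : T).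

Definition batch_arrival n w : R :=
  \sum_(0 <= l < n.+1 | (init_batches q w <= l)%N) interarrival q l w.

(* index of the first customer of batch n *)
Definition first n w : nat := (\sum_(0 <= l < n) batch_size q l w)%N.

(* Number of batches all of whose customers precede customer k; batches are
   nonempty, so only batches l < k can qualify. *)
Definition batch_of k w : nat :=
  (\sum_(0 <= l < k) (first l.+1 w <= k))%N.

Definition arrival k w : R := batch_arrival (batch_of k w) w.

(* [dep k] is the departure time of the k-th served customer counted from 1,
   i.e. the time at which the server has completed customers 0, ..., k-1. *)
Fixpoint dep k w : R :=
  if k is k'.+1 then Num.max (arrival k' w) (dep k' w) + service q k' w else 0.

Definition start k w : R := Num.max (arrival k w) (dep k w).

Definition waiting k w : R := start k w - arrival k w.

Definition sojourn k w : R := dep k.+1 w - arrival k w.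

(* Number of customers in the system just after the k-th departure. The set is
   almost surely finite; [fset_set] returns the empty set when it is not. *)
Definition num_left k w : nat :=
  #|` fset_set [set k' | (k <= k')%N /\ arrival k' w <= dep k w]|%fset.

(* Super customers: batch n is served as customers first n, ...,
   first (n+1) - 1. *)

Definition sc_waiting n w : R := start (first n w) w - batch_arrival n w.

Definition sc_sojourn n w : R := dep (first n.+1 w) w - batch_arrival n w.

Definition sc_type n w : 'I_N := ctype q (first n w) w.

(* Number of super customers in the system just after the n-th departure of a
   super customer (same conventions as for [num_left]). *)
Definition sc_num_left n w : nat :=
  #|` fset_set
      [set l | (n <= l)%N /\ batch_arrival l w <= dep (first n w) w]|%fset.

(* the m-th customer of batch n, m >= 1, when batch_size n >= m *)
Definition member n m w : nat := (first n w + m.-1)%N.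

Definition batch_pmf k : \bar R := P [set w | batch_size q 0 w = k].

Definition batch_ge n m : set T := [set w | (m <= batch_size q n w)%N].

Definition mean_batch : \bar R := 'E_P[fun w => (batch_size q 0%N w)%:R].

Definition r_weight m : R :=
  (fine mean_batch)^-1 * fine (\sum_(m <= k <oo) batch_pmf k)%E.

Definition input_events (x : nat + nat + unit) : set (set T) :=
  match x with
  | inl (inl n) => events_of (interarrival q n)
  | inl (inr n) => events_of (batch_size q n)
  | inr tt =>
      preimage_set_system setT (fun w => (init_batches q w, ctype q 0 w)) setT
  end.

(* The past at the start of service of customer k. It contains the whole
   arrival process, so that conditionally on it the service of customer k
   depends on the arrivals only through ctype k and num_left k. *)
Definition past k : set (set T) :=
  <<s (\bigcup_x input_events x) `|`
      (\bigcup_(l in [set l | (l < k)%N])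
         (events_of (service q l) `|`
          preimage_set_system setT (ctype q l.+1) setT)) >>.

(* Law of (service k, ctype k.+1) given the past, on the event that ctype k = i
   and num_left k satisfies [p]: its part on {ctype k.+1 = j} is K i j. *)
Definition service_law (p : pred nat)
    (K : 'I_N -> 'I_N -> {measure set R -> \bar R}) :=
  forall k (i j : 'I_N) (H : set T) (A : set R), past k H -> measurable A ->
    let H' := H `&` [set w | ctype q k w = i /\ p (num_left k w)] in
    P (H' `&` [set w | A (service q k w) /\ ctype q k.+1 w = j]) =
    (P H' * K i j A)%E.

Definition semi_markov_kernel (K : 'I_N -> 'I_N -> {measure set R -> \bar R}) :=
  forall i, (\sum_(j < N) K i j setT = 1)%E /\
    forall j, K i j [set x | x < 0] = 0%E.

(* The kernels K and Kstar govern services that do not start, resp. start, a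
   busy period. *)
Record MXSM2_queue (lambda : R)
    (K Kstar : 'I_N -> 'I_N -> {measure set R -> \bar R}) : Prop := {
  measurable_ctype : forall k i, measurable [set w | ctype q k w = i];
  interarrival_exponential : forall n (A : set R), measurable A ->
    P (interarrival q n @^-1` A) = exponential_prob lambda A;
  batch_size_ge1 : forall n w, (1 <= batch_size q n w)%N;
  batch_size_idd : forall n k, P [set w | batch_size q n w = k] = batch_pmf k;
  mean_batch_fin : (mean_batch < +oo)%E;
  inputs_independent : mutually_independent P input_events;
  K_kernel : semi_markov_kernel K;
  Kstar_kernel : semi_markov_kernel Kstar;
  service_busy : service_law (fun x => 1 <= x)%N K;
  service_idle : service_law (fun x => x == 0)%N Kstar
}.

Section Limits.
Context d' (T' : measurableType d') (Q : probability T' R).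

(* In a countable discrete space, convergence in law to a probability amounts to
   convergence of the point masses. *)
Definition sc_state_limit (Xd : T' -> nat) (Jd : T' -> 'I_N) :=
  forall x i, P [set w | sc_num_left n w = x /\ sc_type n w = i] @[n --> \oo] -->
    Q [set v | Xd v = x /\ Jd v = i].

Definition sc_limit (V : nat -> T -> R) (Y : T' -> R) :=
  cvg_in_law Q (fun n f => \int[P]_w f (V n w)) Y.

(* The m-th customer of batch n is considered conditionally on its existence. *)
Definition member_limit (V : nat -> T -> R) m (Y : T' -> R) :=
  cvg_in_law Q (fun n f =>
    (fine (P (batch_ge n m)))^-1 *
      \int[P]_(w in batch_ge n m) f (V (member n m w) w)) Y.

(* A customer sampled uniformly among the first n, as n -> oo. *)
Definition arbitrary_limit (V : nat -> T -> R) (Y : T' -> R) :=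
  cvg_in_law Q (fun n f =>
    n%:R^-1 * \sum_(0 <= k < n) \int[P]_w f (V k w)) Y.

End Limits.

End Dynamics.

Section Transforms.
Context {R : realType} (N : nat) (lambda : R).
Variables K Kstar : 'I_N -> 'I_N -> {measure set R -> \bar R}.
Context d' (T' : measurableType d') (Q : probability T' R).
Variables (Xd : T' -> nat) (Jd : T' -> 'I_N).

Definition Gt s : 'M[R[i]]_N := \matrix_(i, j) lst (K i j) s idfun.

Definition Gtstar s : 'M[R[i]]_N := \matrix_(i, j) lst (Kstar i j) s idfun.

(* max(Xd - 1, 0): subtraction on nat is truncated *)
Definition Xbs (v : T') : nat := (Xd v - 1)%N.

Definition a_coef i : R[i] := ofR (fine (Q [set v | Xd v = 0%N /\ Jd v = i])).

Definition c_coef i s : R[i] :=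
  cintegral Q (fun v => (1 - s / ofR lambda) ^+ (Xd v - 1) *
                        (Jd v == i)%:R * (1 <= Xd v)%N%:R).

(* meaningful for m >= 1 *)
Definition w_transform m s : R[i] :=
  match m with
  | 0 => 0
  | 1 => cintegral Q (fun v => (1 - s / ofR lambda) ^+ Xbs v)
  | _ => \sum_k \sum_j \sum_i a_coef i * Gtstar s i k * (Gt s ^+ (m - 2)) k j
         + \sum_j \sum_i c_coef i s * (Gt s ^+ (m - 1)) i j
  end.

End Transforms.

(* Main.v *)
Require Import Defs.
From HB Require Import structures.
From mathcomp Require Import all_boot all_order all_algebra finmap.
From mathcomp Require Import complex.
From mathcomp Require Import all_classical all_reals all_analysis.
From mathcomp Require Import measurable_realfun ring lra zify.
Set Implicit Arguments.
Unset Strict Implicit.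
Unset Printing Implicit Defensive.
Import Order.TTheory GRing.Theory Num.Theory.
Import numFieldNormedType.Exports.
Local Open Scope classical_set_scope.
Local Open Scope ring_scope.


(* By memorylessness, after the arrival of batch n the later arrivals form a Poisson
   process independent of what determines the time until batch n starts service or
   leaves. The number of super customers that it leaves behind is the number of
   arrivals of this process during the waiting or sojourn time U, so that
   E z^X = E e^(-lambda (1 - z) U); batches present at time 0 are negligible in the
   limit. On the event that the first customer of batch n has type i and finds a busy
   server, the same identity gives c_i, and the complementary event gives a_i. The
   size of batch n is independent of this event, and each further service inside the
   batch multiplies the vector of transforms by a service matrix (Gstar for a service
   that starts a busy period, G otherwise): this gives w_m.

   For an arbitrary customer, the sum of f over the first N customers, with N close
   to n E[B], is compared with the sum over the first n batches, each truncated to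
   its first c members. The error per batch is at most twice the mean excess
   E (B - c)^+, plus the fluctuations of the truncated number of customers, which a
   variance bound makes negligible. With Cesaro means,
   |sum_(m <= c) P(B >= m) E f(W^(m)) - E min(B, c) E f(W)| <= 2 E (B - c)^+, and c
   tends to infinity. *)

(** * Integrals of bounded functions *)

Section BoundedMeasurable.
Context d (T : measurableType d) (R : realType).
Implicit Types (f g : T -> R).

(** The independence behind the memorylessness argument is not a hypothesis. The inputs are
    independent of each other, but service [k] is described only by its law given a past that
    contains the whole arrival process, through the type and through whether [num_left k] vanishes,
    an event that looks at all arrivals. Two facts remove the circularity. On a set of paths of full
    probability, [num_left k = 0] is a comparison of [dep k] with [arrival k]; and for customers of
    the first [b] batches these two times do not change when the later inputs are replaced by
    constants. An induction over services then shows that the history built from early inputs is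
    independent of the late ones. It is carried out at fixed [k] and transferred to the random index
    of the first customer of a batch by summing over the values of that index. The limits are known
    only through bounded continuous test functions, and [exp (- s y)] is unbounded on negative [y]
    when [Re s > 0]. Hence each limit variable is shown to be nonnegative almost surely, and the
    exponential is replaced by its version truncated at 0. *)

Definition bmfun f := measurable_fun setT f /\ exists C, forall x, `|f x| <= C.

Lemma bmfun_cst (c : R) : bmfun (fun=> c).
Proof. by split; [exact: measurable_cst|exists `|c|]. Qed.

Lemma bmfunD f g : bmfun f -> bmfun g -> bmfun (fun x => f x + g x).
Proof.
move=> [mf [C hC]] [mg [D hD]]; split; first exact: measurable_funD.
by exists (C + D) => x; rewrite (le_trans (ler_normD _ _))// lerD.
Qed.

Lemma bmfunN f : bmfun f -> bmfun (fun x => - f x).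
Proof.
move=> [mf [C hC]]; split; first exact: measurableT_comp.
by exists C => x; rewrite normrN.
Qed.

Lemma bmfunB f g : bmfun f -> bmfun g -> bmfun (fun x => f x - g x).
Proof. by move=> bf bg; apply: bmfunD => //; exact: bmfunN. Qed.

Lemma bmfunM f g : bmfun f -> bmfun g -> bmfun (fun x => f x * g x).
Proof.
move=> [mf [C hC]] [mg [D hD]]; split; first exact: measurable_funM.
by exists (C * D) => x; rewrite normrM ler_pM.
Qed.

Lemma bmfun_indic (A : set T) : measurable A -> bmfun \1_A.
Proof.
move=> mA; split; first exact: measurable_indic.
by exists 1 => x; rewrite indicE; case: (_ \in _); rewrite ?normr1 ?normr0.
Qed.

Lemma bmfun_sum I (s : seq I) (F : I -> T -> R) :
  (forall i, bmfun (F i)) -> bmfun (fun x => \sum_(i <- s) F i x).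
Proof.
move=> bF; elim: s => [|i s IH].
  by under [X in bmfun X]eq_fun do rewrite big_nil; exact: bmfun_cst.
by under [X in bmfun X]eq_fun do rewrite big_cons; exact: bmfunD.
Qed.

Lemma bmfun_norm f : bmfun f -> bmfun (fun x => `|f x|).
Proof.
move=> [mf [C hC]]; split; first exact: measurableT_comp.
by exists C => x; rewrite normr_id.
Qed.

End BoundedMeasurable.

Lemma bmfun_comp d (T : measurableType d) d2 (T2 : measurableType d2)
    (R : realType) (f : T2 -> R) (X : T -> T2) :
  bmfun f -> measurable_fun setT X -> bmfun (fun x => f (X x)).
Proof.
move=> [mf [C hC]] mX; split; first exact: measurableT_comp.
by exists C => x.
Qed.

Section BoundedIntegral.
Context d (T : measurableType d) (R : realType).
Variable mu : {measure set T -> \bar R}.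
Hypothesis mufin : (mu setT < +oo)%E.
Implicit Types (D A B : set T) (f g : T -> R).

Lemma mu_lty A : measurable A -> (mu A < +oo)%E.
Proof.
by move=> mA; apply: le_lt_trans mufin; apply: le_measure; rewrite ?inE.
Qed.

Lemma mu_fin A : measurable A -> mu A \is a fin_num.
Proof. by move=> mA; rewrite ge0_fin_numE// mu_lty. Qed.

Lemma bmfun_integrable D f : measurable D -> bmfun f ->
  mu.-integrable D (EFin \o f).
Proof.
move=> mD [mf [C hC]]; apply: measurable_bounded_integrable => //.
- exact: mu_lty.
- exact: measurable_funS mf.
- by exists C; split; [exact: num_real|move=> M CM x _; exact/(le_trans (hC x))/ltW].
Qed.

Lemma bRintegralD D f g : measurable D -> bmfun f -> bmfun g ->
  \int[mu]_(x in D) (f x + g x) = \int[mu]_(x in D) f x + \int[mu]_(x in D) g x.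
Proof. by move=> mD bf bg; apply: RintegralD => //; exact: bmfun_integrable. Qed.

Lemma bRintegralB D f g : measurable D -> bmfun f -> bmfun g ->
  \int[mu]_(x in D) (f x - g x) = \int[mu]_(x in D) f x - \int[mu]_(x in D) g x.
Proof. by move=> mD bf bg; apply: RintegralB => //; exact: bmfun_integrable. Qed.

Lemma bRintegralZl D f r : measurable D -> bmfun f ->
  \int[mu]_(x in D) (r * f x) = r * \int[mu]_(x in D) f x.
Proof. by move=> mD bf; apply: RintegralZl => //; exact: bmfun_integrable. Qed.

Lemma bRintegral_sum D I (s : seq I) (F : I -> T -> R) : measurable D ->
  (forall i, bmfun (F i)) ->
  \int[mu]_(x in D) (\sum_(i <- s) F i x) =
  \sum_(i <- s) \int[mu]_(x in D) F i x.
Proof.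
move=> mD bF; elim: s => [|i s IH].
  rewrite big_nil; under eq_Rintegral do rewrite big_nil.
  by rewrite Rintegral_cst// mul0r.
rewrite big_cons -IH; under eq_Rintegral do rewrite big_cons.
by rewrite bRintegralD//; exact: bmfun_sum.
Qed.

Lemma le_bRintegral D f g : measurable D -> bmfun f -> bmfun g ->
  (forall x, D x -> f x <= g x) ->
  \int[mu]_(x in D) f x <= \int[mu]_(x in D) g x.
Proof. by move=> mD bf bg; apply: le_Rintegral => //; exact: bmfun_integrable. Qed.

Lemma Rintegral_setI_indic D A f : measurable D -> measurable A ->
  \int[mu]_(x in D `&` A) f x = \int[mu]_(x in D) (\1_A x * f x).
Proof.
move=> mD mA; rewrite Rintegral_mkcondr; apply: eq_Rintegral => x _.
by rewrite patchE indicE; case: ifP; rewrite ?mul1r ?mul0r.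
Qed.

Lemma Rintegral_indicE D A : measurable D -> measurable A ->
  \int[mu]_(x in D) \1_A x = fine (mu (D `&` A)).
Proof.
move=> mD mA; have := @Rintegral_setI_indic D A (fun=> 1) mD mA.
under [X in _ = X -> _]eq_Rintegral do rewrite mulr1.
by move=> <-; rewrite Rintegral_cst ?mul1r//; exact: measurableI.
Qed.

Lemma bRintegral_setU D A f : measurable D -> measurable A -> bmfun f ->
  \int[mu]_(x in D) f x =
  \int[mu]_(x in D `&` A) f x + \int[mu]_(x in D `&` ~` A) f x.
Proof.
move=> mD mA bf; have mAC := measurableC mA.
rewrite !Rintegral_setI_indic// -bRintegralD//; last 2 first.
- by apply: bmfunM => //; exact: bmfun_indic.
- by apply: bmfunM => //; exact: bmfun_indic.
apply: eq_Rintegral => x _; rewrite !indicE in_setC.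
by case: (_ \in _); rewrite /= ?mul1r ?mul0r ?addr0 ?add0r.
Qed.

Lemma bRintegral_null D f : measurable D -> bmfun f -> mu D = 0%E ->
  \int[mu]_(x in D) f x = 0.
Proof.
move=> mD [mf _] D0; rewrite /Rintegral null_set_integral//.
by apply/measurable_EFinP; exact: measurable_funS mf.
Qed.

Lemma le_norm_bRintegral D f C : measurable D -> bmfun f ->
  (forall x, D x -> `|f x| <= C) ->
  `|\int[mu]_(x in D) f x| <= C * fine (mu D).
Proof.
move=> mD bf fC; apply: (le_trans (le_normr_Rintegral mD (bmfun_integrable mD bf))).
rewrite -Rintegral_cst//; apply: le_bRintegral => //.
- exact: bmfun_norm.
- exact: bmfun_cst.
Qed.

Lemma eq_bRintegral_ae D A f g : measurable D -> measurable A ->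
  bmfun f -> bmfun g -> mu (~` A) = 0%E ->
  (forall x, D x -> A x -> f x = g x) ->
  \int[mu]_(x in D) f x = \int[mu]_(x in D) g x.
Proof.
move=> mD mA bf bg A0 fg.
rewrite (bRintegral_setU mD mA bf) (bRintegral_setU mD mA bg).
have mAC := measurableC mA.
have mDA : measurable (D `&` ~` A) by exact: measurableI.
have DA0 : mu (D `&` ~` A) = 0%E.
  apply/eqP; rewrite -measure_le0 -A0; apply: le_measure; rewrite ?inE//.
by rewrite !(bRintegral_null mDA)//; congr (_ + _); apply: eq_Rintegral => x;
  rewrite inE => -[]; exact: fg.
Qed.

End BoundedIntegral.

Section Law.
Context d1 d2 (T1 : measurableType d1) (T2 : measurableType d2) (R : realType).
Variables (mu : {measure set T1 -> \bar R}) (D : set T1) (X : T1 -> T2).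
Hypotheses (mD : measurable D) (muD : (mu D < +oo)%E).
Hypothesis (mX : measurable_fun setT X).

(** A measure of total mass [mu D]. The hypotheses are arguments of the definition so that the
    measure structure declared below can be recovered from the term. *)
Definition law of measurable D & (mu D < +oo)%E & measurable_fun setT X :=
  fun A : set T2 => mu (D `&` X @^-1` A).

Local Notation L := (law mD muD mX).

Let L0 : L set0 = 0%E.
Proof. by rewrite /law preimage_set0 setI0 measure0. Qed.

Let Lge0 A : (0 <= L A)%E. Proof. exact: measure_ge0. Qed.

Let mXA A : measurable A -> measurable (X @^-1` A).
Proof. by move=> mA; rewrite -[X in measurable X]setTI; exact: mX. Qed.

Let Lsigma : semi_sigma_additive L.
Proof.
move=> F mF tF mUF; rewrite /law preimage_bigcup setI_bigcupr.
apply: measure_semi_sigma_additive.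
- by move=> n; apply: measurableI => //; exact: mXA.
- apply/trivIsetP => /= i j _ _ ij; rewrite setIACA setIid -preimage_setI.
  by move/trivIsetP : tF => /(_ _ _ _ _ ij) ->//; rewrite preimage_set0 setI0.
- by apply: bigcup_measurable => n _; apply: measurableI => //; exact: mXA.
Qed.

HB.instance Definition _ := isMeasure.Build _ _ _ L L0 Lge0 Lsigma.

Let Lfin : fin_num_fun L.
Proof.
move=> A mA; rewrite ge0_fin_numE//; apply: le_lt_trans muD.
by apply: le_measure; rewrite ?inE//; apply: measurableI => //; exact: mXA.
Qed.

HB.instance Definition _ := Measure_isFinite.Build _ _ _ L Lfin.

(** Image measure formula for the restriction of [mu] to [D], whose integrals vanish off [D] and
    agree with those of [mu] on [D]. *)
Lemma Rintegral_law (f : T2 -> R) : bmfun f ->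
  \int[L]_y f y = \int[mu]_(x in D) f (X x).
Proof.
move=> bf; have mDC := measurableC mD.
pose restr : {measure set T1 -> \bar R} := mfrestr mD muD.
have rT : (restr setT < +oo)%E by rewrite /restr/= /mfrestr/mrestr/= setTI.
have bfX : bmfun (fun x => f (X x)) by exact: bmfun_comp.
have i1 := bmfun_integrable rT measurableT bfX.
transitivity (\int[restr]_x f (X x)).
  congr fine.
  have := @integral_pushforward _ _ _ _ R X mX restr setT (EFin \o f).
  rewrite preimage_setT => H.
  rewrite -[RHS]H//; last by apply/measurable_EFinP; case: bf.
  apply: eq_measure_integral => A mA _ /=.
  by rewrite /law /pushforward /restr/= /mfrestr /mrestr setIC.
rewrite (bRintegral_setU rT measurableT mD bfX) setTI.
rewrite [X in _ + X](bRintegral_null _ bfX) ?addr0//; last 2 first.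
- by rewrite setTI.
- by rewrite setTI /restr/= /mfrestr /mrestr setICl measure0.
congr fine; apply: eq_measure_integral => A mA AD /=.
by rewrite /restr/= /mfrestr /mrestr setIidl.
Qed.

End Law.

(** * Laws that factor on rectangles *)

Section ProductLaw.
Context d d1 d2 (T : measurableType d) (T1 : measurableType d1)
  (T2 : measurableType d2) (R : realType).
Variables (mu : {measure set T -> \bar R}) (nu : {measure set T2 -> \bar R}).
Hypotheses (mufin : (mu setT < +oo)%E) (nufin : (nu setT < +oo)%E).
Variables (D D0 : set T) (X : T -> T1) (Y : T -> T2) (c : {nonneg R}).
Hypotheses (mD : measurable D) (mD0 : measurable D0).
Hypotheses (mX : measurable_fun setT X) (mY : measurable_fun setT Y).
Hypothesis prodlaw : forall A B, measurable A -> measurable B ->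
  mu (D `&` X @^-1` A `&` Y @^-1` B) =
  (mu (D0 `&` X @^-1` A) * (c%:num%:E * nu B))%E.

(** Uniqueness of product measures turns the factorisation on rectangles into Fubini's formula. Two
    events and a constant are allowed so that [D] can be [D0] cut by an event independent of [X],
    whose probability is [c], or by an outcome whose probability is part of the kernel [nu]. *)
Lemma product_law (h : T1 * T2 -> R) : bmfun h ->
  \int[mu]_(w in D) h (X w, Y w) =
  c%:num * \int[mu]_(w in D0) \int[nu]_y h (X w, y).
Proof.
move=> bh.
have muD := mu_lty mufin mD; have muD0 := mu_lty mufin mD0.
have mXY : measurable_fun setT (fun w => (X w, Y w)).
  exact: measurable_fun_pair.
pose m : {finite_measure set (T1 * T2)%type -> \bar R} := law mD muD mXY.
pose m1 : {finite_measure set T1 -> \bar R} := law mD0 muD0 mX.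
(* The law of the identity is [nu] itself, bundled as a finite measure. *)
have idT2 : measurable_fun setT (@id T2) by exact: measurable_id.
pose m2 : {finite_measure set T2 -> \bar R} :=
  mscale c (law measurableT nufin idT2).
have m2E B : measurable B -> m2 B = (c%:num%:E * nu B)%E.
  by move=> mB; rewrite /m2/= /mscale/= /law setTI preimage_id.
have mE A : measurable A -> (m1 \x m2)%E A = m A.
  apply: product_measure_unique => A1 B1 mA1 mB1.
  transitivity (m1 A1 * m2 B1)%E; last by [].
  rewrite m2E// -[m1 A1]/(mu (D0 `&` X @^-1` A1)) -prodlaw//; congr (mu _).
  by apply/seteqP; split => w /= [] => [? [? ?]|[? ?] ?].
rewrite -[LHS](Rintegral_law mD muD mXY bh).
transitivity (\int[(m1 \x m2)%E]_z h z).
  by congr fine; apply: eq_measure_integral => A mA _; exact/esym/mE.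
have ih : (m1 \x m2)%E.-integrable setT (EFin \o h).
  apply: bmfun_integrable => //.
  apply: le_lt_trans (_ : _ <= m setT)%E _; last by rewrite ltey_eq fin_num_measure.
  by rewrite -(mE _ measurableT).
rewrite {1}/Rintegral -integral12_prod_meas1//.
have hx x : bmfun (fun y => h (x, y)).
  case: bh => mh [C hC]; split; last by exists C.
  exact: measurableT_comp.
have nux x : (\int[m2]_y (EFin \o h) (x, y) =
    (c%:num * \int[nu]_y h (x, y))%:E)%E.
  have i2 : m2.-integrable setT (fun y => (h (x, y))%:E).
    apply: bmfun_integrable => //.
    by rewrite ltey_eq fin_num_measure.
  rewrite -[LHS]fineK; last exact: integrable_fin_num.
  congr EFin; rewrite -[LHS]/(\int[m2]_y h (x, y)).
  have mh := (hx x).1; have [_ [C hC]] := hx x.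
  (* The scaling rule for [m2] is applied to nonnegative functions, so [h] is shifted by its bound
     [C]. *)
  transitivity (\int[m2]_y ((h (x, y) + C) - C)).
    by apply: eq_Rintegral => y _; rewrite addrK.
  have m2fin : (m2 setT < +oo)%E by rewrite ltey_eq fin_num_measure.
  have bD : bmfun (fun y => h (x, y) + C) by apply: bmfunD => //; exact: bmfun_cst.
  rewrite bRintegralB//; last exact: bmfun_cst.
  transitivity (\int[nu]_y (c%:num * ((h (x, y) + C) - C))); last first.
    by under eq_Rintegral do rewrite addrK; rewrite bRintegralZl.
  under [RHS]eq_Rintegral do rewrite mulrBr.
  rewrite bRintegralB//; last 2 first.
  - by apply: bmfunM => //; exact: bmfun_cst.
  - exact: bmfun_cst.
  have ge0 (f : T2 -> R) : bmfun f -> (forall y, 0 <= f y) ->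
      \int[m2]_y f y = \int[nu]_y (c%:num * f y).
    move=> bf f0; rewrite bRintegralZl//.
    rewrite {1}/Rintegral ge0_integral_mscale//; last 2 first.
      by apply/measurable_EFinP; exact: bf.1.
      by move=> y _; rewrite lee_fin.
    rewrite fineM//; last first.
      apply: integrable_fin_num => //; apply: bmfun_integrable => //=.
      by rewrite /law setTI preimage_setT.
    congr (_ * _); rewrite -[LHS]/(Rintegral (law measurableT nufin idT2) setT f).
    by rewrite Rintegral_law.
  congr (_ - _); apply: ge0 => //.
  - by move=> y; rewrite -lerBlDr sub0r lerNl (le_trans _ (hC y))// -normrN ler_norm.
  - exact: bmfun_cst.
  - by move=> y; apply: le_trans (hC y).
under eq_integral do rewrite /fubini_F nux.
rewrite -[LHS]/(\int[m1]_x (c%:num * \int[nu]_y h (x, y))).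
have bI : bmfun (fun x => \int[nu]_y h (x, y)).
  split; last first.
    case: bh => mh [C hC]; exists (C * fine (nu setT)) => x.
    exact: le_norm_bRintegral.
  pose nu' : {finite_measure set T2 -> \bar R} := law measurableT nufin idT2.
  have i' : (m1 \x nu')%E.-integrable setT (EFin \o h).
    apply: bmfun_integrable => //.
    apply: le_lt_trans (_ : _ <= m1 setT * nu' setT)%E _.
      have := product_measure1E m1 nu' (@measurableT _ T1) (@measurableT _ T2).
      by rewrite setXTT => e; rewrite -e.
    by rewrite ltey_eq fin_numM// fin_num_measure.
  have := measurable_fubini_F i'.
  move=> mF; apply: (@eq_measurable_fun _ _ _ _ _ (fine \o fubini_F nu' (EFin \o h))).
    move=> x _ /=; rewrite /fubini_F -[LHS]/(\int[nu']_y h (x, y)).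
    by rewrite Rintegral_law.
  exact: measurableT_comp.
rewrite bRintegralZl//; last by rewrite ltey_eq fin_num_measure.
by rewrite Rintegral_law.
Qed.

End ProductLaw.

(** * Exponential spacings and Poisson counts *)

Section MeasurableSets.
Context d (T : measurableType d) (R : realType).

Lemma measurable_preimageT d2 (T2 : measurableType d2) (X : T -> T2) A :
  measurable_fun setT X -> measurable A -> measurable (X @^-1` A).
Proof. by move=> mX mA; rewrite -[X in measurable X]setTI; exact: mX. Qed.

Lemma measurable_set_bool (b : T -> bool) :
  measurable_fun setT b -> measurable [set w | b w].
Proof.
move=> mb; rewrite -[X in measurable X]/(b @^-1` [set true]).
exact: measurable_preimageT.
Qed.

Lemma measurable_set_le (f g : T -> R) :
  measurable_fun setT f -> measurable_fun setT g ->
  measurable [set w | f w <= g w].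
Proof. by move=> mf mg; exact/measurable_set_bool/measurable_fun_ler. Qed.

Lemma measurable_set_lt (f g : T -> R) :
  measurable_fun setT f -> measurable_fun setT g ->
  measurable [set w | f w < g w].
Proof. by move=> mf mg; exact/measurable_set_bool/measurable_fun_ltr. Qed.

End MeasurableSets.

(** [p] and the Radon-Nikodym derivative of [nu] have the same integral over every measurable set,
    hence agree almost everywhere; the change of variables holds for the latter. *)
Lemma density_Rintegral (R : realType) (nu : {finite_measure set (measurableTypeR R) -> \bar R})
    (p f : measurableTypeR R -> R) :
  (forall x, 0 <= p x) ->
  lebesgue_measure.-integrable setT (EFin \o p) ->
  (forall A : set (measurableTypeR R), measurable A ->
     nu A = (\int[lebesgue_measure]_(x in A) (p x)%:E)%E) ->
  bmfun f ->
  \int[nu]_x f x = \int[lebesgue_measure]_x (f x * p x).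
Proof.
move=> p0 ip nuE bf.
have mp : measurable_fun setT (EFin \o p) := measurable_int _ ip.
have dom : nu `<< (@lebesgue_measure R).
  apply/null_content_dominatesP => A mA A0; rewrite nuE// null_set_integral//.
  exact: measurable_funS mp.
congr fine.
have nufin : (nu setT < +oo)%E by rewrite ltey_eq fin_num_measure.
have inu := bmfun_integrable nufin measurableT bf.
have mf : measurable_fun setT (EFin \o f) := measurable_int _ inu.
have := @Radon_Nikodym_change_of_variables _ _ R nu lebesgue_measure dom _ setT measurableT inu.
move=> <-.
under [RHS]eq_integral do rewrite EFinM.
have iRN : lebesgue_measure.-integrable setT
    (Radon_Nikodym (charge_of_finite_measure nu) (@lebesgue_measure R)).
  exact: Radon_Nikodym_integrable.
apply: ae_eq_integral => //.
- apply: emeasurable_funM => //; exact: measurable_int iRN.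
- by apply: emeasurable_funM.
- apply: ae_eqe_mul2l.
  apply: integral_ae_eq => // E _ mE.
  by rewrite -Radon_Nikodym_integral// -nuE.
Qed.

Section PoissonCount.
Context (R : realType) (lambda : R).
Hypothesis lambda_gt0 : 0 < lambda.

Definition pois (j : nat) (x : R) : R :=
  expR (- lambda * x) * ((lambda * x) ^+ j / j`!%:R).

Lemma sum_exp_coeff_le (x : R) n : 0 <= x ->
  \sum_(0 <= k < n) x ^+ k / k`!%:R <= expR x.
Proof.
move=> x0; apply: (@nondecreasing_cvgn_le R (series (exp_coeff x))).
  apply/nondecreasing_seqP => m; rewrite /series/= big_nat_recr//= lerDl.
  exact: exp_coeff_ge0.
exact: is_cvg_series_exp_coeff.
Qed.

Lemma pois_ge0 j x : 0 <= x -> 0 <= pois j x.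
Proof.
by move=> x0; rewrite mulr_ge0 ?expR_ge0// divr_ge0// exprn_ge0// mulr_ge0// ltW.
Qed.

Lemma sum_pois_le1 n x : 0 <= x -> \sum_(0 <= j < n) pois j x <= 1.
Proof.
move=> x0; rewrite -mulr_sumr mulNr expRN -ler_pdivlMl ?invr_gt0 ?expR_gt0//.
by rewrite mulr1 invrK sum_exp_coeff_le// mulr_ge0// ltW.
Qed.

Lemma pois_le1 j x : 0 <= x -> pois j x <= 1.
Proof.
move=> x0; apply: le_trans (sum_pois_le1 j.+1 x0).
rewrite big_nat_recr//= lerDr sumr_ge0// => i _; exact: pois_ge0.
Qed.

Lemma pois0 x : pois 0 x = expR (- lambda * x).
Proof. by rewrite /pois expr0 divr1 mulr1. Qed.

Lemma poisS0 j : pois j.+1 0 = 0.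
Proof. by rewrite /pois !mulr0 expr0n mul0r mulr0. Qed.

Lemma continuous_pois j : continuous (pois j).
Proof.
move=> x; rewrite /pois; apply: cvgM.
  by apply: continuous_comp; [apply: cvgMr; exact: cvg_id|exact: continuous_expR].
apply: cvgMl; apply: (@continuous_comp _ _ _ (fun x => lambda * x) (fun x => x ^+ j)).
  by apply: cvgMr; exact: cvg_id.
exact: exprn_continuous.
Qed.

Lemma measurable_pois j : measurable_fun setT (pois j).
Proof. by apply: continuous_measurable_fun; exact: continuous_pois. Qed.

Lemma bmfun_pois_pos j : bmfun (fun x : R => \1_`[0, +oo[%classic x * pois j x).
Proof.
split.
  by apply: measurable_funM; [exact: measurable_indic|exact: measurable_pois].
exists 1 => x; rewrite indicE; have [|_] := boolP (_ \in _).
  rewrite inE/= in_itv/= andbT => x0.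
  by rewrite mul1r ger0_norm ?pois_ge0// pois_le1.
by rewrite mul0r normr0.
Qed.

(** This is the renewal equation at the first point [y]. The two exponentials combine into the
    constant [exp (- lambda x)]; what remains is polynomial in [y], with the antiderivative [F],
    which is 0 at [x] and [- pois j.+1 x] at 0. *)
Lemma pois_convolution j (x : R) : 0 <= x ->
  \int[lebesgue_measure]_(y in `[0, x]) (pois j (x - y) * exponential_pdf lambda y)
  = pois j.+1 x.
Proof.
rewrite le_eqVlt => /predU1P[<-|x0].
  by rewrite set_itv1 Rintegral_set1 poisS0.
pose f (y : R) := expR (- lambda * x) * lambda * ((lambda * (x - y)) ^+ j / j`!%:R).
pose F (y : R) := - (expR (- lambda * x) * ((lambda * (x - y)) ^+ j.+1 / j.+1`!%:R)).
have dF y : is_derive y (1 : R) F (f y).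
  have j1 : j.+1%:R != 0 :> R by rewrite pnatr_eq0.
  have j2 : j`!%:R != 0 :> R by rewrite pnatr_eq0 -lt0n fact_gt0.
  pose g (y : R) := lambda * (x - y).
  have dg : is_derive y (1 : R) g (- lambda).
    by apply: is_derive_eq; rewrite /GRing.scale/=; ring.
  have := is_deriveZ (- (expR (- lambda * x) / j.+1`!%:R)) (is_deriveX j.+1 dg).
  rewrite (_ : (_ \*: _)%R = F); last first.
    apply/funext => z; transitivity
      (- (expR (- lambda * x) / j.+1`!%:R) * (lambda * (x - z)) ^+ j.+1).
      by rewrite !fctE.
    by rewrite /F; ring.
  move=> dF; apply: is_derive_eq.
  transitivity (- (expR (- lambda * x) / j.+1`!%:R) *
    ((j.+1%:R * (lambda * (x - y)) ^+ j) * (- lambda))); first by [].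
  rewrite /f factS natrM.
  by field; rewrite j2 -?natr1 addrC natr1 j1.
have -> : \int[lebesgue_measure]_(y in `[0, x])
    (pois j (x - y) * exponential_pdf lambda y) =
    \int[lebesgue_measure]_(y in `[0, x]) f y.
  apply: eq_Rintegral => y; rewrite inE/= in_itv/= => /andP[y0 yx].
  rewrite exponential_pdfE// /pois /f.
  have -> : expR (- lambda * x) = expR (- lambda * (x - y)) * expR (- lambda * y).
    by rewrite -expRD; congr expR; ring.
  by ring.
have cF : continuous F.
  by move=> y; apply: differentiable_continuous; apply/derivable1_diffP; case: (dF y).
have cf : continuous f.
  move=> y; apply: cvgMr; apply: cvgMl.
  apply: (@continuous_comp _ _ _ (fun y => lambda * (x - y)) (fun x => x ^+ j)).
    apply: cvgMr; apply: cvgB; [exact: cvg_cst|exact: cvg_id].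
  exact: exprn_continuous.
rewrite /Rintegral (@continuous_FTC2 _ f F 0 x)//.
- have -> : F x = 0 by rewrite /F subrr mulr0 expr0n mul0r mulr0 oppr0.
  have -> : F 0 = - pois j.+1 x by rewrite /F subr0.
  by rewrite -EFinB/= sub0r opprK.
- by apply: continuous_subspaceT.
- split.
  + by move=> y _; case: (dF y).
  + by apply: cvg_at_right_filter; exact: cF.
  + by apply: cvg_at_left_filter; exact: cF.
- by move=> y _; rewrite derive1E; case: (dF y).
Qed.

Variable nu : {finite_measure set (measurableTypeR R) -> \bar R}.
Hypothesis nuE : forall A : set (measurableTypeR R), measurable A ->
  nu A = exponential_prob lambda A.

Lemma exponential_law_lt0 : nu `]-oo, 0[%classic = 0%E.
Proof.
rewrite nuE//; apply: integral0_eq => x /=; rewrite in_itv/= => x0.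
by rewrite lt0_exponential_pdf.
Qed.

Lemma exponential_lawT : nu setT = 1%E.
Proof. by rewrite nuE// /exponential_prob integral_exponential_pdf. Qed.

Lemma exponential_law_gt (x : R) : 0 <= x ->
  nu `]x, +oo[%classic = (expR (- lambda * x))%:E.
Proof.
move=> x0.
have h0 : nu `[0, x]%classic = (1 - expR (- lambda * x))%:E.
  move: x0; rewrite le_eqVlt => /predU1P[<-|x0].
    by rewrite set_itv1 mulr0 expR0 subrr nuE// /exponential_prob integral_set1.
  by rewrite nuE// exponential_prob_itv0c// EFinB.
pose A : set (measurableTypeR R) := `]-oo, 0[%classic.
pose B : set (measurableTypeR R) := `[0, x]%classic.
pose C : set (measurableTypeR R) := `]x, +oo[%classic.
have mA : measurable A by exact: measurable_itv.
have mB : measurable B by exact: measurable_itv.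
have mC : measurable C by exact: measurable_itv.
have UE : setT = A `|` (B `|` C).
  apply/seteqP; split => y //= _; rewrite /A/B/C/= !in_itv/= !andbT.
  by case: (ltP y 0) => y0; [left|right; case: (leP y x) => yx; [left|right]].
have := exponential_lawT.
rewrite {1}UE measureU//; last 2 first.
- exact: measurableU.
- apply/seteqP; split => y //= []; rewrite /A/B/C/= !in_itv/= !andbT => y0.
  by case=> [/andP[]|]; lra.
rewrite measureU//; last first.
  apply/seteqP; split => y //= []; rewrite /B/C/= !in_itv/= !andbT.
  by move=> /andP[]; lra.
move=> sum1; have {sum1} : (nu A + (nu B + nu C))%E = 1%E := sum1.
rewrite -[nu C]fineK ?fin_num_measure//.
rewrite [nu A]exponential_law_lt0 [nu B]h0 add0e -EFinD => -[] h.
by congr EFin; lra.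
Qed.

Lemma exponential_law_pois j (x : R) : 0 <= x ->
  \int[nu]_y (\1_[set y : R | 0 <= y <= x] y * pois j (x - y)) = pois j.+1 x.
Proof.
move=> x0.
have Exy : [set y : R | 0 <= y <= x] = `[0, x]%classic.
  by apply/seteqP; split => y /=; rewrite in_itv.
have bm : bmfun (fun y : R => \1_[set y : R | 0 <= y <= x] y * pois j (x - y)).
  rewrite Exy; split.
    apply: measurable_funM; first exact: measurable_indic.
    apply: measurableT_comp; first exact: measurable_pois.
    exact: measurable_funB.
  exists 1 => y; rewrite indicE; have [|_] := boolP (_ \in _).
    rewrite inE/= in_itv/= => /andP[y0 yx].
    by rewrite mul1r ger0_norm ?pois_ge0 ?pois_le1// subr_ge0.
  by rewrite mul0r normr0.
rewrite (@density_Rintegral _ nu (exponential_pdf lambda))//; last 2 first.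
- by move=> y; rewrite exponential_pdf_ge0// ltW.
- exact: integrable_exponential_pdf.
rewrite -pois_convolution// [RHS]Rintegral_mkcond; apply: eq_Rintegral => y _.
by rewrite Exy patchE indicE; case: ifP; rewrite ?mul1r// !mul0r.
Qed.

End PoissonCount.

(* [count_in j x t]: a point process with successive spacings [t] has exactly
   [j] points in [0, x]. *)
Fixpoint count_in (R : realType) (j : nat) (x : R) (t : nat -> R) : bool :=
  if j is j'.+1 then (0 <= t 0%N <= x) && count_in j' (x - t 0%N) (fun l => t l.+1)
  else 0 <= x < t 0%N.

Lemma in_set_bool (T : Type) (b : T -> bool) (x : T) :
  (x \in [set z | b z]) = b x.
Proof. by apply/idP/idP; rewrite inE. Qed.

Section PoissonLaw.
Context (R : realType) (lambda : R) (lambda_gt0 : 0 < lambda).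
Variable nu : {finite_measure set (measurableTypeR R) -> \bar R}.
Hypothesis nuE : forall A : set (measurableTypeR R), measurable A ->
  nu A = exponential_prob lambda A.
Context d (T : measurableType d) (mu : {measure set T -> \bar R}).
Hypothesis mufin : (mu setT < +oo)%E.

(** The spacings are i.i.d. with law [nu] and independent of what [D] and [S] determine, tested on
    rectangles. [D] is an unnormalised event rather than a conditioning, so that the property
    survives when [D] is cut by a condition on [S] and the first spacing. *)
Definition indep_spacings (D : set T) (S : T -> measurableTypeR R)
    (t : nat -> T -> measurableTypeR R) :=
  forall j (A : set (measurableTypeR R)) (B : nat -> set (measurableTypeR R)),
    measurable A -> (forall l, measurable (B l)) ->
    mu (D `&` S @^-1` A `&` [set w | forall l, (l < j)%N -> B l (t l w)]) =
    (mu (D `&` S @^-1` A) * \prod_(l < j) nu (B l))%E.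

Lemma measurable_spacings j (t : nat -> T -> measurableTypeR R)
    (B : nat -> set (measurableTypeR R)) :
  (forall l, measurable_fun setT (t l)) -> (forall l, measurable (B l)) ->
  measurable [set w | forall l, (l < j)%N -> B l (t l w)].
Proof.
move=> mt mB.
rewrite (_ : [set _ | _] = \bigcap_(l in [set l | (l < j)%N]) (t l @^-1` B l)).
  by apply: bigcap_measurableType => l _; exact: measurable_preimageT.
by apply/seteqP; split => w /= h l; exact: h.
Qed.

Lemma measurable_count_in j (S : T -> measurableTypeR R)
    (t : nat -> T -> measurableTypeR R) :
  measurable_fun setT S -> (forall l, measurable_fun setT (t l)) ->
  measurable [set w | count_in j (S w) (t ^~ w)].
Proof.
elim: j S t => [|j IH] S t mS mt /=.
  rewrite (_ : [set _ | _] = [set w | 0 <= S w] `&` [set w | S w < t 0%N w]).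
    apply: measurableI; first exact: measurable_set_le.
    by apply: measurable_set_lt => //; exact: mt.
  by apply/seteqP; split => w /= /andP.
rewrite (_ : [set _ | _] = [set w | 0 <= t 0%N w] `&` [set w | t 0%N w <= S w] `&`
    [set w | count_in j (S w - t 0%N w) (fun l => t l.+1 w)]).
  apply: measurableI; last first.
    apply: (IH (fun w => S w - t 0%N w) (fun l => t l.+1)) => [|l]; last exact: mt.
    exact: (measurable_funB mS (mt 0%N)).
  by apply: measurableI; apply: measurable_set_le => //; exact: mt.
by apply/seteqP; split => w /= [] => [/andP[/andP[]]|[? ?] ->]; rewrite ?andbT//;
  apply/andP.
Qed.

Lemma prod_nu_fin j (B : nat -> set (measurableTypeR R)) :
  (forall l, measurable (B l)) ->
  (\prod_(l < j) nu (B l))%E = (\prod_(l < j) fine (nu (B l)))%:E.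
Proof.
move=> mB; elim/big_rec2 : _ => //= i y1 y2 _ ->.
by rewrite EFinM fineK// fin_num_measure.
Qed.

Lemma prod_nu_ge0 j (B : nat -> set (measurableTypeR R)) :
  0 <= \prod_(l < j) fine (nu (B l)).
Proof. by apply: prodr_ge0 => l _; rewrite fine_ge0. Qed.

Variables (D : set T) (S : T -> measurableTypeR R)
  (t : nat -> T -> measurableTypeR R).
Hypotheses (mD : measurable D) (mS : measurable_fun setT S).
Hypotheses (mt : forall l, measurable_fun setT (t l)).
Hypothesis indep : indep_spacings D S t.

(** One spacing is set apart from the [j] that follow it; these contribute only the constant factor
    in [product_law]. *)
Lemma indep_spacings_law j B (h : measurableTypeR R * measurableTypeR R -> R) :
  (forall l, measurable (B l)) -> bmfun h ->
  \int[mu]_(w in D `&` [set w | forall l, (l < j)%N -> B l (t l.+1 w)])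
     h (S w, t 0%N w) =
  (\prod_(l < j) fine (nu (B l))) *
     \int[mu]_(w in D) \int[nu]_y h (S w, y).
Proof.
move=> mB bh.
apply: (@product_law _ _ _ T _ _ R mu nu mufin _ _ _ S (t 0%N)
  (NngNum (prod_nu_ge0 j B))) => //.
- by rewrite ltey_eq fin_num_measure.
- apply: measurableI => //; apply: (@measurable_spacings _ (fun l => t l.+1)) => //.
move=> A B0 mA mB0 /=.
have mB' l : measurable ((if l is l'.+1 then B l' else B0) : set (measurableTypeR R)).
  by case: l.
have := @indep j.+1 A (fun l => if l is l'.+1 then B l' else B0) mA mB'.
rewrite big_ord_recl/= -prod_nu_fin// [(nu B0 * _)%E]muleC => <-//.
congr (mu _); apply/seteqP; split => w /=.
  by move=> [[[Dw h1] h2] h3]; split => // -[|l] //; exact: h1.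
move=> [[Dw h1] h2]; do !split => //; last exact: (h2 0%N).
by move=> l lj; exact: (h2 l.+1).
Qed.

End PoissonLaw.

Section PoissonLawInduction.
Context (R : realType) (lambda : R) (lambda_gt0 : 0 < lambda).
Variable nu : {finite_measure set (measurableTypeR R) -> \bar R}.
Hypothesis nuE : forall A : set (measurableTypeR R), measurable A ->
  nu A = exponential_prob lambda A.
Context d (T : measurableType d) (mu : {measure set T -> \bar R}).
Hypothesis mufin : (mu setT < +oo)%E.

Lemma indep_spacings0 (D : set T) (S : T -> measurableTypeR R)
    (t : nat -> T -> measurableTypeR R)
    (h : measurableTypeR R * measurableTypeR R -> R) :
  measurable D -> measurable_fun setT S -> (forall l, measurable_fun setT (t l)) ->
  indep_spacings nu mu D S t -> bmfun h ->
  \int[mu]_(w in D) h (S w, t 0%N w) = \int[mu]_(w in D) \int[nu]_y h (S w, y).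
Proof.
move=> mD mS mt ind bh.
have := @indep_spacings_law _ nu _ _ _ mufin D S t mD mS mt ind 0 (fun=> setT) h
  (fun=> measurableT) bh.
rewrite big_ord0 mul1r => <-; congr (Rintegral _ _ _).
by apply/seteqP; split => w //= [].
Qed.

(** Restart of the process at its first point. The new event and the new [S] depend only on [S] and
    the first spacing, so that the condition is membership in a planar set [C], and the later
    spacings factor out. *)
Lemma indep_spacings_shift (D : set T) (S : T -> measurableTypeR R)
    (t : nat -> T -> measurableTypeR R) :
  measurable D -> measurable_fun setT S -> (forall l, measurable_fun setT (t l)) ->
  indep_spacings nu mu D S t ->
  indep_spacings nu mu (D `&` [set w | 0 <= t 0%N w <= S w])
    (fun w => S w - t 0%N w) (fun l => t l.+1).
Proof.
move=> mD mS mt ind j A B mA mB.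
pose C : set (measurableTypeR R * measurableTypeR R) :=
  [set z | 0 <= z.2 <= z.1 /\ A (z.1 - z.2)].
have mfst := @measurable_fst _ _ (measurableTypeR R) (measurableTypeR R).
have msnd := @measurable_snd _ _ (measurableTypeR R) (measurableTypeR R).
have mC : measurable C.
  rewrite (_ : C = [set z | 0 <= z.2] `&` [set z | z.2 <= z.1] `&`
      ((fun z => z.1 - z.2) @^-1` A)).
    apply: measurableI; last first.
      by apply: measurable_preimageT => //; exact: measurable_funB.
    by apply: measurableI; exact: measurable_set_le.
  apply/seteqP; split => z /=; first by move=> [/andP[]].
  by move=> [[h1 h2] h3]; split => //; exact/andP.
pose F := [set w | forall l, (l < j)%N -> B l (t l.+1 w)].
have mF : measurable F by exact: (@measurable_spacings _ _ _ _ (fun l => t l.+1)).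
pose E := [set w | C (S w, t 0%N w)].
have mE : measurable E.
  exact: (measurable_preimageT (measurable_fun_pair mS (mt 0%N)) mC).
have bC := bmfun_indic R mC.
have := @indep_spacings_law _ nu _ _ _ mufin D S t mD mS mt ind j B _ mB bC.
rewrite -(indep_spacings0 mD mS mt ind bC) -/F.
rewrite -[X in X = _ -> _]/(\int[mu]_(w in D `&` F) \1_E w).
rewrite -[X in _ = _ * X -> _]/(\int[mu]_(w in D) \1_E w).
have mDF : measurable (D `&` F) by exact: measurableI.
rewrite !Rintegral_indicE// => H.
rewrite (_ : _ `&` _ = D `&` F `&` E); last first.
  apply/seteqP; split => w /=.
    by move=> [[[Dw h1] h2] h3].
  by move=> [[Dw h3] [h1 h2]].
rewrite (_ : _ `&` _ `&` (fun w => S w - t 0%N w) @^-1` A = D `&` E); last first.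
  by apply/seteqP; split => w /=; [move=> [[]]|move=> [? []]].
rewrite -[LHS]fineK ?mu_fin//; last by apply: measurableI => //; exact: measurableI.
rewrite H EFinM muleC -prod_nu_fin// fineK// mu_fin//; exact: measurableI.
Qed.

(** Induction on the number of points: restart at the first one, integrate it out, and recognise the
    renewal equation at each fixed value of [S]. The indicator covers negative [S], for which no
    count holds. *)
Lemma poisson_law j (D : set T) (S : T -> measurableTypeR R)
    (t : nat -> T -> measurableTypeR R) :
  measurable D -> measurable_fun setT S -> (forall l, measurable_fun setT (t l)) ->
  indep_spacings nu mu D S t ->
  fine (mu (D `&` [set w | count_in j (S w) (t ^~ w)])) =
  \int[mu]_(w in D) (\1_`[0, +oo[%classic (S w) * pois lambda j (S w)).
Proof.
elim: j D S t => [|j IH] D S t mD mS mt ind.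
  pose C : set (measurableTypeR R * measurableTypeR R) := [set z | 0 <= z.1 < z.2].
  have mfst := @measurable_fst _ _ (measurableTypeR R) (measurableTypeR R).
  have msnd := @measurable_snd _ _ (measurableTypeR R) (measurableTypeR R).
  have mC : measurable C.
    rewrite (_ : C = [set z | 0 <= z.1] `&` [set z | z.1 < z.2]).
      by apply: measurableI; [exact: measurable_set_le|exact: measurable_set_lt].
    by apply/seteqP; split => z /= /andP.
  have := indep_spacings0 mD mS mt ind (bmfun_indic R mC).
  rewrite -[X in X = _ -> _]/(\int[mu]_(w in D) \1_([set w | C (S w, t 0%N w)]) w).
  rewrite Rintegral_indicE//; last first.
    exact: (measurable_preimageT (measurable_fun_pair mS (mt 0%N)) mC).
  rewrite /C/= => ->; apply: eq_Rintegral => w _.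
  rewrite indicE mem_setE in_itv/= andbT; have [S0|S0] := boolP (0 <= S w).
    rewrite mul1r pois0.
    rewrite (_ : (fun y => _) = \1_`](S w), +oo[%classic); last first.
      by apply/funext => y; rewrite !indicE !in_set_bool/= in_itv/= S0 andbT.
    rewrite Rintegral_indicE// setTI.
    exact: (congr1 fine (exponential_law_gt lambda_gt0 nuE S0)).
  rewrite mul0r (_ : (fun y => _) = cst 0) ?Rintegral_cst ?mul0r//.
  by apply/funext => y; rewrite indicE in_set_bool/= (negbTE S0).
pose D' := D `&` [set w | 0 <= t 0%N w <= S w].
have mE : measurable [set w | 0 <= t 0%N w <= S w].
  rewrite (_ : [set _ | _] = [set w | 0 <= t 0%N w] `&` [set w | t 0%N w <= S w]).
    by apply: measurableI; apply: measurable_set_le => //; exact: mt.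
  by apply/seteqP; split => w /= /andP.
have mD' : measurable D' by exact: measurableI.
have mS' := measurable_funB mS (mt 0%N).
have := IH D' _ _ mD' mS' (fun l => mt l.+1) (indep_spacings_shift mD mS mt ind).
rewrite (_ : D' `&` _ = D `&` [set w | count_in j.+1 (S w) (t ^~ w)]); last first.
  apply/seteqP; split => w /=; first by move=> [[? ->] ->].
  by move=> [? /andP[]].
move=> ->.
pose C : set (measurableTypeR R * measurableTypeR R) := [set z | 0 <= z.2 <= z.1].
pose h (z : measurableTypeR R * measurableTypeR R) : R :=
  \1_C z * pois lambda j (z.1 - z.2).
have mfst := @measurable_fst _ _ (measurableTypeR R) (measurableTypeR R).
have msnd := @measurable_snd _ _ (measurableTypeR R) (measurableTypeR R).
have mC : measurable C.
  rewrite (_ : C = [set z | 0 <= z.2] `&` [set z | z.2 <= z.1]).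
    by apply: measurableI; exact: measurable_set_le.
  by apply/seteqP; split => z /= /andP.
have bh : bmfun h.
  split.
    apply: measurable_funM; first exact: measurable_indic.
    apply: measurableT_comp; first exact: measurable_pois.
    exact: measurable_funB.
  exists 1 => z; rewrite /h indicE; have [|_] := boolP (_ \in _).
    rewrite inE/= => /andP[y0 yx].
    by rewrite mul1r ger0_norm ?pois_ge0 ?pois_le1// subr_ge0.
  by rewrite mul0r normr0.
rewrite Rintegral_setI_indic//.
transitivity (\int[mu]_(w in D) h (S w, t 0%N w)).
  apply: eq_Rintegral => w _; rewrite /h !indicE !in_set_bool/=.
  have [/andP[h1 h2]|_] := boolP (_ <= _ <= _); last by rewrite !mul0r.
  by rewrite !mul1r in_itv/= subr_ge0 h2 mul1r.
rewrite indep_spacings0//; apply: eq_Rintegral => w _.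
rewrite indicE mem_setE in_itv/= andbT; have [S0|S0] := boolP (0 <= S w).
  by rewrite mul1r -(exponential_law_pois lambda_gt0 nuE).
rewrite mul0r (_ : (fun y => _) = cst 0) ?Rintegral_cst ?mul0r//.
apply/funext => y; rewrite /h indicE in_set_bool/=; have [/andP[y0 yx]|_] := boolP (_ <= _ <= _); last by rewrite mul0r.
by rewrite (le_trans y0 yx) in S0.
Qed.

End PoissonLawInduction.

(** * Complex exponentials and complex-valued integrals *)

Section ComplexParts.
Context (R : realType).
Implicit Types (x y z : R[i]).
Local Notation Re := complex.Re.
Local Notation Im := complex.Im.

Lemma eq_complexP x y : Re x = Re y -> Im x = Im y -> x = y.
Proof. by case: x y => [a b] [c e] /= -> ->. Qed.

Lemma cReD x y : Re (x + y) = Re x + Re y. Proof. by case: x y => [? ?] []. Qed.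
Lemma cImD x y : Im (x + y) = Im x + Im y. Proof. by case: x y => [? ?] []. Qed.
Lemma cReN x : Re (- x) = - Re x. Proof. by case: x. Qed.
Lemma cImN x : Im (- x) = - Im x. Proof. by case: x. Qed.
Lemma cReM x y : Re (x * y) = Re x * Re y - Im x * Im y.
Proof. by case: x y => [? ?] []. Qed.
Lemma cImM x y : Im (x * y) = Re x * Im y + Im x * Re y.
Proof. by case: x y => [? ?] []. Qed.

Lemma cReB x y : Re (x - y) = Re x - Re y. Proof. by rewrite cReD cReN. Qed.
Lemma cImB x y : Im (x - y) = Im x - Im y. Proof. by rewrite cImD cImN. Qed.

Lemma cRe_sum I (s : seq I) (F : I -> R[i]) :
  Re (\sum_(i <- s) F i) = \sum_(i <- s) Re (F i).
Proof. by elim: s => [|i s IH]; rewrite ?big_nil// !big_cons cReD IH. Qed.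

Lemma cIm_sum I (s : seq I) (F : I -> R[i]) :
  Im (\sum_(i <- s) F i) = \sum_(i <- s) Im (F i).
Proof. by elim: s => [|i s IH]; rewrite ?big_nil// !big_cons cImD IH. Qed.

Lemma ofR1 : ofR 1 = 1 :> R[i]. Proof. by []. Qed.
Lemma ofRD (a b : R) : ofR (a + b) = ofR a + ofR b.
Proof. by apply: eq_complexP => /=; rewrite ?addr0. Qed.
Lemma ofRM (a b : R) : ofR (a * b) = ofR a * ofR b.
Proof. by apply: eq_complexP => /=; ring. Qed.
Lemma ofR_eq0 (a : R) : (ofR a == 0) = (a == 0).
Proof. by rewrite eq_complex/= eqxx andbT. Qed.

Lemma cexpD x y : cexp (x + y) = cexp x * cexp y.
Proof.
case: x y => [a b] [c e]; apply: eq_complexP => /=;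
  rewrite expRD ?cosD ?sinD; ring.
Qed.

Lemma complex_le1 z : `|z| <= 1 -> Re z ^+ 2 + Im z ^+ 2 <= 1.
Proof.
rewrite normc_def -[1 : R[i]]/((1 : R)%:C%C) lecR => h.
rewrite -[leLHS]sqr_sqrtr ?addr_ge0 ?sqr_ge0//.
by rewrite expr_le1// sqrtr_ge0.
Qed.

Lemma sqr_Re_Im_expr z j :
  Re (z ^+ j) ^+ 2 + Im (z ^+ j) ^+ 2 = (Re z ^+ 2 + Im z ^+ 2) ^+ j.
Proof.
elim: j => [|j IH]; first by rewrite !expr0/= expr0n expr1n addr0.
by rewrite [RHS]exprS -IH (exprS z) cReM cImM; ring.
Qed.

Lemma sqr_norm_le1 (a b : R) : a ^+ 2 + b ^+ 2 <= 1 -> `|a| <= 1.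
Proof.
move=> h; rewrite -(@expr_le1 _ 2)// real_normK ?num_real//.
by rewrite (le_trans _ h)// lerDl sqr_ge0.
Qed.

Lemma Re_expr_le1 z j : `|z| <= 1 -> `|Re (z ^+ j)| <= 1.
Proof.
move=> /complex_le1 h; apply: (@sqr_norm_le1 _ (Im (z ^+ j))).
by rewrite sqr_Re_Im_expr exprn_ile1// addr_ge0// sqr_ge0.
Qed.

Lemma Im_expr_le1 z j : `|z| <= 1 -> `|Im (z ^+ j)| <= 1.
Proof.
move=> /complex_le1 h; apply: (@sqr_norm_le1 _ (Re (z ^+ j))).
by rewrite addrC sqr_Re_Im_expr exprn_ile1// addr_ge0// sqr_ge0.
Qed.

Lemma Re_le1 z : `|z| <= 1 -> Re z <= 1.
Proof. by move=> /(Re_expr_le1 1); rewrite expr1; exact: le_trans (ler_norm _). Qed.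

Lemma cexp_norm_le (w : R[i]) : Re w <= 0 ->
  `|Re (cexp w)| <= 1 /\ `|Im (cexp w)| <= 1.
Proof.
move=> w0; have e1 : `|expR (Re w)| <= 1 by rewrite ger0_norm ?expR_ge0 ?expR_le1.
by rewrite /= !normrM; split; rewrite mulr_ile1// ?cos_max ?sin_max.
Qed.

End ComplexParts.

(* Termwise differentiation shows that the real and imaginary parts [f], [g] of
   [\sum_j (z u)^j / j!] solve [f' = a f - b g], [g' = b f + a g]. *)
Section ComplexExponentialSeries.
Context (R : realType) (z : R[i]) (z1 : `|z| <= 1).
Local Notation Re := complex.Re.
Local Notation Im := complex.Im.
Let a := Re z.
Let b := Im z.
Let p (j : nat) : R := Re (z ^+ j) / j`!%:R.
Let q (j : nat) : R := Im (z ^+ j) / j`!%:R.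

Let cvg_small (c : nat -> R) (K : R) :
  (forall j, `|c j| <= 1) -> cvgn (pseries (fun j => c j / j`!%:R) K).
Proof.
move=> c1; apply: normed_cvg.
apply: (@series_le_cvg _ _ (exp_coeff `|K|)).
- by move=> n; exact: normr_ge0.
- by move=> n; exact: exp_coeff_ge0.
- move=> n; rewrite /exp_coeff/= normrM normrM normfV normrX normr_nat.
  rewrite mulrAC [leRHS]mulrC -[leRHS]mul1r -mulrA [_ / _]mulrC.
  by apply: ler_wpM2r => //; rewrite mulr_ge0// ?invr_ge0 ?exprn_ge0.
exact: is_cvg_series_exp_coeff.
Qed.

Let diffs (c : nat -> R) : pseries_diffs (fun j => c j / j`!%:R) =
  (fun j => c j.+1 / j`!%:R).
Proof.
apply/funext => j; rewrite /pseries_diffs factS natrM.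
have j1 : j.+1%:R != 0 :> R by rewrite pnatr_eq0.
have j2 : j`!%:R != 0 :> R by rewrite pnatr_eq0 -lt0n fact_gt0.
by field; rewrite j2 addrC natr1 j1.
Qed.

Let f u := limn (pseries p u).
Let g u := limn (pseries q u).

Let dpow (c : nat -> R) u : (forall j, `|c j| <= 1) ->
  is_derive u (1 : R) (fun x => limn (pseries (fun j => c j / j`!%:R) x))
    (limn (pseries (fun j => c j.+1 / j`!%:R) u)).
Proof.
move=> c1; have := @pseries_snd_diffs R (fun j => c j / j`!%:R) (`|u| + 1) u.
rewrite diffs diffs; apply; [exact: cvg_small|exact: cvg_small|exact: cvg_small|].
by rewrite [ltRHS]ger0_norm ?addr_ge0// ltrDl.
Qed.

Let limD (c e : nat -> R) (k l : R) u : (forall j, `|c j| <= 1) ->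
  (forall j, `|e j| <= 1) ->
  limn (pseries (fun j => (k * c j + l * e j) / j`!%:R) u) =
  k * limn (pseries (fun j => c j / j`!%:R) u) +
  l * limn (pseries (fun j => e j / j`!%:R) u).
Proof.
move=> c1 e1; apply/cvg_lim => //.
have -> : pseries (fun j => (k * c j + l * e j) / j`!%:R) u =
    (fun n => k * pseries (fun j => c j / j`!%:R) u n +
              l * pseries (fun j => e j / j`!%:R) u n).
  apply/funext => n; rewrite /pseries /series/= !mulr_sumr -big_split/=.
  by apply: eq_bigr => i _; ring.
by apply: cvgD; apply: cvgMr; exact: cvg_small.
Qed.

Let df u : is_derive u (1 : R) f (a * f u - b * g u).
Proof.
have := @dpow (fun j => Re (z ^+ j)) u (fun j => Re_expr_le1 j z1).
move=> h; apply: is_derive_eq; rewrite -mulNr -limD//; last 2 first.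
- by move=> j; exact: Re_expr_le1.
- by move=> j; exact: Im_expr_le1.
congr (limn (pseries _ u)); apply/funext => j.
by rewrite exprS cReM -/a -/b; congr (_ / _); ring.
Qed.

Let dg u : is_derive u (1 : R) g (b * f u + a * g u).
Proof.
have := @dpow (fun j => Im (z ^+ j)) u (fun j => Im_expr_le1 j z1).
move=> h; apply: is_derive_eq; rewrite -limD//; last 2 first.
- by move=> j; exact: Re_expr_le1.
- by move=> j; exact: Im_expr_le1.
congr (limn (pseries _ u)); apply/funext => j.
by rewrite exprS cImM -/a -/b; congr (_ / _); ring.
Qed.

(** [A] and [B] are the real and imaginary parts of [exp (- z u)] times the power series [f + i g].
    By the differential equations for [f] and [g] this product has zero derivative, hence keeps its
    value 1 at [u = 0]. *)
Let A u := expR (- a * u) * (f u * cos (b * u) + g u * sin (b * u)).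
Let B u := expR (- a * u) * (g u * cos (b * u) - f u * sin (b * u)).

Let dlin (k u : R) : is_derive u (1 : R) (fun v : R => k * v) k.
Proof.
have := is_deriveZ k (is_derive_id u (1 : R)).
by move=> h; apply: is_derive_eq; rewrite /GRing.scale/= mulr1.
Qed.

Let dcomp (h : R -> R) (k u h' : R) : is_derive (k * u) (1 : R) h h' ->
  is_derive u (1 : R) (fun v => h (k * v)) (h' * k).
Proof.
move=> hh; have := @is_derive1_comp _ h (fun v => k * v) u _ _ hh (dlin k u).
exact.
Qed.

Let dA u : is_derive u (1 : R) A 0.
Proof.
have d1 := @dcomp expR (- a) u _ (is_derive_expR _).
have d2 := @dcomp cos b u _ (is_derive_cos _).
have d3 := @dcomp sin b u _ (is_derive_sin _).
have d4 := is_deriveM d1 (is_deriveD (is_deriveM (df u) d2) (is_deriveM (dg u) d3)).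
move: d4; rewrite /GRing.scale/=.
by move=> d4; apply: is_derive_eq; rewrite !fctE; ring.
Qed.

Let dB u : is_derive u (1 : R) B 0.
Proof.
have d1 := @dcomp expR (- a) u _ (is_derive_expR _).
have d2 := @dcomp cos b u _ (is_derive_cos _).
have d3 := @dcomp sin b u _ (is_derive_sin _).
have d4 := is_deriveM d1 (is_deriveB (is_deriveM (dg u) d2) (is_deriveM (df u) d3)).
move: d4; rewrite /GRing.scale/=.
by move=> d4; apply: is_derive_eq; rewrite !fctE; ring.
Qed.

Let at0 (c : nat -> R) : limn (pseries (fun j => c j / j`!%:R) 0) = c 0%N.
Proof.
apply/cvg_lim => //; rewrite -(cvg_shiftS (pseries _ 0)).
rewrite (_ : (fun n => _) = cst (c 0%N)); first exact: cvg_cst.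
apply/funext => n; rewrite /pseries/series/= big_nat_recl//= expr0 mulr1 divr1.
by rewrite big1 ?addr0// => i _; rewrite expr0n mulr0.
Qed.

Let A1 u : A u = 1.
Proof.
rewrite (is_derive_0_is_cst u 0 dA) /A !mulr0 expR0 cos0 sin0 /f /g !at0/=; ring.
Qed.

Let B0 u : B u = 0.
Proof.
rewrite (is_derive_0_is_cst u 0 dB) /B !mulr0 expR0 cos0 sin0 /f /g !at0/=; ring.
Qed.

Let fE u : f u = expR (a * u) * cos (b * u) /\ g u = expR (a * u) * sin (b * u).
Proof.
have cs := cos2Dsin2 (b * u).
have e1 : expR (a * u) * expR (- a * u) = 1 by rewrite -expRD mulNr subrr expR0.
have := A1 u; have := B0 u; rewrite /A /B.
set C := cos _ in cs *; set S := sin _ in cs *; set E := expR (- a * u) in e1 *.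
set E' := expR _ in e1 * => hB hA; split.
  transitivity (E' * E * (f u * (C ^+ 2 + S ^+ 2))); first by rewrite e1 cs; ring.
  transitivity (E' * (C * (E * (f u * C + g u * S)) - S * (E * (g u * C - f u * S)))).
    by ring.
  by rewrite hA hB; ring.
transitivity (E' * E * (g u * (C ^+ 2 + S ^+ 2))); first by rewrite e1 cs; ring.
transitivity (E' * (S * (E * (f u * C + g u * S)) + C * (E * (g u * C - f u * S)))).
  by ring.
by rewrite hA hB; ring.
Qed.

Lemma cvg_Re_cexp (u : R) :
  (\sum_(0 <= j < n) Re (z ^+ j) * (u ^+ j / j`!%:R)) @[n --> \oo]
    --> Re (cexp (z * ofR u)).
Proof.
rewrite /= cReM cImM/= !mulr0 subr0 add0r -(fE u).1.
have := @cvg_small (fun j => Re (z ^+ j)) u (fun j => Re_expr_le1 j z1).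
rewrite /f /p /pseries/series/=.
by under eq_fun do under eq_bigr do rewrite mulrAC -mulrA.
Qed.

Lemma cvg_Im_cexp (u : R) :
  (\sum_(0 <= j < n) Im (z ^+ j) * (u ^+ j / j`!%:R)) @[n --> \oo]
    --> Im (cexp (z * ofR u)).
Proof.
rewrite /= cReM cImM/= !mulr0 subr0 add0r -(fE u).2.
have := @cvg_small (fun j => Im (z ^+ j)) u (fun j => Im_expr_le1 j z1).
rewrite /g /q /pseries/series/=.
by under eq_fun do under eq_bigr do rewrite mulrAC -mulrA.
Qed.

End ComplexExponentialSeries.

Section BoundedConvergence.
Context d (T : measurableType d) (R : realType) (mu : {measure set T -> \bar R}).
Hypothesis mufin : (mu setT < +oo)%E.

Lemma bounded_convergence (D : set T) (f_ : nat -> T -> R) (f : T -> R) (C : R) :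
  measurable D -> (forall n, measurable_fun setT (f_ n)) ->
  measurable_fun setT f ->
  (forall n x, D x -> `|f_ n x| <= C) ->
  (forall x, D x -> f_ ^~ x @ \oo --> f x) ->
  \int[mu]_(x in D) f_ n x @[n --> \oo] --> \int[mu]_(x in D) f x.
Proof.
move=> mD mf_ mf fC fcv.
have iC : mu.-integrable D (cst C%:E).
  exact: (bmfun_integrable mufin mD (bmfun_cst _ C)).
have mf_' n : measurable_fun D (EFin \o f_ n).
  by apply/measurable_EFinP; exact: measurable_funS (mf_ n).
have mf' : measurable_fun D (EFin \o f).
  by apply/measurable_EFinP; exact: measurable_funS mf.
have fC' : {ae mu, forall x n, D x -> (`|(EFin \o f_ n) x| <= cst C%:E x)%E}.
  by apply: aeW => x n Dx; rewrite /= lee_fin fC.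
have fcv' : {ae mu, forall x, D x -> (EFin \o f_ n) x @[n --> \oo] --> (EFin \o f) x}.
  by apply: aeW => x Dx; apply: cvg_EFin; [exact: nearW|exact: fcv].
have [i1 _ cv] := dominated_convergence mD mf_' mf' fcv' iC fC'.
apply: (fine_cvg (a := \int[mu]_(x in D) f x)).
by rewrite /Rintegral fineK; [exact: cv|exact: integrable_fin_num].
Qed.

End BoundedConvergence.

Lemma measurable_nat_comp d (T : measurableType d) d' (T' : measurableType d')
    (X : T -> nat) (h : nat -> T') :
  measurable_fun setT X -> measurable_fun setT (fun w => h (X w)).
Proof. by move=> mX; apply: measurableT_comp. Qed.

Section ComplexIntegral.
Context d (T : measurableType d) (R : realType).
Implicit Types (F G : T -> R[i]).
Local Notation Re := complex.Re.
Local Notation Im := complex.Im.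

Definition cbm F := bmfun (fun x => Re (F x)) /\ bmfun (fun x => Im (F x)).

Lemma cbm_cst (c : R[i]) : cbm (fun=> c).
Proof. by split; exact: bmfun_cst. Qed.

Lemma cbmD F G : cbm F -> cbm G -> cbm (fun x => F x + G x).
Proof.
move=> [F1 F2] [G1 G2]; split.
  by under eq_fun do rewrite cReD; exact: bmfunD.
by under eq_fun do rewrite cImD; exact: bmfunD.
Qed.

Lemma cbmM F G : cbm F -> cbm G -> cbm (fun x => F x * G x).
Proof.
move=> [F1 F2] [G1 G2]; split.
  by under eq_fun do rewrite cReM; apply: bmfunB; exact: bmfunM.
by under eq_fun do rewrite cImM; apply: bmfunD; exact: bmfunM.
Qed.

Lemma cbm_sum I (s : seq I) (F : I -> T -> R[i]) :
  (forall i, cbm (F i)) -> cbm (fun x => \sum_(i <- s) F i x).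
Proof.
move=> bF; elim: s => [|i s IH].
  by under [X in cbm X]eq_fun do rewrite big_nil; exact: cbm_cst.
by under [X in cbm X]eq_fun do rewrite big_cons; exact: cbmD.
Qed.

Lemma cbm_ofR (f : T -> R) : bmfun f -> cbm (fun x => ofR (f x)).
Proof. by move=> bf; split => //; exact: bmfun_cst. Qed.

Lemma cbm_expr (z : R[i]) (X : T -> nat) : `|z| <= 1 -> measurable_fun setT X ->
  cbm (fun x => z ^+ X x).
Proof.
move=> z1 mX; split; split.
- exact: (measurable_nat_comp (fun n => Re (z ^+ n))).
- by exists 1 => x; exact: Re_expr_le1.
- exact: (measurable_nat_comp (fun n => Im (z ^+ n))).
- by exists 1 => x; exact: Im_expr_le1.
Qed.

Variable mu : {measure set T -> \bar R}.

Definition cint (D : set T) F : R[i] :=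
  Complex (\int[mu]_(x in D) Re (F x)) (\int[mu]_(x in D) Im (F x)).

Lemma eq_cint D F G : {in D, F =1 G} -> cint D F = cint D G.
Proof.
by move=> FG; apply: eq_complexP; apply: eq_Rintegral => x xD; rewrite FG.
Qed.

Hypothesis mufin : (mu setT < +oo)%E.

Lemma cintD D F G : measurable D -> cbm F -> cbm G ->
  cint D (fun x => F x + G x) = cint D F + cint D G.
Proof.
move=> mD [F1 F2] [G1 G2]; apply: eq_complexP; rewrite /= -bRintegralD//.
  by apply: eq_Rintegral => x _; rewrite cReD.
by apply: eq_Rintegral => x _; rewrite cImD.
Qed.

Lemma cint_sum D I (s : seq I) (F : I -> T -> R[i]) : measurable D ->
  (forall i, cbm (F i)) ->
  cint D (fun x => \sum_(i <- s) F i x) = \sum_(i <- s) cint D (F i).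
Proof.
move=> mD bF; elim: s => [|i s IH].
  rewrite big_nil (eq_cint (G := fun=> 0)); last by move=> x _; rewrite big_nil.
  by apply: eq_complexP; rewrite /= Rintegral_cst// mul0r.
rewrite big_cons -IH -cintD//; last exact: cbm_sum.
by apply: eq_cint => x _; rewrite big_cons.
Qed.

Lemma cint_setI_indic D A F : measurable D -> measurable A ->
  cint (D `&` A) F = cint D (fun x => ofR (\1_A x) * F x).
Proof.
move=> mD mA; apply: eq_complexP; rewrite /= Rintegral_setI_indic//;
  by apply: eq_Rintegral => x _; rewrite ?cReM ?cImM/= mul0r ?subr0 ?addr0.
Qed.

Lemma cint_setU D A F : measurable D -> measurable A -> cbm F ->
  cint D F = cint (D `&` A) F + cint (D `&` ~` A) F.
Proof.
move=> mD mA [F1 F2].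
by apply: eq_complexP; rewrite ?cReD ?cImD/=; exact: bRintegral_setU.
Qed.

Lemma cint_null D F : measurable D -> cbm F -> mu D = 0%E -> cint D F = 0.
Proof.
by move=> mD [F1 F2] D0; apply: eq_complexP; rewrite /= bRintegral_null.
Qed.

Lemma eq_cint_ae D A F G : measurable D -> measurable A -> cbm F -> cbm G ->
  mu (~` A) = 0%E -> (forall x, D x -> A x -> F x = G x) -> cint D F = cint D G.
Proof.
move=> mD mA [F1 F2] [G1 G2] A0 FG; apply: eq_complexP => /=;
  by apply: (eq_bRintegral_ae _ _ mA) => // x Dx Ax; rewrite FG.
Qed.

Lemma cint_cst D (c : R[i]) : measurable D -> cint D (fun=> c) = c * ofR (fine (mu D)).
Proof.
move=> mD; apply: eq_complexP; rewrite ?cReM ?cImM/= Rintegral_cst//; ring.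
Qed.

Lemma cint_partition (I : finType) D (J : T -> I) F :
  measurable D -> (forall i, measurable [set w | J w = i]) -> cbm F ->
  cint D F = \sum_i cint (D `&` [set w | J w = i]) F.
Proof.
move=> mD mJ bF; under eq_bigr do rewrite cint_setI_indic//.
rewrite -cint_sum//; last first.
  by move=> i; apply: cbmM => //; apply: cbm_ofR; exact: bmfun_indic.
apply: eq_cint => w _; rewrite (bigD1 (J w))//= indicE mem_set//= mul1r big1 ?addr0//.
by move=> i /eqP iJ; rewrite indicE memNset ?mul0r//= => Ji; exact: iJ.
Qed.

End ComplexIntegral.

Lemma cbm_comp d (T : measurableType d) d2 (T2 : measurableType d2)
    (R : realType) (F : T2 -> R[i]) (X : T -> T2) :
  cbm F -> measurable_fun setT X -> cbm (fun x => F (X x)).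
Proof.
by move=> [F1 F2] mX; split; [exact: bmfun_comp F1 mX|exact: bmfun_comp F2 mX].
Qed.

Section ComplexProductLaw.
Context d d1 d2 (T : measurableType d) (T1 : measurableType d1)
  (T2 : measurableType d2) (R : realType).
Variables (mu : {measure set T -> \bar R}) (nu : {measure set T2 -> \bar R}).
Hypotheses (mufin : (mu setT < +oo)%E) (nufin : (nu setT < +oo)%E).
Variables (D D0 : set T) (X : T -> T1) (Y : T -> T2) (c : {nonneg R}).
Hypotheses (mD : measurable D) (mD0 : measurable D0).
Hypotheses (mX : measurable_fun setT X) (mY : measurable_fun setT Y).
Hypothesis prodlaw : forall A B, measurable A -> measurable B ->
  mu (D `&` X @^-1` A `&` Y @^-1` B) =
  (mu (D0 `&` X @^-1` A) * (c%:num%:E * nu B))%E.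

Lemma Rproduct_law (f : T1 -> R) (g : T2 -> R) : bmfun f -> bmfun g ->
  \int[mu]_(w in D) (f (X w) * g (Y w)) =
  c%:num * (\int[mu]_(w in D0) f (X w) * \int[nu]_y g y).
Proof.
move=> bf bg.
have bh : bmfun (fun z : T1 * T2 => f z.1 * g z.2).
  by apply: bmfunM; [exact: (bmfun_comp bf)|exact: (bmfun_comp bg)].
have := product_law mufin nufin mD mD0 mX mY prodlaw bh.
rewrite /= => ->; congr (_ * _).
have bfX : bmfun (fun w => f (X w)) by exact: bmfun_comp.
rewrite [RHS]mulrC -bRintegralZl//; apply: eq_Rintegral => w _.
by rewrite bRintegralZl// mulrC.
Qed.

Lemma cproduct_law (F : T1 -> R[i]) (G : T2 -> R[i]) : cbm F -> cbm G ->
  cint mu D (fun w => F (X w) * G (Y w)) =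
  ofR c%:num * (cint mu D0 (fun w => F (X w)) * cint nu setT G).
Proof.
move=> [F1 F2] [G1 G2].
have bX (f : T1 -> R) : bmfun f -> bmfun (fun w => f (X w)) by move=> bf; exact: bmfun_comp.
have bY (f : T2 -> R) : bmfun f -> bmfun (fun w => f (Y w)) by move=> bf; exact: bmfun_comp.
apply: eq_complexP; rewrite ?cReM ?cImM /= mul0r ?subr0 ?addr0.
  under eq_Rintegral do rewrite cReM.
  rewrite bRintegralB//; last 2 first.
  - exact: (bmfunM (bX _ F1) (bY _ G1)).
  - exact: (bmfunM (bX _ F2) (bY _ G2)).
  by rewrite (Rproduct_law F1 G1) (Rproduct_law F2 G2) mulrBr.
under eq_Rintegral do rewrite cImM.
rewrite bRintegralD//; last 2 first.
- exact: (bmfunM (bX _ F1) (bY _ G2)).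
- exact: (bmfunM (bX _ F2) (bY _ G1)).
by rewrite (Rproduct_law F1 G2) (Rproduct_law F2 G1) mulrDr.
Qed.

End ComplexProductLaw.

Section Decay.
Context (R : realType) (s : R[i]) (s0 : 0 <= complex.Re s).
Local Notation Re := complex.Re.
Local Notation Im := complex.Im.

Lemma Re_cexpN (y : R) : Re (cexp (- (s * ofR y))) =
  expR (- (Re s * y)) * cos (- (Im s * y)).
Proof. by case: s => a b /=; rewrite !mulr0 subr0 add0r. Qed.

Lemma Im_cexpN (y : R) : Im (cexp (- (s * ofR y))) =
  expR (- (Re s * y)) * sin (- (Im s * y)).
Proof. by case: s => a b /=; rewrite !mulr0 subr0 add0r. Qed.

(* [decay y] is [exp (- s y)] for [0 <= y], made bounded by truncation at 0. *)
Definition decay (y : R) : R[i] := cexp (- (s * ofR (Num.max y 0))).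

Lemma decayE y : 0 <= y -> decay y = cexp (- (s * ofR y)).
Proof. by move=> y0; rewrite /decay max_l. Qed.

Lemma decayD x y : 0 <= x -> 0 <= y -> decay (x + y) = decay x * decay y.
Proof.
by move=> x0 y0; rewrite !decayE ?addr_ge0// -cexpD ofRD mulrDr opprD.
Qed.

Lemma continuous_Re_decay : continuous (fun y => Re (decay y)).
Proof.
rewrite (_ : (fun y => _) = (fun y => expR (- (Re s * Num.max y 0)) *
    cos (- (Im s * Num.max y 0)))); last by apply/funext => y; exact: Re_cexpN.
move=> y.
have cm : {for y, continuous (fun y : R => Num.max y 0)}.
  by apply: continuous_max; [exact: cvg_id|exact: cvg_cst].
have cn (k : R) : {for y, continuous (fun y : R => - (k * Num.max y 0))}.
  by apply: cvgN; apply: cvgMr; exact: cm.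
have c1 := continuous_comp (cn (Re s)) (@continuous_expR R _).
have c2 := continuous_comp (cn (Im s)) (@continuous_cos R _).
exact: (cvgM c1 c2).
Qed.

Lemma continuous_Im_decay : continuous (fun y => Im (decay y)).
Proof.
rewrite (_ : (fun y => _) = (fun y => expR (- (Re s * Num.max y 0)) *
    sin (- (Im s * Num.max y 0)))); last by apply/funext => y; exact: Im_cexpN.
move=> y.
have cm : {for y, continuous (fun y : R => Num.max y 0)}.
  by apply: continuous_max; [exact: cvg_id|exact: cvg_cst].
have cn (k : R) : {for y, continuous (fun y : R => - (k * Num.max y 0))}.
  by apply: cvgN; apply: cvgMr; exact: cm.
have c1 := continuous_comp (cn (Re s)) (@continuous_expR R _).
have c2 := continuous_comp (cn (Im s)) (@continuous_sin R _).
exact: (cvgM c1 c2).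
Qed.

Lemma decay_le1 y : `|Re (decay y)| <= 1 /\ `|Im (decay y)| <= 1.
Proof.
apply: cexp_norm_le; rewrite cReN cReM/= mulr0 subr0 oppr_le0 mulr_ge0//.
by rewrite le_max lexx orbT.
Qed.

Lemma cbm_decay : cbm decay.
Proof.
split; split; try (by exists 1 => y; case: (decay_le1 y)).
- exact: (continuous_measurable_fun continuous_Re_decay).
- exact: (continuous_measurable_fun continuous_Im_decay).
Qed.

(** The two integrands differ only on a null set. The point of the replacement is that [decay s] is
    bounded and continuous on the whole line, as convergence in law requires. *)
Lemma lst_decay d (T : measurableType d) (mu : {measure set T -> \bar R})
    (Y : T -> R) : measurable_fun setT Y -> mu [set w | Y w < 0] = 0%E ->
  lst mu s Y = cint mu setT (fun w => decay (Y w)).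
Proof.
move=> mY Y0.
have mN : measurable [set w | Y w < 0] by exact: measurable_set_lt.
have aeY : {ae mu, forall w, 0 <= Y w}.
  exists [set w | Y w < 0]; split => //= w /=; by move/negP; rewrite -ltNge.
have mRe : measurable_fun setT (fun w => - (Re s * Y w)).
  by apply: measurableT_comp => //; exact: measurable_funM.
have mIm : measurable_fun setT (fun w => - (Im s * Y w)).
  by apply: measurableT_comp => //; exact: measurable_funM.
have mexp := measurableT_comp (continuous_measurable_fun (@continuous_expR R)) mRe.
have mcos := measurableT_comp (continuous_measurable_fun (@continuous_cos R)) mIm.
have msin := measurableT_comp (continuous_measurable_fun (@continuous_sin R)) mIm.
have [dRe dIm] := cbm_decay.
apply: eq_complexP; rewrite /=; congr fine; apply: ae_eq_integral => //.
- apply/measurable_EFinP; apply: eq_measurable_fun (measurable_funM mexp mcos).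
  by move=> w _; exact: (esym (Re_cexpN (Y w))).
- by apply/measurable_EFinP; exact: (bmfun_comp dRe mY).1.
- by apply: filterS aeY => w /= Y0w _; rewrite max_l.
- apply/measurable_EFinP; apply: eq_measurable_fun (measurable_funM mexp msin).
  by move=> w _; exact: (esym (Im_cexpN (Y w))).
- by apply/measurable_EFinP; exact: (bmfun_comp dIm mY).1.
- by apply: filterS aeY => w /= Y0w _; rewrite max_l.
Qed.

End Decay.

Section PoissonTransform.
Context (R : realType) (lambda : R) (lambda_gt0 : 0 < lambda).
Context d (T : measurableType d) (mu : {measure set T -> \bar R}).
Hypothesis mufin : (mu setT < +oo)%E.
Local Notation Re := complex.Re.
Local Notation Im := complex.Im.

(** Both sides are limits of sums over [j < n], which agree term by term since [X] is Poisson with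
    random parameter [lambda S]. Bounded convergence applies with the bound 1, because [|r j| <= 1]
    and Poisson weights sum to at most 1. *)
Lemma poisson_mixture (D : set T) (S : T -> R) (X : T -> nat) (r : nat -> R)
    (phi : R -> R) :
  measurable D -> measurable_fun setT S -> measurable_fun setT X ->
  (forall w, D w -> 0 <= S w) ->
  (forall j, fine (mu (D `&` [set w | X w = j])) =
             \int[mu]_(w in D) (\1_`[0, +oo[%classic (S w) * pois lambda j (S w))) ->
  (forall j, `|r j| <= 1) -> bmfun phi ->
  (forall x, 0 <= x -> (\sum_(0 <= j < n) r j * pois lambda j x) @[n --> \oo] --> phi x) ->
  \int[mu]_(w in D) r (X w) = \int[mu]_(w in D) phi (S w).
Proof.
move=> mD mS mX S0 hX r1 bphi hphi.
have mXj j : measurable [set w | X w = j].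
  by rewrite -[X in measurable X]/(X @^-1` [set j]); exact: measurable_preimageT.
have brX : bmfun (fun w => r (X w)).
  by split; [exact: measurable_nat_comp|exists 1].
pose fS n w := \sum_(0 <= j < n)
  (r j * (\1_`[0, +oo[%classic (S w) * pois lambda j (S w))).
have bpS j : bmfun (fun w => r j * (\1_`[0, +oo[%classic (S w) * pois lambda j (S w))).
  apply: bmfunM; first exact: bmfun_cst.
  exact: (bmfun_comp (bmfun_pois_pos lambda_gt0 j)).
pose fX n w := \sum_(0 <= j < n) (r j * \1_[set w | X w = j] w).
have bpX j : bmfun (fun w => r j * \1_[set w | X w = j] w).
  by apply: bmfunM; [exact: bmfun_cst|exact: bmfun_indic].
have fXE n w : fX n w = if (X w < n)%N then r (X w) else 0.
  rewrite /fX; case: ifPn => Xn.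
    rewrite (bigD1_seq (X w)) ?iota_uniq ?mem_index_iota//= indicE mem_set// mulr1.
    by rewrite big1 ?addr0// => j jX; rewrite indicE memNset ?mulr0//= => /esym/eqP;
      rewrite (negbTE jX).
  rewrite big_nat_cond big1// => j /andP[jn _]; rewrite indicE memNset ?mulr0//=.
  by move=> Xj; move: Xn; rewrite Xj; case/andP: jn => _ ->.
have eqn n : \int[mu]_(w in D) fX n w = \int[mu]_(w in D) fS n w.
  rewrite !bRintegral_sum//; apply: eq_bigr => j _.
  rewrite !bRintegralZl//; last 2 first.
  - exact: (bmfun_comp (bmfun_pois_pos lambda_gt0 j)).
  - exact: bmfun_indic.
  by rewrite Rintegral_indicE// hX.
have cX : \int[mu]_(w in D) fX n w @[n --> \oo] --> \int[mu]_(w in D) r (X w).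
  apply: (bounded_convergence mufin (C := 1)) => //.
  - by move=> n; have [] := bmfun_sum (index_iota 0 n) bpX.
  - by case: brX.
  - by move=> n w _; rewrite fXE; case: ifP => // _; rewrite normr0.
  - move=> w _; apply: cvg_near_cst; exists (X w).+1 => // n /= Xn.
    by rewrite fXE Xn.
have cS : \int[mu]_(w in D) fS n w @[n --> \oo] --> \int[mu]_(w in D) phi (S w).
  apply: (bounded_convergence mufin (C := 1)) => //.
  - by move=> n; have [] := bmfun_sum (index_iota 0 n) bpS.
  - by have [] := bmfun_comp bphi mS.
  - move=> n w /S0 Sw; apply: le_trans (sum_pois_le1 lambda_gt0 n Sw).
    rewrite (le_trans (ler_norm_sum _ _ _))// ler_sum// => j _.
    rewrite indicE mem_set ?mul1r/= ?in_itv/= ?Sw//.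
    by rewrite normrM [X in _ * X]ger0_norm ?pois_ge0// ler_piMl// pois_ge0.
  - move=> w /S0 Sw; have := hphi _ Sw; rewrite /fS.
    under [in X in _ -> X]eq_fun do under eq_bigr do
      rewrite indicE mem_set ?mul1r/= ?in_itv/= ?Sw//.
    exact.
move: cX; rewrite (funext eqn) => cX.
exact: (cvg_unique (@Rhausdorff R) cX cS).
Qed.

(** Rests on the Poisson generating function, [\sum_j z^j pois j x = exp (- lambda (1 - z) x)], used
    separately for real and imaginary parts. It holds on the whole closed disc. *)
Lemma poisson_transform (z : R[i]) (D : set T) (S : T -> R) (X : T -> nat) :
  `|z| <= 1 ->
  measurable D -> measurable_fun setT S -> measurable_fun setT X ->
  (forall w, D w -> 0 <= S w) ->
  (forall j, fine (mu (D `&` [set w | X w = j])) =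
             \int[mu]_(w in D) (\1_`[0, +oo[%classic (S w) * pois lambda j (S w))) ->
  cint mu D (fun w => z ^+ X w) =
  cint mu D (fun w => decay (ofR lambda * (1 - z)) (S w)).
Proof.
move=> z1 mD mS mX S0 hX; set s := ofR lambda * (1 - z).
have s0 : 0 <= Re s.
  have -> : Re s = lambda * (1 - Re z) by rewrite /s; case: (z) => ? ? /=; ring.
  by apply: mulr_ge0; [exact: ltW|rewrite subr_ge0 Re_le1].
have [bRe bIm] := cbm_decay s0.
have sE x : 0 <= x -> decay s x = ofR (expR (- lambda * x)) * cexp (z * ofR (lambda * x)).
  move=> x0; rewrite decayE//.
  have -> : ofR (expR (- lambda * x)) = cexp (ofR (- lambda * x)).
    by apply: eq_complexP; rewrite /= ?cos0 ?sin0 ?mulr1 ?mulr0.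
  rewrite -cexpD; congr cexp; rewrite /s mulNr; apply: eq_complexP.
    by rewrite !(cReM, cImM, cReN, cImN, cReB, cImB, cReD, cImD)/=; ring.
  by rewrite !(cReM, cImM, cReN, cImN, cReB, cImB, cReD, cImD)/=; ring.
apply: eq_complexP => /=.
- apply: (@poisson_mixture D S X (fun j => Re (z ^+ j)) (fun x => Re (decay s x))) => //.
    by move=> j; exact: Re_expr_le1.
  move=> x x0; rewrite sE// cReM/= mul0r subr0.
  have /(_ _) := cvgMl_tmp (a := expR (- lambda * x)) (cvg_Re_cexp z1 (u := lambda * x)).
  rewrite /pois; under eq_fun do rewrite mulr_sumr.
  by under eq_fun do under eq_bigr do rewrite mulrCA.
- apply: (@poisson_mixture D S X (fun j => Im (z ^+ j)) (fun x => Im (decay s x))) => //.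
    by move=> j; exact: Im_expr_le1.
  move=> x x0; rewrite sE// cImM/= mul0r addr0.
  have /(_ _) := cvgMl_tmp (a := expR (- lambda * x)) (cvg_Im_cexp z1 (u := lambda * x)).
  rewrite /pois; under eq_fun do rewrite mulr_sumr.
  by under eq_fun do under eq_bigr do rewrite mulrCA.
Qed.

End PoissonTransform.

(** * Limits of laws *)

Lemma cvg_sum_seq (R : realType) I (s : seq I) (u : I -> nat -> R) (l : I -> R) :
  (forall i, u i n @[n --> \oo] --> l i) ->
  (\sum_(i <- s) u i n) @[n --> \oo] --> \sum_(i <- s) l i.
Proof.
move=> ul; elim: s => [|i s IH].
  by under eq_fun do rewrite big_nil; rewrite big_nil; exact: cvg_cst.
by under eq_fun do rewrite big_cons; rewrite big_cons; exact: cvgD.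
Qed.

Section DiscreteLaw.
Context d (T : measurableType d) (R : realType) (P : probability T R) (N : nat).
Variables (X : T -> nat) (J : T -> 'I_N).
Hypotheses (mX : measurable_fun setT X).
Hypothesis (mJ : forall i, measurable [set w | J w = i]).

Definition cell x i : set T := [set w | X w = x /\ J w = i].

Lemma measurable_fiber x : measurable [set w | X w = x].
Proof.
by rewrite -[X in measurable X]/(X @^-1` [set x]); exact: measurable_preimageT.
Qed.

Lemma measurable_cell x i : measurable (cell x i).
Proof.
rewrite (_ : cell x i = [set w | X w = x] `&` [set w | J w = i]) //.
by apply: measurableI => //; exact: measurable_fiber.
Qed.

Lemma Pfin : (P setT < +oo)%E. Proof. by rewrite probability_setT ltry. Qed.

Lemma bmfun_cells (h : nat -> 'I_N -> R) (C : R) :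
  (forall x i, `|h x i| <= C) -> bmfun (fun w => h (X w) (J w)).
Proof.
move=> hC; split; last by exists C.
rewrite (_ : (fun w => _) = (fun w => \sum_i \1_[set w | J w = i] w * h (X w) i)).
  apply: measurable_sum => i; apply: measurable_funM.
    exact: measurable_indic.
  exact: (measurable_nat_comp (h ^~ i)).
apply/funext => w; rewrite (bigD1 (J w))//= indicE mem_set//= mul1r big1 ?addr0//.
by move=> i /eqP iJ; rewrite indicE memNset ?mul0r//= => Ji; exact: iJ.
Qed.

Let trunc (h : nat -> 'I_N -> R) M w :=
  \sum_(0 <= x < M) \sum_i h x i * \1_(cell x i) w.

Let truncE h M w : trunc h M w = if (X w < M)%N then h (X w) (J w) else 0.
Proof.
rewrite /trunc; case: ifPn => XM.
  rewrite (bigD1_seq (X w)) ?iota_uniq ?mem_index_iota//=.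
  rewrite (bigD1 (J w))//= indicE mem_set//= mulr1 !big1 ?addr0//.
    move=> x xX; rewrite big1// => i _.
    by rewrite indicE memNset ?mulr0//= => -[/esym/eqP]; rewrite (negbTE xX).
  move=> i /eqP iJ; rewrite indicE memNset ?mulr0//= => -[_ Ji]; exact: iJ.
rewrite big_nat_cond big1// => x /andP[/andP[_ xM] _]; rewrite big1// => i _.
rewrite indicE memNset ?mulr0//= => -[Xx _].
by move: XM; rewrite Xx xM.
Qed.

Let bmfun_trunc h M : bmfun (trunc h M).
Proof.
apply: bmfun_sum => x; apply: bmfun_sum => i; apply: bmfunM.
  exact: bmfun_cst.
by apply: bmfun_indic; exact: measurable_cell.
Qed.

Let int_trunc h M : \int[P]_w trunc h M w =
  \sum_(0 <= x < M) \sum_i h x i * fine (P (cell x i)).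
Proof.
have b x i : bmfun (fun w => h x i * \1_(cell x i) w).
  apply: bmfunM; first exact: bmfun_cst.
  by apply: bmfun_indic; exact: measurable_cell.
rewrite (bRintegral_sum Pfin)//; last by move=> x; exact: bmfun_sum.
apply: eq_bigr => x _; rewrite (bRintegral_sum Pfin)//.
apply: eq_bigr => i _; rewrite (bRintegralZl Pfin)//; last first.
  by apply: bmfun_indic; exact: measurable_cell.
by rewrite Rintegral_indicE ?setTI//; exact: measurable_cell.
Qed.

(** The probability of [X >= M], written with finitely many point masses so that it inherits their
    convergence. *)
Definition tail_mass M := 1 - \sum_(0 <= x < M) \sum_i fine (P (cell x i)).

Let tail_massE M : tail_mass M = \int[P]_w (1 - trunc (fun _ _ => 1) M w).
Proof.
rewrite (bRintegralB Pfin)//; last exact: bmfun_cst.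
rewrite int_trunc Rintegral_cst// mul1r; congr (_ - _).
  by rewrite -[RHS]/(fine (P setT)) probability_setT.
by apply: eq_bigr => x _; apply: eq_bigr => i _; rewrite mul1r.
Qed.

Lemma cells_approx (h : nat -> 'I_N -> R) (C : R) M :
  (forall x i, `|h x i| <= C) ->
  `|\int[P]_w h (X w) (J w) - \sum_(0 <= x < M) \sum_i h x i * fine (P (cell x i))|
  <= C * tail_mass M.
Proof.
move=> hC; have bh := bmfun_cells hC.
rewrite -int_trunc -(bRintegralB Pfin)// tail_massE -(bRintegralZl Pfin)//; last first.
  by apply: bmfunB => //; exact: bmfun_cst.
have b1 : bmfun (fun w => h (X w) (J w) - trunc h M w) by exact: bmfunB.
apply: (le_trans (le_normr_Rintegral measurableT (bmfun_integrable Pfin measurableT b1))).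
apply: (le_bRintegral Pfin) => //.
- exact: bmfun_norm.
- by apply: bmfunM; [exact: bmfun_cst|apply: bmfunB => //; exact: bmfun_cst].
move=> w _; rewrite !truncE; case: ifP => _.
  by rewrite !subrr normr0 mulr0.
by rewrite !subr0 mulr1.
Qed.

Lemma tail_mass_cvg0 : tail_mass M @[M --> \oo] --> (0 : R).
Proof.
rewrite (funext tail_massE).
rewrite [X in _ --> X](_ : _ = \int[P]_w (cst 0 w)); last first.
  by rewrite Rintegral_cst// mul0r.
apply: (bounded_convergence Pfin (C := 1)) => //.
- by move=> M; have [] := bmfunB (bmfun_cst _ 1) (bmfun_trunc (fun _ _ => 1) M).
- move=> M w _; rewrite truncE; case: ifP => _; first by rewrite subrr normr0.
  by rewrite subr0 normr1.
- move=> w _; apply: cvg_near_cst; exists (X w).+1 => // n /= Xn.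
  by rewrite truncE Xn subrr.
Qed.

End DiscreteLaw.

(* Pointwise convergence of probability mass functions to a probability mass
   function forces convergence of bounded expectations, by tightness. *)
Lemma discrete_law_cvg d (T : measurableType d) (R : realType) (P : probability T R)
    d' (T' : measurableType d') (Q : probability T' R) (N : nat)
    (X_ : nat -> T -> nat) (J_ : nat -> T -> 'I_N) (X : T' -> nat) (J : T' -> 'I_N)
    (h : nat -> 'I_N -> R) (C : R) :
  (forall n, measurable_fun setT (X_ n)) ->
  (forall n i, measurable [set w | J_ n w = i]) ->
  measurable_fun setT X -> (forall i, measurable [set w | J w = i]) ->
  (forall x i, P [set w | X_ n w = x /\ J_ n w = i] @[n --> \oo] -->
     Q [set v | X v = x /\ J v = i]) ->
  (forall x i, `|h x i| <= C) ->
  \int[P]_w h (X_ n w) (J_ n w) @[n --> \oo] --> \int[Q]_v h (X v) (J v).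
Proof.
move=> mX_ mJ_ mX mJ PQ hC.
pose p n x i := fine (P (cell (X_ n) (J_ n) x i)).
pose q x i := fine (Q (cell X J x i)).
have pq x i : p n x i @[n --> \oo] --> q x i.
  apply: fine_cvg; rewrite fineK; first exact: PQ.
  by rewrite fin_num_measure//; exact: measurable_cell.
have sum_cvg (g : nat -> 'I_N -> R) M :
    (\sum_(0 <= x < M) \sum_i g x i * p n x i) @[n --> \oo] -->
    \sum_(0 <= x < M) \sum_i g x i * q x i.
  apply: cvg_sum_seq => x; apply: cvg_sum_seq => i.
  by apply: cvgMl_tmp; exact: pq.
have tail_cvg M : tail_mass P (X_ n) (J_ n) M @[n --> \oo] --> tail_mass Q X J M.
  rewrite /tail_mass; apply: cvgB; first exact: cvg_cst.
  have := sum_cvg (fun _ _ => 1) M.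
  under eq_fun do under eq_bigr do under eq_bigr do rewrite mul1r.
  by under [in X in _ --> X]eq_bigr do under eq_bigr do rewrite mul1r.
have C0 : 0 <= `|C| + 1 by rewrite addr_ge0.
have hC' x i : `|h x i| <= `|C| + 1.
  by rewrite (le_trans (hC x i))// (le_trans (ler_norm _))// lerDl.
apply/cvgrPdist_lt => e e0.
have e4 : 0 < e / 4 by rewrite divr_gt0.
have eC : 0 < e / 4 / (`|C| + 1) by rewrite divr_gt0// ltr_wpDl.
have C1 : 0 < `|C| + 1 by rewrite ltr_wpDl.
(* Budget: a quarter of [e] for the tail of [Q], a quarter for the difference of the finite sums,
   and two quarters for the tail of [P], which is compared with that of [Q]. *)
have /cvgrPdist_lt/(_ _ eC)[M _ /(_ M (leqnn M))/=] := tail_mass_cvg0 Q mX mJ.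
rewrite sub0r normrN => tM.
near=> n.
have h1 := cells_approx P (mX_ n) (mJ_ n) M hC'.
have h2 := cells_approx Q mX mJ M hC'.
have h3 : `|\sum_(0 <= x < M) \sum_i h x i * q x i -
    \sum_(0 <= x < M) \sum_i h x i * p n x i| < e / 4.
  by near: n; move/cvgrPdist_lt : (sum_cvg h M); exact.
have h4 : `|tail_mass Q X J M - tail_mass P (X_ n) (J_ n) M| < e / 4 / (`|C| + 1).
  by near: n; move/cvgrPdist_lt : (tail_cvg M); exact.
have h5 : (`|C| + 1) * tail_mass Q X J M < e / 4.
  by rewrite -ltr_pdivlMl// mulrC (le_lt_trans (ler_norm _)).
have h6 : (`|C| + 1) * tail_mass P (X_ n) (J_ n) M < e / 4 + e / 4.
  have : tail_mass P (X_ n) (J_ n) M < e / 4 / (`|C| + 1) + e / 4 / (`|C| + 1).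
    move: h4 tM; rewrite ltr_norml => /andP[+ _]; rewrite ltr_norml => + /andP[_]; lra.
  by rewrite -ltr_pdivlMl// mulrDr ![(`|C| + 1)^-1 * _]mulrC.
move: h1 h2 h3; rewrite !ler_norml !ltr_norml /p /q.
set a := \int[P]_w _; set b := \int[Q]_v _; set u := \sum_(_ <= _ < _) _.
set v := \sum_(_ <= _ < _) _.
by move=> /andP[a1 a2] /andP[b1 b2] /andP[c1 c2]; apply/andP; split; lra.
Unshelve. all: by end_near. Qed.

Section LawLimit.
Context (R : realType) d' (T' : measurableType d') (Q : probability T' R).
Variables (L : nat -> (R -> R) -> R) (Y : {RV Q >-> R}).
Hypothesis LY : cvg_in_law Q L Y.

(** The test function [f], the positive part of [min (- y) 1], is bounded, continuous and positive
    exactly for [y < 0]. Its integral against the limit law is 0, so this law does not charge the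
    negative half-line. *)
Lemma law_limit_ge0 :
  (forall n (f : R -> R), continuous f -> bounded_fun f -> (forall y, 0 <= y -> f y = 0) ->
     L n f = 0) ->
  Q [set v | Y v < 0] = 0%E.
Proof.
move=> L0.
pose f (y : R) := Num.max (- Num.max y (-1)) 0.
have f01 y : 0 <= f y <= 1.
  rewrite /f le_max lexx orbT/= ge_max ler01 andbT lerNl le_max lexx orbT//.
have cf : continuous f.
  move=> y.
  have c1 : {for y, continuous (fun y : R => Num.max y (-1))}.
    by apply: continuous_max; [exact: cvg_id|exact: cvg_cst].
  have c2 : {for y, continuous (fun y : R => - Num.max y (-1))} := cvgN c1.
  have c3 : {for y, continuous (fun y : R => Num.max (- Num.max y (-1)) 0)}.
    by apply: continuous_max; [exact: c2|exact: cvg_cst].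
  exact: c3.
have bf : bmfun f.
  split; first exact: continuous_measurable_fun.
  by exists 1 => y; have /andP[y0 y1] := f01 y; rewrite ger0_norm.
have bdf : bounded_fun f.
  exists 1; split; first exact: num_real.
  move=> M M1 y _ /=; have /andP[y0 y1] := f01 y.
  by rewrite ger0_norm// (le_trans y1)// ltW.
have int0 : \int[Q]_v f (Y v) = 0.
  have := LY cf bdf; rewrite (_ : (fun n => _) = cst 0); last first.
    apply/funext => n; apply: L0 => // y y0; rewrite /f max_r//.
    by rewrite oppr_le0 le_max y0.
  by move=> h; exact: (cvg_unique (@Rhausdorff R) h (cvg_cst _)).
have bfY : bmfun (fun v => f (Y v)) by exact: bmfun_comp.
have iY := bmfun_integrable (Pfin Q) measurableT bfY.
have : (\int[Q]_v `|(f (Y v))%:E| = 0)%E.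
  have -> : (\int[Q]_v `|(f (Y v))%:E| = \int[Q]_v (f (Y v))%:E)%E.
    apply: eq_integral => v _; rewrite gee0_abs// lee_fin.
    by have /andP[] := f01 (Y v).
  rewrite -[LHS]fineK; last exact: integrable_fin_num.
  by congr EFin.
move/(ae_eq_integral_abs Q measurableT (measurable_int _ iY)) => ae0.
have mN : measurable [set v | Y v < 0] by exact: measurable_set_lt.
apply: measure_negligible => //.
apply: negligibleS ae0 => v /= Yv fv0; have {fv0} := fv0 I.
rewrite /cst/= => -[] /eqP; rewrite /f maxEle; case: ifPn => [|_ /eqP].
  by rewrite oppr_le0 le_max oppr_ge0 ler10 orbF leNgt Yv.
move/eqP; rewrite oppr_eq0 maxEle; case: ifP => _; rewrite ?oppr_eq0 ?oner_eq0//.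
by move/eqP => Y0; rewrite Y0 ltxx in Yv.
Qed.

Lemma lst_limit (s : R[i]) : 0 <= complex.Re s -> Q [set v | Y v < 0] = 0%E ->
  L n (fun y => complex.Re (decay s y)) @[n --> \oo] --> complex.Re (lst Q s Y) /\
  L n (fun y => complex.Im (decay s y)) @[n --> \oo] --> complex.Im (lst Q s Y).
Proof.
move=> s0 Y0; rewrite lst_decay//; split.
- apply: (LY (f := fun y => complex.Re (decay s y))).
    exact: continuous_Re_decay.
  exists 1; split; first exact: num_real.
  by move=> M M1 y _; apply: (le_trans (decay_le1 s0 y).1); exact: ltW.
- apply: (LY (f := fun y => complex.Im (decay s y))).
    exact: continuous_Im_decay.
  exists 1; split; first exact: num_real.
  by move=> M M1 y _; apply: (le_trans (decay_le1 s0 y).2); exact: ltW.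
Qed.

End LawLimit.

(** * Dynamics with arbitrary inputs *)

Lemma card_fset_set_bounded (E : pred nat) (M : nat) :
  (forall l, E l -> (l < M)%N) ->
  #|` fset_set [set l | E l]|%fset = count E (iota 0 M).
Proof.
move=> EM.
have -> : [set l | E l] = [set` [fset x in [seq x <- iota 0 M | E x]]%fset].
  apply/seteqP; split => l /=; rewrite !inE mem_filter mem_iota/= add0n.
    by move=> El; rewrite El EM.
  by case/andP.
rewrite set_fsetK card_fseq undup_id ?size_filter//.
by rewrite filter_uniq// iota_uniq.
Qed.

Lemma card_fset_set_infinite (E : pred nat) :
  (forall M, exists2 l, (M <= l)%N & E l) ->
  #|` fset_set [set l | E l]|%fset = 0%N.
Proof.
move=> Einf; have : ~ finite_set [set l | E l].
  move=> finE; have [l lM El] := Einf (\max_(i <- fset_set [set l | E l]) i).+1.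
  have : l \in fset_set [set l | E l] by rewrite in_fset_set// inE.
  move=> lF; have := leq_bigmax_seq (P := xpredT) (F := fun i => i) l lF isT.
  by rewrite leqNgt lM.
by rewrite /fset_set; case: pselect => // h _; rewrite cardfs0.
Qed.

Lemma card_fset_set_interval (E : pred nat) (n x : nat) :
  (forall l, E l = (n <= l < n + x)%N) ->
  #|` fset_set [set l | E l]|%fset = x.
Proof.
move=> Enx; rewrite (card_fset_set_bounded (M := (n + x)%N)); last first.
  by move=> l; rewrite Enx => /andP[].
rewrite iotaD count_cat add0n (@eq_in_count _ E pred0); last first.
  by move=> l; rewrite mem_iota add0n => /andP[_ ln] /=; rewrite Enx leqNgt ln.
rewrite count_pred0 add0n (@eq_in_count _ E predT) ?count_predT ?size_iota//.
by move=> l; rewrite mem_iota Enx => /=.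
Qed.

Section MeasurableCounting.
Context d (T : measurableType d).

Lemma measurable_nat_fibers (F : T -> nat) :
  (forall x, measurable [set w | F w = x]) -> measurable_fun setT F.
Proof.
move=> mF _ A _; rewrite setTI (_ : F @^-1` A = \bigcup_(x in A) [set w | F w = x]).
  by apply: bigcup_measurable => x _.
by apply/seteqP; split => w /= => [|[x Ax ->]] // FA; exists (F w).
Qed.

Lemma measurable_setT_eq (I : eqType) (F : T -> I) x :
  measurable_fun setT (fun w => F w == x) -> measurable [set w | F w = x].
Proof.
move=> /measurable_set_bool; congr measurable.
by apply/seteqP; split => w /= /eqP.
Qed.

Lemma measurable_sum_nat (I : Type) (s : seq I) (F : I -> T -> nat) :
  (forall i, measurable_fun setT (F i)) ->
  measurable_fun setT (fun w => \sum_(i <- s) F i w)%N.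
Proof.
move=> mF; elim: s => [|i s IH].
  by under [X in measurable_fun _ X]eq_fun do rewrite big_nil; exact: measurable_cst.
under [X in measurable_fun _ X]eq_fun do rewrite big_cons.
exact: measurable_fun_addn.
Qed.

Lemma measurable_card (E : nat -> T -> bool) :
  (forall l, measurable_fun setT (E l)) ->
  measurable_fun setT (fun w => #|` fset_set [set l | E l w]|%fset).
Proof.
move=> mE.
have mEl l : measurable [set w | E l w] by exact: measurable_set_bool.
have mEN l : measurable [set w | ~~ E l w].
  by apply: measurable_set_bool; exact: measurableT_comp (mE l).
pose bd M := [set w | forall l, (M <= l)%N -> ~~ E l w].
have mbd M : measurable (bd M).
  rewrite (_ : bd M = \bigcap_(l in [set l | (M <= l)%N]) [set w | ~~ E l w]) //.
  by apply: bigcap_measurableType.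
pose cnt M w := \sum_(l <- iota 0 M) (E l w : nat).
have mcnt M x : measurable [set w | cnt M w = x].
  rewrite -[X in measurable X]/(cnt M @^-1` [set x]).
  apply: measurable_preimageT => //; apply: measurable_sum_nat => l.
  by apply: measurableT_comp => //.
have cardE M w : bd M w -> #|` fset_set [set l | E l w]|%fset = cnt M w.
  move=> bM; rewrite (card_fset_set_bounded (M := M)) /cnt.
    by rewrite -sum1_count big_mkcond/=; apply: eq_bigr => l _; case: (E l w).
  by move=> l; apply: contraLR; rewrite -leqNgt; exact: bM.
apply: measurable_nat_fibers => x.
rewrite (_ : [set w | _] = \bigcup_M (bd M `&` [set w | cnt M w = x]) `|`
    ((\bigcap_M ~` bd M) `&` [set w | x = 0%N])).
  apply: measurableU.
    by apply: bigcup_measurable => M _; exact: measurableI.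
  apply: measurableI; first by apply: bigcap_measurableType => M _; exact: measurableC.
  by case: x => [|x]; [rewrite (_ : [set _ | _] = setT)|rewrite (_ : [set _ | _] = set0)];
    rewrite //; apply/seteqP; split.
apply/seteqP; split => w /=.
  move=> wx; have [[M bM]|nb] := pselect (exists M, bd M w).
    by left; exists M => //; split => //; rewrite /= -(cardE M).
  right; split; first by move=> M _ bM; apply: nb; exists M.
  rewrite -wx; apply: card_fset_set_infinite => M; apply: contrapT => h.
  by apply: nb; exists M => l Ml; apply/negP => El; apply: h; exists l.
move=> [[M _ [bM <-]]|[nb ->]]; first exact: cardE.
apply: card_fset_set_infinite => M; apply: contrapT => h.
by apply: (nb M I) => l Ml; apply/negP => El; apply: h; exists l.
Qed.

Lemma measurable_random_index d' (T' : measurableType d') (F : nat -> T -> T')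
    (K : T -> nat) :
  (forall k, measurable_fun setT (F k)) -> measurable_fun setT K ->
  measurable_fun setT (fun w => F (K w) w).
Proof.
move=> mF mK _ A mA; rewrite setTI.
rewrite (_ : _ @^-1` A = \bigcup_k ([set w | K w = k] `&` F k @^-1` A)).
  apply: bigcup_measurable => k _; apply: measurableI.
    by rewrite -[X in measurable X]/(K @^-1` [set k]); exact: measurable_preimageT.
  exact: measurable_preimageT.
by apply/seteqP; split => w /= => [Fw|[k _ [<-]]//]; exists (K w).
Qed.

End MeasurableCounting.

(* The dynamics for arbitrary inputs [A] (interarrival times), [I] (initial number
   of batches), [B] (batch sizes), [S] (service times): replacing the inputs after
   a given time by constants then shows that the past does not depend on them. *)
Section InputDynamics.
Context (R : realType) (T : Type).
Variables (A : nat -> T -> R) (I : T -> nat) (B : nat -> T -> nat) (S : nat -> T -> R).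
Implicit Types (n k m : nat) (w : T).

Definition g_batch_arrival n w : R := \sum_(0 <= l < n.+1 | (I w <= l)%N) A l w.

Definition g_first n w : nat := (\sum_(0 <= l < n) B l w)%N.

Definition g_batch_of k w : nat := (\sum_(0 <= l < k) (g_first l.+1 w <= k))%N.

Definition g_arrival k w : R := g_batch_arrival (g_batch_of k w) w.

Fixpoint g_dep k w : R :=
  if k is k'.+1 then Num.max (g_arrival k' w) (g_dep k' w) + S k' w else 0.

Lemma g_firstS n w : g_first n.+1 w = (g_first n w + B n w)%N.
Proof. by rewrite /g_first big_nat_recr. Qed.

Lemma g_first_mono m n w : (m <= n)%N -> (g_first m w <= g_first n w)%N.
Proof.
move=> /subnK <-; elim: (n - m)%N => [|j IH] //.
by rewrite addSn g_firstS (leq_trans IH)// leq_addr.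
Qed.

Section Nonempty.
Variable w : T.
Hypothesis B1 : forall l, (1 <= B l w)%N.

Lemma leq_g_first n : (n <= g_first n w)%N.
Proof.
elim: n => // n IH; rewrite g_firstS -addn1; exact: leq_add.
Qed.

Lemma g_batch_of_eq k n : (g_first n w <= k < g_first n.+1 w)%N -> g_batch_of k w = n.
Proof.
move=> /andP[h1 h2].
have e l : (g_first l.+1 w <= k)%N = (l < n)%N.
  apply/idP/idP => [h|ln]; last exact: leq_trans (g_first_mono w ln) h1.
  rewrite ltnNge; apply/negP => nl.
  by move: h2; rewrite ltnNge (leq_trans _ h)// g_first_mono.
rewrite /g_batch_of; under eq_bigr do rewrite e.
(* Nonempty batches give [n <= k], so the count over [l < k] sees all of the first [n] batches. *)
have nk : (n <= k)%N := leq_trans (leq_g_first n) h1.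
rewrite (@big_cat_nat _ _ _ n)//= [X in (_ + X)%N]big_nat_cond [X in (_ + X)%N]big1.
  rewrite addn0 big_nat (eq_bigr (fun=> 1%N)).
    by rewrite -big_nat sum_nat_const_nat muln1 subn0.
  by move=> l /andP[_ ->].
by move=> l /andP[/andP[nl _] _]; rewrite ltnNge nl.
Qed.

Lemma g_batch_ofP k :
  (g_first (g_batch_of k w) w <= k < g_first (g_batch_of k w).+1 w)%N.
Proof.
have [n h] : exists n, (g_first n w <= k < g_first n.+1 w)%N.
  elim: k => [|k [n /andP[h1 h2]]].
    by exists 0%N; rewrite {1}/g_first big_geq//= g_firstS addn_gt0 B1 orbT.
  have [h|h] := ltnP k.+1 (g_first n.+1 w).
    by exists n; rewrite h andbT (leq_trans h1).
  exists n.+1; rewrite h /= g_firstS.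
  have -> : g_first n.+1 w = k.+1 by apply/eqP; rewrite eqn_leq h h2.
  by rewrite -[X in (X < _)%N]addn0 ltn_add2l.
by rewrite (g_batch_of_eq h).
Qed.

Lemma g_batch_of_mono k k' : (k <= k')%N -> (g_batch_of k w <= g_batch_of k' w)%N.
Proof.
move=> kk'; rewrite leqNgt; apply/negP => h.
have /andP[h1 _] := g_batch_ofP k; have /andP[_ h2] := g_batch_ofP k'.
have := leq_trans h2 (leq_trans (g_first_mono w h) h1).
by rewrite ltnNge kk'.
Qed.

Lemma g_batch_of_lt k b : (k < g_first b w)%N -> (g_batch_of k w < b)%N.
Proof.
move=> kb; rewrite ltnNge; apply/negP => bk.
have /andP[h1 _] := g_batch_ofP k.
by have := leq_trans kb (leq_trans (g_first_mono w bk) h1); rewrite ltnn.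
Qed.

Lemma g_batch_of_first n : g_batch_of (g_first n w) w = n.
Proof.
by apply: g_batch_of_eq; rewrite leqnn/= g_firstS -[X in (X < _)%N]addn0 ltn_add2l.
Qed.

Lemma g_batch_of_member n r : (r < B n w)%N -> g_batch_of (g_first n w + r) w = n.
Proof. by move=> rB; apply: g_batch_of_eq; rewrite leq_addr/= g_firstS ltn_add2l. Qed.

Hypothesis A0 : forall l, 0 < A l w.
Hypothesis S0 : forall l, 0 <= S l w.

Lemma g_batch_arrivalS n : g_batch_arrival n.+1 w =
  g_batch_arrival n w + (if (I w <= n.+1)%N then A n.+1 w else 0).
Proof.
rewrite /g_batch_arrival big_mkcond/= big_nat_recr//= -big_mkcond/=.
by case: ifP.
Qed.

Lemma g_batch_arrival_mono m n : (m <= n)%N ->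
  g_batch_arrival m w <= g_batch_arrival n w.
Proof.
move=> /subnK <-; elim: (n - m)%N => [|j IH] //.
rewrite addSn g_batch_arrivalS (le_trans IH)// lerDl.
by case: ifP => // _; exact: ltW.
Qed.

Lemma g_batch_arrival_ge n l : (I w <= l)%N -> (l <= n)%N ->
  A l w <= g_batch_arrival n w.
Proof.
move=> Il ln; apply: le_trans (g_batch_arrival_mono ln).
rewrite /g_batch_arrival big_mkcond/= big_nat_recr//= Il lerDr sumr_ge0// => i _.
by case: ifP => // _; exact: ltW.
Qed.

(** The differences of arrival times are the inputs [A] only for batches that are not present at
    time 0: this is the condition [I w <= n.+1]. The recursion of [count_in] removes one spacing and
    moves from batch [n] to batch [n.+1]. *)
Lemma g_count_in n j y : (I w <= n.+1)%N ->
  count_in j y (fun l => A (n.+1 + l)%N w) =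
  [&& 0 <= y, g_batch_arrival (n + j) w - g_batch_arrival n w <= y &
      y < g_batch_arrival (n + j.+1) w - g_batch_arrival n w].
Proof.
elim: j n y => [|j IH] n y In /=.
  rewrite !addn0 subrr addn1 g_batch_arrivalS In addrC addKr.
  by case: (0 <= y).
rewrite (_ : (fun l => A (n.+1 + l.+1)%N w) = (fun l => A (n.+2 + l)%N w)); last first.
  by apply/funext => l; rewrite -addSnnS.
rewrite IH ?(leq_trans In)// addn0 -!addSnnS g_batch_arrivalS In.
have := A0 n.+1; have := g_batch_arrival_mono (leq_addr j n.+1).
rewrite g_batch_arrivalS In => h1 h2.
apply/idP/idP => [/andP[/andP[a1 a2] /and3P[b1 b2 b3]]|/and3P[b1 b2 b3]].
  by apply/and3P; split; lra.
apply/andP; split; first by apply/andP; split; lra.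
by apply/and3P; split; lra.
Qed.

(** Arrival times are nondecreasing, so the counted indices form an interval starting at [n], and
    its length is found by locating [D] between two arrivals. [(n + x).-1] is the last counted
    batch; for [x = 0] there is none, hence the disjunction. The assumed arrival after [D] makes the
    set finite. *)
Lemma g_card_left (n x : nat) (D : R) : (exists l, D < g_batch_arrival l w) ->
  (#|` fset_set [set l | (n <= l)%N /\ g_batch_arrival l w <= D]|%fset = x) <->
  ((x = 0%N \/ g_batch_arrival (n + x).-1 w <= D) /\ D < g_batch_arrival (n + x) w).
Proof.
move=> [l0 Dl0].
have setE : [set l | (n <= l)%N /\ g_batch_arrival l w <= D] =
    [set l | (n <= l)%N && (g_batch_arrival l w <= D)].
  by apply/seteqP; split => l /= /andP.
have key y : (y = 0%N \/ g_batch_arrival (n + y).-1 w <= D) ->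
    D < g_batch_arrival (n + y) w ->
    #|` fset_set [set l | (n <= l)%N /\ g_batch_arrival l w <= D]|%fset = y.
  move=> h1 h2; rewrite setE; apply: (@card_fset_set_interval _ n y) => l.
  case: (leqP n l) => //= nl; apply/idP/idP => [lD|ly].
    rewrite ltnNge; apply/negP => yl.
    by have := lt_le_trans h2 (g_batch_arrival_mono yl); rewrite ltNge lD.
  case: h1 => [y0|]; first by rewrite y0 addn0 ltnNge nl in ly.
  by apply: le_trans; apply: g_batch_arrival_mono; case: (n + y)%N ly.
have [y h1 h2] : exists2 y, (y = 0%N \/ g_batch_arrival (n + y).-1 w <= D) &
    D < g_batch_arrival (n + y) w.
  have ex : exists y, D < g_batch_arrival (n + y) w.
    by exists l0; apply: (lt_le_trans Dl0); apply: g_batch_arrival_mono; rewrite leq_addl.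
  exists (ex_minn ex); case: ex_minnP => y hy miny //.
  case: y hy miny => [|y] hy miny; [by left|right].
  by rewrite addnS/= leNgt; apply/negP => /miny; rewrite ltnn.
split => [<-|[]]; last exact: key.
by rewrite (key y h1 h2).
Qed.

(** Arrivals are nondecreasing in the order of service, so emptiness is decided by customer [k]
    alone. An arrival after [D] excludes the case where the value 0 would come from the convention
    for infinite sets. *)
Lemma g_card_left_customers k (D : R) : (exists l, D < g_batch_arrival l w) ->
  (#|` fset_set [set k' | (k <= k')%N /\ g_arrival k' w <= D]|%fset == 0%N) =
  (D < g_arrival k w).
Proof.
move=> [l0 Dl0].
have setE : [set k' | (k <= k')%N /\ g_arrival k' w <= D] =
    [set k' | (k <= k')%N && (g_arrival k' w <= D)].
  by apply/seteqP; split => l /= /andP.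
have bd k' : (k <= k')%N && (g_arrival k' w <= D) -> (k' < g_first l0 w)%N.
  move=> /andP[_ k'D]; rewrite ltnNge; apply/negP => h.
  have : (l0 <= g_batch_of k' w)%N.
    by rewrite -(g_batch_of_first l0); exact: g_batch_of_mono.
  move/g_batch_arrival_mono => h2.
  by have := lt_le_trans Dl0 h2; rewrite ltNge k'D.
rewrite setE (card_fset_set_bounded bd) -leqn0 leqNgt -has_count.
apply/idP/idP => [/hasPn h|Dk].
  rewrite ltNge; apply/negP => kD.
  have /bd kl : (k <= k)%N && (g_arrival k w <= D) by rewrite leqnn.
  have := h k; rewrite mem_iota/= add0n kl => /(_ isT).
  by rewrite leqnn kD.
apply/hasPn => k' _; rewrite negb_and -ltnNge -ltNge.
case: (ltnP k' k) => //= kk'; apply: (lt_le_trans Dk).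
by apply: g_batch_arrival_mono; exact: g_batch_of_mono.
Qed.

End Nonempty.

End InputDynamics.

Section MeasurableDynamics.
Context (R : realType) d (T : measurableType d).
Variables (A : nat -> T -> R) (I : T -> nat) (B : nat -> T -> nat) (S : nat -> T -> R).
Hypotheses (mA : forall l, measurable_fun setT (A l)) (mI : measurable_fun setT I).
Hypothesis mB : forall l, measurable_fun setT (B l).

Lemma measurable_g_first n : measurable_fun setT (g_first B n).
Proof. exact: measurable_sum_nat. Qed.

Lemma measurable_g_batch_of k : measurable_fun setT (g_batch_of B k).
Proof.
apply: measurable_sum_nat => l.
apply: (@measurableT_comp _ _ _ _ _ _ (fun n : nat => (n <= k)%N : nat)) => //.
exact: measurable_g_first.
Qed.

Lemma measurable_g_batch_arrival n : measurable_fun setT (g_batch_arrival A I n).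
Proof.
rewrite /g_batch_arrival.
under [X in measurable_fun _ X]eq_fun do rewrite big_mkcond/=.
apply: measurable_sum => l.
rewrite (_ : (fun w => _) = (fun w => ((I w <= l)%N)%:R * A l w)); last first.
  by apply/funext => w; case: ifP; rewrite ?mul1r ?mul0r.
apply: measurable_funM => //.
exact: (measurable_nat_comp (fun i => ((i <= l)%N)%:R : R)).
Qed.

Lemma measurable_g_arrival k : measurable_fun setT (g_arrival A I B k).
Proof.
apply: measurable_random_index; first exact: measurable_g_batch_arrival.
exact: measurable_g_batch_of.
Qed.

Lemma measurable_g_dep k : (forall l, (l < k)%N -> measurable_fun setT (S l)) ->
  measurable_fun setT (g_dep A I B S k).
Proof.
elim: k => [|k IH] mS /=; first exact: measurable_cst.
apply: measurable_funD; last exact: mS.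
apply: measurable_maxr; first exact: measurable_g_arrival.
by apply: IH => l lk; apply: mS; exact: ltnW.
Qed.

End MeasurableDynamics.

Section TruncatedInputs.
Context (R : realType) (T : Type).
Variables (A A' : nat -> T -> R) (I : T -> nat) (B B' : nat -> T -> nat).
Variables (S : nat -> T -> R) (a b : nat) (w : T).
Hypotheses (ba : (b <= a)%N) (AA : forall l, (l < a)%N -> A' l w = A l w).
Hypotheses (BB : forall l, (l < b)%N -> B' l w = B l w).
Hypotheses (B1 : forall l, (1 <= B l w)%N) (B1' : forall l, (1 <= B' l w)%N).

Lemma g_first_agree n : (n <= b)%N -> g_first B' n w = g_first B n w.
Proof.
by move=> nb; apply: eq_big_nat => l /andP[_ ln]; rewrite BB// (leq_trans ln).
Qed.

Lemma g_batch_arrival_agree n : (n < a)%N ->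
  g_batch_arrival A' I n w = g_batch_arrival A I n w.
Proof.
move=> na; rewrite /g_batch_arrival big_nat_cond [RHS]big_nat_cond.
by apply: eq_bigr => l /andP[/andP[_ ln] _]; rewrite AA// (leq_trans ln).
Qed.

(** A customer with index below [first b] belongs to one of the first [b] batches. The sizes that
    locate it are known, and so are the interarrival times up to its batch, because [b <= a]. *)
Lemma g_arrival_agree k : (k < g_first B b w)%N ->
  g_arrival A' I B' k w = g_arrival A I B k w.
Proof.
move=> kb; have nb := g_batch_of_lt B1 kb.
rewrite /g_arrival; have -> : g_batch_of B' k w = g_batch_of B k w.
  apply: g_batch_of_eq => //; rewrite !g_first_agree//; last exact: ltnW.
  exact: g_batch_ofP.
by rewrite g_batch_arrival_agree// (leq_trans nb).
Qed.

Lemma g_dep_agree k : (k <= g_first B b w)%N ->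
  g_dep A' I B' S k w = g_dep A I B S k w.
Proof.
elim: k => //= k IH kb; rewrite g_arrival_agree// IH//; exact: ltnW.
Qed.

End TruncatedInputs.

Section QueueDynamics.
Context {R : realType} d (T : measurableType d) (P : probability T R) (N : nat).
Variable q : queue P N.
Local Notation A := (interarrival q).
Local Notation I := (init_batches q).
Local Notation B := (batch_size q).
Local Notation S := (service q).

Lemma batch_arrivalE n w : batch_arrival q n w = g_batch_arrival A I n w.
Proof. by []. Qed.

Lemma firstE n w : first q n w = g_first B n w.
Proof. by []. Qed.

Lemma depE k w : dep q k w = g_dep A I B S k w.
Proof. by elim: k => //= k ->. Qed.

Lemma measurable_first n : measurable_fun setT (first q n).
Proof. exact: measurable_g_first. Qed.

Lemma measurable_arrival k : measurable_fun setT (arrival q k).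
Proof. exact: measurable_g_arrival. Qed.

Lemma measurable_batch_arrival n : measurable_fun setT (batch_arrival q n).
Proof. exact: measurable_g_batch_arrival. Qed.

Lemma measurable_dep k : measurable_fun setT (dep q k).
Proof.
rewrite (_ : dep q k = g_dep A I B S k); last by apply/funext => w; exact: depE.
exact: measurable_g_dep.
Qed.

Lemma measurable_start k : measurable_fun setT (start q k).
Proof.
by apply: measurable_maxr; [exact: measurable_arrival|exact: measurable_dep].
Qed.

Lemma measurable_waiting k : measurable_fun setT (waiting q k).
Proof.
by apply: measurable_funB; [exact: measurable_start|exact: measurable_arrival].
Qed.

Lemma measurable_sojourn k : measurable_fun setT (sojourn q k).
Proof.
by apply: measurable_funB; [exact: measurable_dep|exact: measurable_arrival].
Qed.

Lemma measurable_sc_waiting n : measurable_fun setT (sc_waiting q n).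
Proof.
apply: measurable_funB; last exact: measurable_batch_arrival.
by apply: measurable_random_index; [exact: measurable_start|exact: measurable_first].
Qed.

Lemma measurable_sc_sojourn n : measurable_fun setT (sc_sojourn q n).
Proof.
apply: measurable_funB; last exact: measurable_batch_arrival.
by apply: measurable_random_index; [exact: measurable_dep|exact: measurable_first].
Qed.

Lemma measurable_sc_num_left n : measurable_fun setT (sc_num_left q n).
Proof.
rewrite (_ : sc_num_left q n = fun w => #|` fset_set
    [set l | (n <= l)%N && (batch_arrival q l w <= dep q (first q n w) w)]|%fset).
  apply: (@measurable_card _ _ (fun l w => (n <= l)%N &&
      (batch_arrival q l w <= dep q (first q n w) w))) => l.
  apply: measurable_and; first exact: measurable_cst.
  apply: measurable_fun_ler; first exact: measurable_batch_arrival.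
  by apply: measurable_random_index; [exact: measurable_dep|exact: measurable_first].
apply/funext => w; rewrite /sc_num_left; congr (#|` fset_set _|)%fset.
by apply/seteqP; split => l /= /andP.
Qed.

Lemma measurable_num_left k : measurable_fun setT (num_left q k).
Proof.
rewrite (_ : num_left q k = fun w => #|` fset_set
    [set l | (k <= l)%N && (arrival q l w <= dep q k w)]|%fset).
  apply: (@measurable_card _ _ (fun l w => (k <= l)%N &&
      (arrival q l w <= dep q k w))) => l.
  apply: measurable_and; first exact: measurable_cst.
  by apply: measurable_fun_ler; [exact: measurable_arrival|exact: measurable_dep].
apply/funext => w; rewrite /num_left; congr (#|` fset_set _|)%fset.
by apply/seteqP; split => l /= /andP.
Qed.

Hypothesis mtype : forall k i, measurable [set w | ctype q k w = i].

Lemma measurable_type_at (K : T -> nat) i : measurable_fun setT K ->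
  measurable [set w | ctype q (K w) w = i].
Proof.
move=> mK; rewrite (_ : [set _ | _] =
    \bigcup_k ([set w | K w = k] `&` [set w | ctype q k w = i])).
  by apply: bigcup_measurable => k _; apply: measurableI => //; exact: measurable_fiber.
by apply/seteqP; split => w /= => [h|[k _ [<-]]//]; exists (K w).
Qed.

End QueueDynamics.

(** * Histories and their independence of the future inputs *)

Section FinitePartition.
Context d (T : measurableType d) (R : realType) (mu : {measure set T -> \bar R}).
Hypothesis mufin : (mu setT < +oo)%E.

Lemma fine_measure_partition (I : finType) (F : T -> I) (D : set T) :
  measurable D -> (forall i, measurable [set w | F w = i]) ->
  fine (mu D) = \sum_i fine (mu (D `&` [set w | F w = i])).
Proof.
move=> mD mF.
have := cint_partition mufin mD mF (cbm_cst T (1 : R[i])).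
rewrite cint_cst// mul1r => /(congr1 (@complex.Re R)); rewrite cRe_sum /= => ->.
apply: eq_bigr => i _; rewrite Rintegral_cst ?mul1r//.
by apply: measurableI.
Qed.

Lemma measure_partition0 (I : finType) (F : T -> I) (D : set T) :
  measurable D -> (forall i, measurable [set w | F w = i]) ->
  (forall i, mu (D `&` [set w | F w = i]) = 0%E) -> mu D = 0%E.
Proof.
move=> mD mF D0; rewrite -[LHS]fineK ?mu_fin//.
by rewrite (fine_measure_partition mD mF) big1// => i _; rewrite D0.
Qed.

Lemma measure_countable_partition (F : T -> nat) (D : set T) :
  measurable D -> measurable_fun setT F ->
  (\sum_(0 <= k < n) fine (mu (D `&` [set w | F w = k]))) @[n --> \oo] --> fine (mu D).
Proof.
move=> mD mF; have mFk k := measurable_fiber mF k.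
have -> : fine (mu D) = \int[mu]_(w in D) (cst 1 w).
  by rewrite Rintegral_cst// mul1r.
pose f n w := \sum_(0 <= k < n) \1_[set w | F w = k] w : R.
have bf k : bmfun (\1_[set w | F w = k] : T -> R) by exact: bmfun_indic.
have fE n w : f n w = if (F w < n)%N then 1 else 0.
  rewrite /f; case: ifPn => Fn.
    rewrite (bigD1_seq (F w)) ?iota_uniq ?mem_index_iota//= indicE mem_set//.
    by rewrite big1 ?addr0// => k kF; rewrite indicE memNset//= => /esym/eqP;
      rewrite (negbTE kF).
  rewrite big_nat_cond big1// => k /andP[/andP[_ kn] _]; rewrite indicE memNset//=.
  by move=> Fk; move: Fn; rewrite Fk kn.
rewrite (_ : (fun n => _) = (fun n => \int[mu]_(w in D) f n w)); last first.
  apply/funext => n; rewrite bRintegral_sum//; apply: eq_bigr => k _.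
  by rewrite Rintegral_indicE.
apply: (bounded_convergence mufin (C := 1)) => //.
- by move=> n; have [] := bmfun_sum (index_iota 0 n) bf.
- by move=> n w _; rewrite fE; case: ifP => _; rewrite ?normr1 ?normr0.
- move=> w _; apply: cvg_near_cst; exists (F w).+1 => // n /= Fn.
  by rewrite fE Fn.
Qed.

(** Allows a proportionality between two events to be checked on each value of a random index; all
    passages from a fixed customer to a random one go through it. *)
Lemma eq_measure_countable (F : T -> nat) (D D' : set T) (c : R) :
  measurable D -> measurable D' -> measurable_fun setT F ->
  (forall k, fine (mu (D `&` [set w | F w = k])) =
             c * fine (mu (D' `&` [set w | F w = k]))) ->
  fine (mu D) = c * fine (mu D').
Proof.
move=> mD mD' mF h.
apply: (cvg_unique (@Rhausdorff R) (measure_countable_partition mD mF)).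
rewrite (_ : (fun n => _) = (fun n => c *
    \sum_(0 <= k < n) fine (mu (D' `&` [set w | F w = k])))).
  exact: cvgMl_tmp (measure_countable_partition mD' mF).
by apply/funext => n; rewrite mulr_sumr; apply: eq_bigr.
Qed.

Lemma measure_setI_full (D A : set T) : measurable D -> measurable A ->
  mu (~` A) = 0%E -> mu (D `&` A) = mu D.
Proof.
move=> mD mA A0; have mDA : measurable (D `&` ~` A) by exact/measurableI/measurableC.
have h : mu (D `&` ~` A) = 0%E.
  apply/eqP; rewrite -measure_le0 -A0; apply: le_measure; rewrite ?inE//.
  exact: measurableC.
rewrite -[in RHS](setIT D) -(setUv A) setIUr measureU//.
- by rewrite [X in (_ + X)%E]h adde0.
- exact: measurableI.
- by rewrite setIACA setICr setI0.
Qed.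

Lemma eq_measure_full (D D' A : set T) : measurable D -> measurable D' ->
  measurable A -> mu (~` A) = 0%E -> (forall w, A w -> D w <-> D' w) -> mu D = mu D'.
Proof.
move=> mD mD' mA A0 DD'; rewrite -(measure_setI_full mD mA A0).
rewrite -(measure_setI_full mD' mA A0); congr (mu _).
by apply/seteqP; split => w [] h Aw; split => //; apply/DD'.
Qed.

End FinitePartition.

Section QueueProbability.
Context (R : realType) (N : nat) (lambda : R).
Context (K Kstar : 'I_N -> 'I_N -> {measure set R -> \bar R}).
Context d (T : measurableType d) (P : probability T R) (q : queue P N).
Hypothesis lambda_gt0 : 0 < lambda.
Hypothesis Hq : MXSM2_queue q lambda K Kstar.
Local Notation A := (interarrival q).
Local Notation I := (init_batches q).
Local Notation B := (batch_size q).
Local Notation S := (service q).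

Implicit Types (pa pb : pred nat) (k l n : nat).

Lemma mtype k i : measurable [set w | ctype q k w = i].
Proof. by case: Hq. Qed.

Lemma size_ge1 n w : (1 <= B n w)%N.
Proof. by case: Hq. Qed.

Let Pf : (P setT < +oo)%E := Pfin P.

Lemma inter0_fun : measurable_fun setT (A 0%N : T -> measurableTypeR R).
Proof. by have : measurable_fun setT (A 0%N) by []. Qed.

(** The exponential law, obtained as the law of one of the inputs: this makes it a bundled finite
    measure, as the lemmas on spacings require. *)
Definition exp_law : {finite_measure set (measurableTypeR R) -> \bar R} :=
  law measurableT Pf inter0_fun.

Lemma exp_lawE (X : set (measurableTypeR R)) : measurable X ->
  exp_law X = exponential_prob lambda X.
Proof.
move=> mX; rewrite /exp_law/= /law setTI.
by case: Hq => _ /(_ 0%N X mX).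
Qed.

Lemma inter_law n (X : set (measurableTypeR R)) : measurable X ->
  P (A n @^-1` X) = exp_law X.
Proof. by move=> mX; rewrite exp_lawE//; case: Hq => _ /(_ n X mX). Qed.

Lemma exp_law_le (t : R) : 0 <= t ->
  fine (exp_law `]-oo, t]%classic) = 1 - expR (- lambda * t).
Proof.
move=> t0; have h := exponential_law_gt lambda_gt0 exp_lawE t0.
pose X : set (measurableTypeR R) := `]-oo, t]%classic.
pose Y : set (measurableTypeR R) := `]t, +oo[%classic.
have mX : measurable X by exact: measurable_itv.
have mY : measurable Y by exact: measurable_itv.
have UE : setT = X `|` Y.
  by apply/seteqP; split => x //= _; rewrite /X/Y/= !in_itv/= andbT;
    case: (leP x t); [left|right].
have := exponential_lawT lambda_gt0 exp_lawE.
rewrite {1}UE measureU//; last first.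
  by apply/seteqP; split => x //=; rewrite /X/Y/= !in_itv/= andbT => -[]; lra.
move=> e; have {e} : (exp_law X + exp_law Y)%E = 1%E := e.
rewrite [exp_law Y]h -[exp_law X]fineK ?fin_num_measure// -EFinD => -[] e.
by rewrite -e addrK.
Qed.

Lemma exp_law_le0 : exp_law `]-oo, 0]%classic = 0%E.
Proof.
have m0 : measurable (`]-oo, 0%R]%classic : set (measurableTypeR R)).
  exact: measurable_itv.
rewrite -[LHS]fineK ?fin_num_measure//.
by have := exp_law_le (lexx 0); rewrite mulr0 expR0 subrr => ->.
Qed.

Definition input_past (pa pb : pred nat) : set (nat + nat + unit) :=
  [set x | match x with
           | inl (inl l) => pa l
           | inl (inr l) => pb l
           | inr _ => True
           end].

Definition history_gen (pa pb : pred nat) k : set (set T) :=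
  (\bigcup_(x in input_past pa pb) input_events q x) `|`
  (\bigcup_(l in [set l | (l < k)%N])
     (events_of (S l) `|` preimage_set_system setT (ctype q l.+1) setT)).

(* [pa] and [pb] select the interarrival times and the batch sizes that are known. *)
Definition history pa pb k : set (set T) := <<s history_gen pa pb k >>.

Lemma history_past k : past q k = history xpredT xpredT k.
Proof.
rewrite /past /history /history_gen; congr (<<s _ `|` _ >>).
apply/seteqP; split => X [x _ hx]; exists x => //.
by case: x hx => [[l|l]|u].
Qed.

Lemma input_events_measurable x : input_events q x `<=` measurable.
Proof.
case: x => [[n|n]|[]] X [Y mY <-]; rewrite ?setTI.
- exact: measurable_preimageT.
- exact: measurable_preimageT.
rewrite (_ : _ @^-1` Y = \bigcup_n \bigcup_(i in [set i | Y (n, i)])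
    ([set w | I w = n] `&` [set w | ctype q 0 w = i])).
  apply: bigcup_measurable => n _; apply: fin_bigcup_measurable => //.
  move=> i _; apply: measurableI; last exact: mtype.
  exact: measurable_fiber.
apply/seteqP; split => w /=; first by move=> Yw; exists (I w) => //; exists (ctype q 0 w).
by move=> [n _ [i Yni [In ci]]]; rewrite In ci.
Qed.

Lemma history_gen_measurable pa pb k : history_gen pa pb k `<=` measurable.
Proof.
move=> X [[x _]|[l _ []]]; first exact: input_events_measurable.
  by move=> [Y mY <-]; rewrite setTI; exact: measurable_preimageT.
move=> [Y _ <-]; rewrite setTI.
rewrite (_ : _ @^-1` Y = \bigcup_(i in Y) [set w | ctype q l.+1 w = i]).
  by apply: fin_bigcup_measurable => // i _; exact: mtype.
by apply/seteqP; split => w /= => [Yw|[i Yi ->]//]; exists (ctype q l.+1 w).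
Qed.

Lemma history_measurable pa pb k X : history pa pb k X -> measurable X.
Proof.
by apply: smallest_sub; [exact: sigma_algebra_measurable|exact: history_gen_measurable].
Qed.

Lemma history_sub (pa pb pa' pb' : pred nat) k k' :
  (forall l, pa l -> pa' l) -> (forall l, pb l -> pb' l) -> (k <= k')%N ->
  history pa pb k `<=` history pa' pb' k'.
Proof.
move=> ha hb kk'; apply: sub_sigma_algebra2 => X [[x xp Xx]|[l lk Xl]].
  by left; exists x => //; case: x xp {Xx} => [[l|l]|u]//=; [exact: ha|exact: hb].
by right; exists l => //=; exact: leq_trans kk'.
Qed.

Lemma past_measurable k X : past q k X -> measurable X.
Proof. by rewrite history_past; exact: history_measurable. Qed.

Lemma historyT pa pb k : history pa pb k setT.
Proof.
by have := @measurableT _ (g_sigma_algebraType (history_gen pa pb k)).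
Qed.

Lemma historyI pa pb k X Y : history pa pb k X -> history pa pb k Y ->
  history pa pb k (X `&` Y).
Proof. exact: (@measurableI _ (g_sigma_algebraType (history_gen pa pb k))). Qed.

(* Stated on the type that carries the history as its sigma-algebra, so that the
   measurability lemmas for the dynamics apply to it. *)
Definition hmeas pa pb k d1 (T1 : measurableType d1) (X : T -> T1) :=
  measurable_fun setT (X : g_sigma_algebraType (history_gen pa pb k) -> T1).

Lemma hmeasP pa pb k d1 (T1 : measurableType d1) (X : T -> T1) Y :
  hmeas pa pb k X -> measurable Y -> history pa pb k (X @^-1` Y).
Proof. by move=> hX mY; exact: (measurable_preimageT hX mY). Qed.

Lemma hmeas_events pa pb k d1 (T1 : measurableType d1) (X : T -> T1) :
  (forall Y, measurable Y -> history_gen pa pb k (X @^-1` Y)) -> hmeas pa pb k X.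
Proof.
by move=> h _ Y mY; rewrite setTI; apply: sub_sigma_algebra; exact: h.
Qed.

Lemma hmeas_inter pa pb k l : pa l -> hmeas pa pb k (A l).
Proof.
move=> pal; apply: hmeas_events => Y mY; left; exists (inl (inl l)) => //=.
by exists Y => //; rewrite setTI.
Qed.

Lemma hmeas_size pa pb k l : pb l -> hmeas pa pb k (B l).
Proof.
move=> pbl; apply: hmeas_events => Y mY; left; exists (inl (inr l)) => //=.
by exists Y => //; rewrite setTI.
Qed.

Lemma hmeas_init pa pb k : hmeas pa pb k I.
Proof.
apply: hmeas_events => Y mY; left; exists (inr tt) => //=.
by exists [set z | Y z.1] => //; rewrite setTI.
Qed.

Lemma hmeas_service pa pb k l : (l < k)%N -> hmeas pa pb k (S l).
Proof.
move=> lk; apply: hmeas_events => Y mY; right; exists l => //=; left.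
by exists Y => //; rewrite setTI.
Qed.

Lemma history_type pa pb k l i : (l <= k)%N ->
  history pa pb k [set w | ctype q l w = i].
Proof.
case: l => [_|l lk]; apply: sub_sigma_algebra.
  by left; exists (inr tt) => //=; exists [set z | z.2 = i] => //; rewrite setTI.
by right; exists l => //=; right; exists [set i] => //; rewrite setTI.
Qed.

(** Unknown inputs are replaced by constants. An unknown batch size becomes 1 and not 0, so that all
    batches remain nonempty and the lemmas on the dynamics still apply. *)
Definition cutA (pa : pred nat) l w : R := if pa l then A l w else 0.
Definition cutB (pb : pred nat) l w : nat := if pb l then B l w else 1%N.

Lemma cutB1 pb l w : (1 <= cutB pb l w)%N.
Proof. by rewrite /cutB; case: ifP => // _; exact: size_ge1. Qed.

Lemma hmeas_cutA pa pb k l : hmeas pa pb k (cutA pa l).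
Proof.
rewrite /cutA; case: (boolP (pa l)) => pal; first exact: hmeas_inter.
exact: measurable_cst.
Qed.

Lemma hmeas_cutB pa pb k l : hmeas pa pb k (cutB pb l).
Proof.
rewrite /cutB; case: (boolP (pb l)) => pbl; first exact: hmeas_size.
exact: measurable_cst.
Qed.

Lemma hmeas_first pa pb k n : hmeas pa pb k (g_first (cutB pb) n).
Proof. by apply: measurable_g_first => l; exact: hmeas_cutB. Qed.

Lemma hmeas_batch_arrival pa pb k n : hmeas pa pb k (g_batch_arrival (cutA pa) I n).
Proof.
apply: measurable_g_batch_arrival; first by move=> l; exact: hmeas_cutA.
exact: hmeas_init.
Qed.

Lemma hmeas_arrival pa pb k k' : hmeas pa pb k (g_arrival (cutA pa) I (cutB pb) k').
Proof.
apply: measurable_g_arrival.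
- by move=> l; exact: hmeas_cutA.
- exact: hmeas_init.
- by move=> l; exact: hmeas_cutB.
Qed.

Lemma hmeas_dep pa pb k k' : (k' <= k)%N ->
  hmeas pa pb k (g_dep (cutA pa) I (cutB pb) S k').
Proof.
move=> k'k; apply: measurable_g_dep.
- by move=> l; exact: hmeas_cutA.
- exact: hmeas_init.
- by move=> l; exact: hmeas_cutB.
- by move=> l lk'; apply: hmeas_service; exact: leq_trans k'k.
Qed.

End QueueProbability.

(** * Paths of full probability and the service law on them *)

Section GoodPaths.
Context (R : realType) (N : nat) (lambda : R).
Context (K Kstar : 'I_N -> 'I_N -> {measure set R -> \bar R}).
Context d (T : measurableType d) (P : probability T R) (q : queue P N).
Hypothesis lambda_gt0 : 0 < lambda.
Hypothesis Hq : MXSM2_queue q lambda K Kstar.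
Local Notation A := (interarrival q).
Local Notation I := (init_batches q).
Local Notation B := (batch_size q).
Local Notation S := (service q).
Implicit Types (pa pb : pred nat) (k l n : nat).
Let Pf : (P setT < +oo)%E := Pfin P.
Let mtype := mtype Hq.

Lemma measurable_service k X : measurable X -> measurable (S k @^-1` X).
Proof. by move=> mX; exact: measurable_preimageT. Qed.

(** The law of a service is given only jointly with the two types and with the state of the server.
    On each cell of this finite partition it is a kernel mass, and the kernels do not charge
    negative times. *)
Lemma service_neg0 k : P [set w | S k w < 0] = 0%E.
Proof.
pose F w := (ctype q k w, ctype q k.+1 w, num_left q k w == 0%N).
have mneg : measurable [set x : R | x < 0].
  by apply: measurable_set_lt => //; exact: measurable_id.
have mleft b : measurable [set w | (num_left q k w == 0%N) = b].
  apply: (@measurable_setT_eq _ _ _ (fun w => num_left q k w == 0%N)).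
  exact: (measurable_nat_comp (fun x => (x == 0%N) == b) (measurable_num_left q k)).
have mS : measurable [set w | S k w < 0] by exact: (measurable_service k mneg).
have mF x : measurable [set w | F w = x].
  case: x => [[i j] b]; rewrite (_ : [set _ | _] = [set w | ctype q k w = i] `&`
      [set w | ctype q k.+1 w = j] `&` [set w | (num_left q k w == 0%N) = b]).
    by apply: measurableI => //; apply: measurableI; exact: mtype.
  by apply/seteqP; split => w /=; rewrite /F; [move=> [-> -> ->]|move=> [[-> ->] ->]].
apply: (measure_partition0 Pf mS mF) => -[[i j] b].
have past0 : past q k setT by rewrite history_past; exact: historyT.
case: b; have := Hq.
- move=> [_ _ _ _ _ _ _ /(_ i)[_ /(_ j) K0] _ /(_ k i j _ _ past0 mneg)].
  rewrite /= K0 mule0 => <-; congr (P _).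
  apply/seteqP; split => w /=; rewrite /F; first by move=> [? [-> -> ->]].
  by move=> [[_ [-> ->]] [? ->]].
- move=> [_ _ _ _ _ _ /(_ i)[_ /(_ j) K0] _ /(_ k i j _ _ past0 mneg) + _].
  rewrite /= K0 mule0 => <-; congr (P _); apply/seteqP; split => w /=; rewrite /F.
    by move=> [? [-> -> /negbT]]; rewrite -lt0n.
  by move=> [[_ [-> h]] [? ->]]; split => //; rewrite gtn_eqF.
Qed.

Lemma inter_le0 n : P [set w | A n w <= 0] = 0%E.
Proof.
rewrite -(exp_law_le0 lambda_gt0 Hq) -(inter_law Hq n); last exact: measurable_itv.
by congr (P _); apply/seteqP; split => w /=; rewrite in_itv.
Qed.

Lemma input_product (s : seq (nat + nat + unit)) E : uniq s ->
  (forall x, x \in s -> input_events q x (E x)) ->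
  P (\bigcap_(x in [set` s]) E x) = (\prod_(x <- s) P (E x))%E.
Proof. by case: Hq => _ _ _ _ _ + _ _ _ _; exact. Qed.

Lemma inter_bounded_prob (t : R) i m : 0 <= t ->
  P [set w | forall l, (i <= l < i + m)%N -> A l w <= t] =
  ((1 - expR (- lambda * t)) ^+ m)%:E.
Proof.
move=> t0.
pose s : seq (nat + nat + unit) := [seq inl (inl l) | l <- iota i m].
pose E (x : nat + nat + unit) : set T :=
  if x is inl (inl l) then A l @^-1` `]-oo, t]%classic else setT.
have us : uniq s by rewrite map_inj_uniq ?iota_uniq// => x y [].
have sE x : x \in s -> input_events q x (E x).
  by move=> /mapP[l _ ->]; exists `]-oo, t]%classic => //; rewrite setTI.
have -> : [set w | forall l, (i <= l < i + m)%N -> A l w <= t] =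
    \bigcap_(x in [set` s]) E x.
  apply/seteqP; split => w /= h.
    by move=> x /mapP[l]; rewrite mem_iota => lim ->; rewrite /E/= in_itv/=; exact: h.
  move=> l lim; have := h (inl (inl l)); rewrite /E/= in_itv/=; apply.
  by apply/mapP; exists l => //; rewrite mem_iota.
rewrite input_product// /s big_map.
under eq_bigr do rewrite /E (inter_law Hq)//.
rewrite -(exp_law_le lambda_gt0 Hq t0).
have fi : exp_law q `]-oo, t]%classic \is a fin_num.
  by apply: fin_num_measure; exact: measurable_itv.
rewrite -[X in (\prod_(_ <- _) X)%E](fineK fi).
clear; elim: m i => [|m IH] i; first by rewrite big_nil expr0.
by rewrite big_cons IH exprS EFinM.
Qed.

(* Unbounded interarrival times make the sets counted by [num_left] and
   [sc_num_left] finite. *)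
Definition good : set T := [set w | (forall l, 0 < A l w) /\ (forall k, 0 <= S k w) /\
  (forall t : nat, exists l, (I w <= l)%N /\ t%:R < A l w)].

Let bad_inter := \bigcup_l [set w | A l w <= 0].
Let bad_service := \bigcup_k [set w | S k w < 0].
Let bad_bounded := \bigcup_(t : nat) [set w | forall l, (I w <= l)%N -> A l w <= t%:R].

Let goodE : ~` good = bad_inter `|` bad_service `|` bad_bounded.
Proof.
apply/seteqP; split => w /=.
  move=> nw; apply: contrapT => h; apply: nw; split; last split.
  - move=> l; rewrite ltNge; apply/negP => h'; apply: h; left; left; by exists l.
  - move=> k; rewrite leNgt; apply/negP => h'; apply: h; left; right; by exists k.
  - move=> t; apply: contrapT => h'; apply: h; right; exists t => //= l Il.
    by rewrite leNgt; apply/negP => h''; apply: h'; exists l.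
move=> [[[l _ h]|[k _ h]]|[t _ h]] [h1 [h2 h3]].
- by have := h1 l; rewrite ltNge h.
- by have := h2 k; rewrite leNgt h.
- by have [l [Il]] := h3 t; rewrite ltNge h.
Qed.

Let mbad_inter l : measurable [set w | A l w <= 0].
Proof. exact: measurable_set_le. Qed.

Let mbad_service k : measurable [set w | S k w < 0].
Proof. exact: measurable_set_lt. Qed.

Let mbounded (t : R) l : measurable [set w | A l w <= t].
Proof. exact: measurable_set_le. Qed.

Let mbad_bounded (t : nat) : measurable [set w | forall l, (I w <= l)%N -> A l w <= t%:R].
Proof.
rewrite (_ : [set _ | _] = \bigcap_l (~` [set w | (I w <= l)%N] `|` [set w | A l w <= t%:R])).
  apply: bigcap_measurableType => l _; apply: measurableU => //; apply: measurableC.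
  apply: measurable_set_bool; exact: (measurable_nat_comp (fun x => (x <= l)%N)).
apply/seteqP; split => w /= h l.
  by move=> _; case: (boolP (I w <= l)%N) => Il; [right; exact: h|left; exact/negP].
by move=> Il; case: (h l Logic.I).
Qed.

Let mbad : measurable (bad_inter `|` bad_service `|` bad_bounded).
Proof.
by apply: measurableU; [apply: measurableU|]; apply: bigcup_measurable => ? _.
Qed.

Lemma measurable_good : measurable good.
Proof. by rewrite -(setCK good) goodE; exact: measurableC. Qed.

(** From any fixed index [i] on, [m] consecutive interarrival times are at most [t] with probability
    [c ^ m], where [c < 1], and [m] is arbitrary. The random starting index [I w] is absorbed by a
    countable union over [i]. *)
Let null_bounded (t : nat) :
  P [set w | forall l, (I w <= l)%N -> A l w <= t%:R] = 0%E.
Proof.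
pose c := 1 - expR (- lambda * t%:R).
have c0 : 0 <= c by rewrite subr_ge0 -expR0 ler_expR mulNr oppr_le0 mulr_ge0// ltW.
have c1 : c < 1 by rewrite ltrBlDr ltrDl expR_gt0.
pose U i := [set w | forall l, (i <= l)%N -> A l w <= t%:R].
have mV i m : measurable [set w | forall l, (i <= l < i + m)%N -> A l w <= t%:R].
  rewrite (_ : [set _ | _] =
      \bigcap_(l in [set l | (i <= l < i + m)%N]) [set w | A l w <= t%:R]).
    exact: bigcap_measurableType.
  by apply/seteqP; split.
have mU i : measurable (U i).
  rewrite (_ : U i = \bigcap_(l in [set l | (i <= l)%N]) [set w | A l w <= t%:R]).
    exact: bigcap_measurableType.
  by apply/seteqP; split.
have U0 i : P (U i) = 0%E.
  rewrite -[LHS]fineK ?(mu_fin Pf)//; congr EFin.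
  apply/eqP; rewrite eq_le fine_ge0// andbT.
  have cm m : fine (P (U i)) <= c ^+ m.
    rewrite -lee_fin fineK ?(mu_fin Pf)//.
    rewrite -(inter_bounded_prob i m (ler0n R t)).
    apply: le_measure; rewrite ?inE//.
    by move=> w h l /andP[il _]; exact: h.
  have := @cvg_expr R c; rewrite ger0_norm// => /(_ c1) h.
  by apply: (cvgr_to_ge h); exact: nearW.
apply: (measure_negligible (mbad_bounded t)).
apply: (negligibleS (A := \bigcup_i U i)).
  by move=> w h; exists (I w) => //= l; exact: h.
by apply: negligible_bigcup => i; exists (U i); split; [exact: mU|exact: U0|].
Qed.

Lemma good_full : P (~` good) = 0%E.
Proof.
apply: measure_negligible; first exact/measurableC/measurable_good.
rewrite goodE; apply: negligibleU; first apply: negligibleU.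
- apply: negligible_bigcup => l; exists [set w | A l w <= 0]; split => //.
  exact: inter_le0.
- apply: negligible_bigcup => k; exists [set w | S k w < 0]; split => //.
  exact: service_neg0.
- apply: negligible_bigcup => t; eexists; split; [exact: mbad_bounded|exact: null_bounded|].
  by [].
Qed.

Lemma good_unbounded w (D : R) : good w -> exists l, D < batch_arrival q l w.
Proof.
move=> [h1 [h2 h3]]; have [l [Il hl]] := h3 (Num.truncn `|D|).+1.
exists l; apply: (@lt_le_trans _ _ (A l w)).
  by apply: le_lt_trans hl; rewrite (le_trans (ler_norm D))// ltW// truncnS_gt.
by rewrite batch_arrivalE; apply: g_batch_arrival_ge.
Qed.

(** The left side looks at all later arrivals, the right side only at two times that the early
    inputs and services determine. This is what makes the condition in the service law visible to a
    truncated history. *)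
Lemma good_num_left0 w k : good w ->
  (num_left q k w == 0%N) = (dep q k w < arrival q k w).
Proof.
move=> gw; have [h1 [h2 h3]] := gw.
have B1 l : (1 <= B l w)%N by exact: (size_ge1 Hq).
have h := g_card_left_customers (A := fun l => A l) (I := I) (B := fun l => B l)
  B1 h1 k (good_unbounded (dep q k w) gw).
exact: h.
Qed.

Definition busy_at k : set T := [set w | arrival q k w <= dep q k w].
Definition idle_at k : set T := [set w | dep q k w < arrival q k w].

Lemma measurable_busy_at k : measurable (busy_at k).
Proof.
by apply: measurable_set_le; [exact: measurable_arrival|exact: measurable_dep].
Qed.

Lemma measurable_idle_at k : measurable (idle_at k).
Proof.
by apply: measurable_set_lt; [exact: measurable_dep|exact: measurable_arrival].
Qed.

Let next k X j : set T := S k @^-1` X `&` [set w | ctype q k.+1 w = j].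

Let mnext k X j : measurable X -> measurable (next k X j).
Proof. by move=> mX; apply: measurableI; [exact: measurable_service|exact: mtype]. Qed.

Lemma service_step (p : pred nat) (L : 'I_N -> 'I_N -> {measure set R -> \bar R})
    (D : set T) k i j (H X : set _) :
  service_law q p L -> measurable D ->
  (forall w, good w -> p (num_left q k w) <-> D w) ->
  past q k H -> measurable X ->
  P (H `&` [set w | ctype q k w = i] `&` D `&` next k X j) =
  (P (H `&` [set w | ctype q k w = i] `&` D) * L i j X)%E.
Proof.
move=> sl mD e pH mX; have mH := past_measurable Hq pH; have mn := mnext k j mX.
pose X1 := H `&` [set w | ctype q k w = i /\ p (num_left q k w)].
pose X2 : set T := [set w | X (S k w) /\ ctype q k.+1 w = j].
have e0 : P (X1 `&` X2) = (P X1 * L i j X)%E by exact: sl.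
have mX1 : measurable X1.
  rewrite (_ : X1 = H `&` ([set w | ctype q k w = i] `&` [set w | p (num_left q k w)]))//.
  apply: measurableI => //; apply: measurableI => //; apply: measurable_set_bool.
  exact: (measurable_nat_comp p (measurable_num_left q k)).
have mHb : measurable (H `&` [set w | ctype q k w = i] `&` D).
  by apply: measurableI => //; exact: measurableI.
have mg := measurable_good; have g0 := good_full.
have -> : P (H `&` [set w | ctype q k w = i] `&` D `&` next k X j) = P (X1 `&` X2).
  apply: (eq_measure_full _ _ mg g0); [exact: measurableI|exact: measurableI|].
  move=> w /e h; split => [[[[h1 h2] /h h3] h4]|[[h1 [h2 /h h3]] h4]].
    by split.
  by do !split => //; case: h4.
rewrite e0; congr (_ * _)%E.
apply: (eq_measure_full mX1 mHb mg g0).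
by move=> w /e h; split => [[h1 [h2 /h h3]]|[[h1 h2] /h h3]].
Qed.

Lemma service_busy_step k i j (H X : set _) : past q k H -> measurable X ->
  P (H `&` [set w | ctype q k w = i] `&` busy_at k `&` next k X j) =
  (P (H `&` [set w | ctype q k w = i] `&` busy_at k) * K i j X)%E.
Proof.
apply: (service_step (p := fun x => (1 <= x)%N)).
- exact: (service_busy Hq).
- exact: measurable_busy_at.
- by move=> w gw; rewrite /= lt0n (good_num_left0 k gw) -leNgt.
Qed.

Lemma service_idle_step k i j (H X : set _) : past q k H -> measurable X ->
  P (H `&` [set w | ctype q k w = i] `&` idle_at k `&` next k X j) =
  (P (H `&` [set w | ctype q k w = i] `&` idle_at k) * Kstar i j X)%E.
Proof.
apply: (service_step (p := fun x => x == 0%N)).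
- exact: (service_idle Hq).
- exact: measurable_idle_at.
- by move=> w gw; rewrite /= (good_num_left0 k gw).
Qed.

End GoodPaths.

Section ServiceAtRandomIndex.
Context (R : realType) (N : nat) (lambda : R).
Context (K Kstar : 'I_N -> 'I_N -> {measure set R -> \bar R}).
Context d (T : measurableType d) (P : probability T R) (q : queue P N).
Hypothesis lambda_gt0 : 0 < lambda.
Hypothesis Hq : MXSM2_queue q lambda K Kstar.
Local Notation A := (interarrival q).
Local Notation I := (init_batches q).
Local Notation B := (batch_size q).
Local Notation S := (service q).
Let Pf : (P setT < +oo)%E := Pfin P.
Let mtype := mtype Hq.

(** The past stopped at the random index [kappa], in the same way as the sigma-algebra of a stopping
    time. *)
Definition past_at (kappa : T -> nat) (H : set T) :=
  forall k, past q k (H `&` [set w | kappa w = k]).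

Lemma past_at_measurable kappa H : past_at kappa H -> measurable H.
Proof.
move=> pH; rewrite (_ : H = \bigcup_k (H `&` [set w | kappa w = k])).
  by apply: bigcup_measurable => k _; exact: (past_measurable Hq (pH k)).
by apply/seteqP; split => w => [Hw|[k _ []]//]; exists (kappa w).
Qed.

Definition type_at (kappa : T -> nat) i : set T := [set w | ctype q (kappa w) w = i].
Definition busy_from (kappa : T -> nat) : set T :=
  [set w | arrival q (kappa w) w <= dep q (kappa w) w].
Definition idle_from (kappa : T -> nat) : set T :=
  [set w | dep q (kappa w) w < arrival q (kappa w) w].
Definition service_at (kappa : T -> nat) w : R := S (kappa w) w.

Lemma kernel_lty (L : 'I_N -> 'I_N -> {measure set R -> \bar R}) i j :
  semi_markov_kernel L -> (L i j setT < +oo)%E.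
Proof.
move=> /(_ i)[h _]; apply: (@le_lt_trans _ _ 1%E); last exact: ltry.
by rewrite -h (bigD1 j)//= leeDl// sume_ge0.
Qed.

Section Index.
Variable kappa : T -> nat.
Hypothesis mk : measurable_fun setT kappa.

Lemma measurable_type_from i : measurable (type_at kappa i).
Proof. exact: measurable_type_at. Qed.

Lemma measurable_type_next i : measurable (type_at (fun w => (kappa w).+1) i).
Proof.
apply: measurable_type_at => //; exact: (measurable_nat_comp (fun x => x.+1)).
Qed.

Lemma measurable_busy_from : measurable (busy_from kappa).
Proof.
apply: measurable_set_le.
  by apply: measurable_random_index => //; exact: measurable_arrival.
by apply: measurable_random_index => //; exact: measurable_dep.
Qed.

Lemma measurable_idle_from : measurable (idle_from kappa).
Proof.
apply: measurable_set_lt.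
  by apply: measurable_random_index => //; exact: measurable_dep.
by apply: measurable_random_index => //; exact: measurable_arrival.
Qed.

Lemma measurable_service_at : measurable_fun setT (service_at kappa).
Proof. by apply: (@measurable_random_index _ _ _ _ S). Qed.

Section Phase.
Variables (L : 'I_N -> 'I_N -> {measure set R -> \bar R}) (phase : nat -> set T).
Let phase_from : set T := [set w | phase (kappa w) w].
Hypothesis Lkernel : semi_markov_kernel L.
Hypotheses (mphase : forall k, measurable (phase k)) (mfrom : measurable phase_from).
Hypothesis phase_step : forall k i j (H X : set _), past q k H -> measurable X ->
  P (H `&` [set w | ctype q k w = i] `&` phase k `&`
     (S k @^-1` X `&` [set w | ctype q k.+1 w = j])) =
  (P (H `&` [set w | ctype q k w = i] `&` phase k) * L i j X)%E.

(** The law at a fixed customer is summed over the values of [kappa]; on each of them [past_at]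
    supplies an event of the past to which it applies. *)
Let phase_law i j (H X : set _) : past_at kappa H -> measurable X ->
  P (H `&` type_at kappa i `&` phase_from `&`
     (service_at kappa @^-1` X `&` type_at (fun w => (kappa w).+1) j)) =
  (P (H `&` type_at kappa i `&` phase_from) * L i j X)%E.
Proof.
move=> pH mX; have mH := past_at_measurable pH.
have mHi : measurable (H `&` type_at kappa i `&` phase_from).
  by apply: measurableI => //; apply: measurableI => //; exact: measurable_type_from.
have mN : measurable (service_at kappa @^-1` X `&` type_at (fun w => (kappa w).+1) j).
  apply: measurableI; last exact: measurable_type_next.
  exact: (measurable_preimageT measurable_service_at mX).
have Kf := mu_fin (kernel_lty i j Lkernel) mX.
rewrite -[LHS]fineK; last by apply: mu_fin => //; exact: measurableI.
rewrite -[P _ in RHS]fineK; last exact: mu_fin.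
rewrite -(fineK Kf) -EFinM mulrC; congr EFin.
apply: (eq_measure_countable Pf (F := kappa)) => //; first exact: measurableI.
move=> k; have := phase_step i j (pH k) mX.
move=> /(congr1 fine); rewrite fineM//; last first.
  apply: mu_fin => //; apply: measurableI => //.
  by apply: measurableI; [exact: (past_measurable Hq (pH k))|exact: mtype].
rewrite mulrC => e; transitivity (fine (L i j X) * fine (P (H `&` [set w | kappa w = k] `&`
    [set w | ctype q k w = i] `&` phase k))).
  rewrite -e; congr (fine (P _)); apply/seteqP; split => w /=.
    by rewrite /phase_from /type_at /service_at/= => -[[[[? h1] h2] [h3 h4]] kw];
      rewrite kw in h1 h2 h3 h4.
  by rewrite /phase_from /type_at /service_at/= => -[[[[? kw] h1] h2] [h3 h4]]; rewrite kw.
congr (_ * fine (P _)); apply/seteqP; split => w /=; rewrite /phase_from /type_at/=.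
  by move=> [[[? kw] h1] h2]; rewrite kw.
by move=> [[[? h1] h2] kw]; rewrite kw in h1 h2.
Qed.

(** [E] is known when the service of customer [kappa] starts. Given the type and the phase, the pair
    formed by the service time and the next type is therefore independent of [E], with law [L i j].
    The busy and the idle phase are the two instances. *)
Lemma cint_service_phase (H : set T) (E : T -> R) : measurable_fun setT E ->
  (forall Z, measurable Z -> past_at kappa (H `&` E @^-1` Z)) ->
  forall i j (F G : R -> R[i]), cbm F -> cbm G ->
  cint P (H `&` type_at kappa i `&` phase_from `&` type_at (fun w => (kappa w).+1) j)
    (fun w => F (E w) * G (service_at kappa w)) =
  cint P (H `&` type_at kappa i `&` phase_from) (fun w => F (E w)) * cint (L i j) setT G.
Proof.
move=> mE pHE i j F G bF bG.
have mH : measurable H.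
  by have := past_at_measurable (pHE _ measurableT); rewrite preimage_setT setIT.
have m1 : measurable (H `&` type_at kappa i `&` phase_from).
  by apply: measurableI => //; apply: measurableI => //; exact: measurable_type_from.
have m2 : measurable (H `&` type_at kappa i `&` phase_from `&`
    type_at (fun w => (kappa w).+1) j).
  by apply: measurableI => //; exact: measurable_type_next.
pose c : {nonneg R} := NngNum (@ler01 R).
have pl X Y : measurable X -> measurable Y ->
    P (H `&` type_at kappa i `&` phase_from `&`
       type_at (fun w => (kappa w).+1) j `&` E @^-1` X `&` service_at kappa @^-1` Y) =
    (P (H `&` type_at kappa i `&` phase_from `&` E @^-1` X) *
     (c%:num%:E * L i j Y))%E.
  move=> mX mY; rewrite mul1e.
  rewrite (_ : H `&` type_at kappa i `&` phase_from `&` E @^-1` X =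
    (H `&` E @^-1` X) `&` type_at kappa i `&` phase_from);
    last by apply/seteqP; split => w /=; tauto.
  rewrite -(phase_law i j (pHE _ mX) mY); congr (P _).
  by apply/seteqP; split => w /=; tauto.
have := cproduct_law Pf (kernel_lty i j Lkernel) m2 m1 mE measurable_service_at pl bF bG.
by rewrite /= ofR1 mul1r.
Qed.

End Phase.

Definition cint_service_busy := cint_service_phase (K_kernel Hq) (measurable_busy_at q)
  measurable_busy_from (service_busy_step lambda_gt0 Hq).

Definition cint_service_idle := cint_service_phase (Kstar_kernel Hq) (measurable_idle_at q)
  measurable_idle_from (service_idle_step lambda_gt0 Hq).

End Index.

End ServiceAtRandomIndex.

Lemma setI_closed_bigcap_seq (T : Type) (J : choiceType) (G : set (set T))
    (s : seq J) (E : J -> set T) :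
  G setT -> setI_closed G -> (forall x, x \in s -> G (E x)) ->
  G (\bigcap_(x in [set` s]) E x).
Proof.
move=> GT GI sG; rewrite bigcap_seq; elim: s sG => [|x s IH] sG.
  by rewrite big_nil.
rewrite big_cons; apply: GI; first by apply: sG; rewrite mem_head.
by apply: IH => y ys; apply: sG; rewrite inE ys orbT.
Qed.

(** * Independence of a stopped history and the inputs that it does not use *)

Section FutureInputs.
Context (R : realType) (N : nat) (lambda : R).
Context (K Kstar : 'I_N -> 'I_N -> {measure set R -> \bar R}).
Context d (T : measurableType d) (P : probability T R) (q : queue P N).
Hypothesis lambda_gt0 : 0 < lambda.
Hypothesis Hq : MXSM2_queue q lambda K Kstar.
Local Notation A := (interarrival q).
Local Notation I := (init_batches q).
Local Notation B := (batch_size q).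
Local Notation S := (service q).
Let Pf : (P setT < +oo)%E := Pfin P.
Let mtype := mtype Hq.

Lemma input_eventsT x : input_events q x setT.
Proof.
by case: x => [[n|n]|[]]; exists setT => //; rewrite preimage_setT setIT.
Qed.

Lemma input_eventsI x X Y : input_events q x X -> input_events q x Y ->
  input_events q x (X `&` Y).
Proof.
case: x => [[n|n]|[]] [X' mX <-] [Y' mY <-]; exists (X' `&` Y');
  rewrite ?preimage_setI ?setTI//; exact: measurableI.
Qed.

(** Expands an event that involves service [k] into events known before this service, with weights
    that depend only on the types and on the state of the server. In the induction below these
    weights are the same with and without the future event. *)
Lemma service_sum k j (H Z : set _) : past q k H -> measurable Z ->
  fine (P (H `&` (S k @^-1` Z `&` [set w | ctype q k.+1 w = j]))) =
  \sum_i (fine (P (H `&` [set w | ctype q k w = i] `&` busy_at q k)) * fine (K i j Z) +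
          fine (P (H `&` [set w | ctype q k w = i] `&` idle_at q k)) * fine (Kstar i j Z)).
Proof.
move=> pH mZ; have mH := past_measurable Hq pH.
have mN : measurable (S k @^-1` Z `&` [set w | ctype q k.+1 w = j]).
  by apply: measurableI; [exact: measurable_service|exact: mtype].
have mHN : measurable (H `&` (S k @^-1` Z `&` [set w | ctype q k.+1 w = j])).
  exact: measurableI.
rewrite (fine_measure_partition Pf mHN (mtype k)); apply: eq_bigr => i _.
have mHi : measurable (H `&` [set w | ctype q k w = i]) by exact: measurableI.
have mb := measurable_busy_at q k; have mi := measurable_idle_at q k.
have mHb : measurable (H `&` [set w | ctype q k w = i] `&` busy_at q k) by exact: measurableI.
have mHi' : measurable (H `&` [set w | ctype q k w = i] `&` idle_at q k) by exact: measurableI.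
rewrite -fineM ?(mu_fin Pf)//; last exact: (mu_fin (kernel_lty i j (K_kernel Hq))).
rewrite -fineM ?(mu_fin Pf)//; last exact: (mu_fin (kernel_lty i j (Kstar_kernel Hq))).
rewrite -(service_busy_step lambda_gt0 Hq i j pH mZ).
rewrite -(service_idle_step lambda_gt0 Hq i j pH mZ).
rewrite -fineD ?(mu_fin Pf)//; try exact: measurableI.
rewrite -measureU//; try exact: measurableI; last first.
  apply/seteqP; split => w //= [[[_ h1] _] [[_ h2] _]]; move: h1 h2.
  by rewrite /busy_at /idle_at/= => h1; rewrite ltNge h1.
congr (fine (P _)); apply/seteqP; split => w /=.
  move=> [[h1 h2] h3]; case: (leP (arrival q k w) (dep q k w)) => h4; [left|right];
    by split.
by case=> [[[[h1 h2] _] h3]|[[[h1 h2] _] h3]].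
Qed.

Variables (a b : nat) (ba : (b <= a)%N).
Let pa : pred nat := fun l => (l < a)%N.
Let pb : pred nat := fun l => (l < b)%N.

Let AA w l : (l < a)%N -> cutA q pa l w = A l w.
Proof. by move=> la; rewrite /cutA /pa la. Qed.

Let BB w l : (l < b)%N -> cutB q pb l w = B l w.
Proof. by move=> lb; rewrite /cutB /pb lb. Qed.

Let B1 w l : (1 <= B l w)%N. Proof. exact: (size_ge1 Hq). Qed.
Let B1' w l : (1 <= cutB q pb l w)%N. Proof. exact: (cutB1 Hq). Qed.

Lemma arrival_cut k w : (k < first q b w)%N ->
  arrival q k w = g_arrival (cutA q pa) I (cutB q pb) k w.
Proof.
by move=> kb; rewrite (g_arrival_agree (A := fun l => A l) (B := fun l => B l)
  I ba (AA w) (BB w) (B1 w) (B1' w)).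
Qed.

Lemma dep_cut k w : (k <= first q b w)%N ->
  dep q k w = g_dep (cutA q pa) I (cutB q pb) S k w.
Proof.
move=> kb; rewrite depE (g_dep_agree (A := fun l => A l) (B := fun l => B l)
  I S ba (AA w) (BB w) (B1 w) (B1' w))//.
Qed.

Lemma batch_arrival_cut n w : (n < a)%N ->
  batch_arrival q n w = g_batch_arrival (cutA q pa) I n w.
Proof.
by move=> na; rewrite (g_batch_arrival_agree (A := fun l => A l) I (AA w)).
Qed.

Lemma history_first k n (X : set nat) : (n <= b)%N ->
  history q pa pb k [set w | X (first q n w)].
Proof.
move=> nb; have -> : [set w | X (first q n w)] = g_first (cutB q pb) n @^-1` X.
  apply/seteqP; split => w /=;
    by rewrite (g_first_agree (B := fun l => B l) (BB w) nb).
by apply: hmeasP => //; exact: hmeas_first.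
Qed.

Variables (fs : seq (nat + nat + unit)) (Ef : nat + nat + unit -> set T).
Hypotheses (ufs : uniq fs) (fsE : forall x, x \in fs -> input_events q x (Ef x)).
Hypothesis fs_future : forall x, x \in fs -> ~ input_past pa pb x.

Definition future_event : set T := \bigcap_(x in [set` fs]) Ef x.
Local Notation Fut := future_event.

Lemma measurable_future : measurable Fut.
Proof.
apply: (@setI_closed_bigcap_seq _ _ measurable) => //; first exact: measurableI.
move=> x xfs; exact: (@input_events_measurable _ _ _ _ _ _ _ _ _ Hq x _ (fsE xfs)).
Qed.

(** The past of a service contains all inputs, also those that are future for the truncated history.
    Hence the service law can be applied after intersecting with the future event. *)
Lemma past_future k : past q k Fut.
Proof.
rewrite history_past; apply: setI_closed_bigcap_seq; first exact: historyT.
  by move=> X Y; exact: historyI.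
move=> x xfs; apply: sub_sigma_algebra; left; exists x; last exact: fsE.
by case: x xfs => [[l|l]|u].
Qed.

Let cF := fine (P Fut).
Let cF0 : 0 <= cF. Proof. exact: fine_ge0. Qed.
Let PF : P Fut = cF%:E. Proof. by rewrite fineK// mu_fin//; exact: measurable_future. Qed.

(** Finite intersections of known input events: a pi-system that generates the history before any
    service and on which independence is the product formula for the inputs. *)
Let pi0 : set (set T) := [set D | exists s : seq (nat + nat + unit),
  exists E : nat + nat + unit -> set T,
  [/\ uniq s, forall x, x \in s -> input_past pa pb x,
      forall x, input_events q x (E x) & D = \bigcap_(x in [set` s]) E x]].

Let pi0I : setI_closed pi0.
Proof.
move=> _ _ [s1 [E1 [u1 p1 e1 ->]]] [s2 [E2 [u2 p2 e2 ->]]].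
exists (undup (s1 ++ s2)), (fun x => (if x \in s1 then E1 x else setT) `&`
  (if x \in s2 then E2 x else setT)); split.
- exact: undup_uniq.
- by move=> x; rewrite mem_undup mem_cat => /orP[/p1|/p2].
- move=> x; apply: input_eventsI; case: ifP => _ //; exact: input_eventsT.
- apply/seteqP; split => w /=.
    move=> [h1 h2] x /= _; split.
      by case: ifPn => // xs; exact: h1.
    by case: ifPn => // xs; exact: h2.
  move=> h; split => x /= xs.
    by have := h x; rewrite /= mem_undup mem_cat xs => /(_ isT)[].
  by have := h x; rewrite /= mem_undup mem_cat xs orbT => /(_ isT)[].
Qed.

Let indep0 D : history q pa pb 0 D -> P (D `&` Fut) = (P D * P Fut)%E.
Proof.
move=> hD; have mF := measurable_future.
pose m1 : {measure set T -> \bar R} := mrestr P mF.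
pose m2 : {measure set T -> \bar R} := mscale (NngNum cF0) P.
suff : m1 D = m2 D by rewrite /m1 /m2/= /mrestr /mscale/= PF muleC.
apply: (@g_sigma_algebra_measure_unique _ _ _ pi0 _ (fun=> setT)).
- move=> _ [s [E [us ps es ->]]].
  apply: (@setI_closed_bigcap_seq _ _ measurable) => //; first exact: measurableI.
  move=> x _; exact: (@input_events_measurable _ _ _ _ _ _ _ _ _ Hq x _ (es x)).
- move=> _; exists [::], (fun=> setT); split => //; first by move=> x; exact: input_eventsT.
  by apply/seteqP; split.
- by apply/seteqP; split => // w _; exists 0%N.
- exact: pi0I.
- move=> _ [s [E [us ps es ->]]]; rewrite /m1 /m2/= /mrestr /mscale/= -PF.
  rewrite (input_product Hq us)//.
  rewrite {2}/future_event (input_product Hq ufs fsE) muleC.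
  have sfs x : x \in s -> x \notin fs.
    by move=> /ps px; apply/negP => /fs_future; exact.
  have : P (\bigcap_(x in [set` s ++ fs]) (if x \in s then E x else Ef x)) =
      (\prod_(x <- s ++ fs) P (if x \in s then E x else Ef x))%E.
    apply: (input_product Hq).
      rewrite cat_uniq us ufs andbT; apply/hasPn => x xfs.
      by apply/negP => /sfs; rewrite xfs.
    move=> x; rewrite mem_cat; case: ifPn => [xs _|xs /= xfs]; first exact: es.
    exact: fsE.
  rewrite big_cat/= (_ : \bigcap_(x in _) _ = \bigcap_(x in [set` s]) E x `&` Fut).
    move=> ->; congr (_ * _)%E; apply: eq_big_seq => x xs; first by rewrite xs.
    by case: ifPn => // /sfs; rewrite xs.
  apply/seteqP; split => w /=.
    move=> h; split => x /= xs; have := h x; rewrite /= mem_cat xs ?orbT => /(_ isT) //.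
    by case: ifPn => // /sfs; rewrite xs.
  move=> [h1 h2] x /=; rewrite mem_cat; case: ifPn => [xs _|_ /= xs]; [exact: h1|exact: h2].
- by move=> _; rewrite /m1/= /mrestr; apply: mu_lty => //; exact: measurableI.
- move: hD; apply: sub_sigma_algebra2 => X [[x px Xx]|[]//].
  exists [:: x], (fun y => if y == x then X else setT); split => //.
  + by move=> y; rewrite inE => /eqP ->.
  + by move=> y; case: eqP => [->|_] //; exact: input_eventsT.
  + apply/seteqP; split => w /=.
      by move=> Xw y /=; rewrite inE => /eqP ->; rewrite eqxx.
    by move=> /(_ x); rewrite /= inE eqxx => /(_ isT).
Qed.

(** On this event all customers before [k] belong to the first [b] batches, so that the cut inputs
    give the true value of [dep k]. *)
Let Lset k : set T := [set w | (k <= first q b w)%N].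

Let hL k k' : history q pa pb k' (Lset k).
Proof. exact: (@history_first k' b [set x | (k <= x)%N] (leqnn b)). Qed.

Let mL k : measurable (Lset k).
Proof. by apply: (@history_measurable _ _ _ _ _ _ _ _ _ Hq pa pb 0); exact: hL. Qed.

Let past_history k D : history q pa pb k D -> past q k D.
Proof. by rewrite history_past; apply: history_sub. Qed.

Let pastI k X Y : past q k X -> past q k Y -> past q k (X `&` Y).
Proof. by rewrite history_past; exact: historyI. Qed.

Let hbusy k : history q pa pb k
  [set w | g_arrival (cutA q pa) I (cutB q pb) k w <= g_dep (cutA q pa) I (cutB q pb) S k w].
Proof.
have h1 : hmeas q pa pb k (g_arrival (cutA q pa) I (cutB q pb) k).
  exact: hmeas_arrival.
have h2 : hmeas q pa pb k (g_dep (cutA q pa) I (cutB q pb) S k) by exact: hmeas_dep.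
have := @measurable_set_le _ (g_sigma_algebraType (history_gen q pa pb k)) R _ _ h1 h2.
exact.
Qed.

Let hidle k : history q pa pb k
  [set w | g_dep (cutA q pa) I (cutB q pb) S k w < g_arrival (cutA q pa) I (cutB q pb) k w].
Proof.
have h1 : hmeas q pa pb k (g_arrival (cutA q pa) I (cutB q pb) k).
  exact: hmeas_arrival.
have h2 : hmeas q pa pb k (g_dep (cutA q pa) I (cutB q pb) S k) by exact: hmeas_dep.
have := @measurable_set_lt _ (g_sigma_algebraType (history_gen q pa pb k)) R _ _ h2 h1.
exact.
Qed.

(** Both sides are expanded by [service_sum]. On [Lset k.+1] customer [k] belongs to one of the
    first [b] batches, so whether it finds a busy server can be read off the cut inputs and is an
    event of the history at [k]. The induction hypothesis then compares the coefficients one by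
    one. *)
Let indep_next k : (forall D, history q pa pb k D ->
    P (D `&` Lset k `&` Fut) = (P (D `&` Lset k) * P Fut)%E) ->
  forall D0 (Z : set R) j, history q pa pb k D0 -> measurable Z ->
  fine (P (D0 `&` Lset k.+1 `&` Fut `&` (S k @^-1` Z `&` [set w | ctype q k.+1 w = j]))) =
  cF * fine (P (D0 `&` Lset k.+1 `&` (S k @^-1` Z `&` [set w | ctype q k.+1 w = j]))).
Proof.
move=> IH D0 Z j hD0 mZ.
have hDL : history q pa pb k (D0 `&` Lset k.+1) by apply: historyI.
have pDL := past_history hDL.
rewrite (service_sum j (pastI pDL (@past_future k)) mZ) (service_sum j pDL mZ).
rewrite mulr_sumr; apply: eq_bigr => i _.
have key (U V : set T) : history q pa pb k V -> 
    (forall w, Lset k.+1 w -> U w <-> V w) ->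
    fine (P (D0 `&` Lset k.+1 `&` Fut `&` [set w | ctype q k w = i] `&` U)) =
    cF * fine (P (D0 `&` Lset k.+1 `&` [set w | ctype q k w = i] `&` U)).
  move=> hV UV.
  pose D := D0 `&` Lset k.+1 `&` [set w | ctype q k w = i] `&` V.
  have hD : history q pa pb k D.
    by apply: historyI => //; apply: historyI => //; exact: history_type.
  have -> : D0 `&` Lset k.+1 `&` Fut `&` [set w | ctype q k w = i] `&` U =
      D `&` Lset k `&` Fut.
    apply/seteqP; split => w /=.
      move=> [[[[h1 h2] h3] h4] h5]; have := (UV w h2).1 h5 => h6.
      by do !split => //; exact: ltnW.
    by move=> [[[[[h1 h2] h4] h5] _] h3]; have := (UV w h2).2 h5 => h6.
  have -> : D0 `&` Lset k.+1 `&` [set w | ctype q k w = i] `&` U = D `&` Lset k.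
    apply/seteqP; split => w /=.
      move=> [[[h1 h2] h4] h5]; have := (UV w h2).1 h5 => h6.
      by do !split => //; exact: ltnW.
    by move=> [[[[h1 h2] h4] h5] _]; have := (UV w h2).2 h5 => h6.
  have mDL : measurable (D `&` Lset k).
    by apply: measurableI => //; exact: (history_measurable Hq hD).
  by rewrite IH// fineM ?(mu_fin Pf)//; [rewrite mulrC|exact: measurable_future].
rewrite (key _ _ (@hbusy k)); last first.
  move=> w kw; rewrite /busy_at/= (arrival_cut kw) dep_cut//; exact: ltnW.
rewrite (key _ _ (@hidle k)); last first.
  move=> w kw; rewrite /idle_at/= (arrival_cut kw) dep_cut//; exact: ltnW.
by rewrite mulrDr !mulrA.
Qed.

(** Induction on the number of completed services, by uniqueness of measures. The step needs only
    the generating pi-system [G]: an event of the history at [k], cut by conditions on service [k]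
    and on the next type. The restriction to [k <= first b] is essential, since later customers
    depend on the inputs declared future. *)
Lemma history_indep k D : history q pa pb k D ->
  P (D `&` [set w | (k <= first q b w)%N] `&` Fut) =
  (P (D `&` [set w | (k <= first q b w)%N]) * P Fut)%E.
Proof.
elim: k D => [|k IH] D hD.
  rewrite (_ : [set w | _] = setT) ?setIT; last by apply/seteqP; split.
  exact: indep0.
have mF := measurable_future.
have mLF : measurable (Lset k.+1 `&` Fut) by exact: measurableI.
pose m1 : {measure set T -> \bar R} := mrestr P mLF.
pose m2 : {measure set T -> \bar R} := mscale (NngNum cF0) (mrestr P (mL k.+1)).
suff : m1 D = m2 D by rewrite /m1 /m2/= /mrestr /mscale/= PF muleC setIA.
pose G : set (set T) := [set X | exists D0, exists Z : set R, exists C : set 'I_N,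
  [/\ history q pa pb k D0, measurable Z &
      X = D0 `&` S k @^-1` Z `&` [set w | C (ctype q k.+1 w)]]].
have mC (C : set 'I_N) : measurable [set w | C (ctype q k.+1 w)].
  rewrite (_ : [set _ | _] = \bigcup_(i in C) [set w | ctype q k.+1 w = i]).
    by apply: fin_bigcup_measurable => // i _; exact: mtype.
  by apply/seteqP; split => w /= => [Cw|[i Ci ->]//]; exists (ctype q k.+1 w).
have mG X : G X -> measurable X.
  move=> [D0 [Z [C [hD0 mZ ->]]]]; apply: measurableI => //; apply: measurableI.
    exact: (history_measurable Hq hD0).
  exact: measurable_service.
apply: (@g_sigma_algebra_measure_unique _ _ _ G _ (fun=> setT)).
- exact: mG.
- move=> _; exists setT, setT, setT; split => //; first exact: historyT.
  by apply/seteqP; split.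
- by apply/seteqP; split => // w _; exists 0%N.
- move=> _ _ [D1 [Z1 [C1 [h1 mZ1 ->]]]] [D2 [Z2 [C2 [h2 mZ2 ->]]]].
  exists (D1 `&` D2), (Z1 `&` Z2), (C1 `&` C2); split.
  + exact: historyI.
  + exact: measurableI.
  + by apply/seteqP; split => w /=; tauto.
- move=> X GX; have mX := mG _ GX; case: GX => D0 [Z [C [hD0 mZ XE]]].
  rewrite /m1 /m2/= /mrestr /mscale/=.
  have mXL : measurable (X `&` Lset k.+1) by exact: measurableI.
  have mXLF : measurable (X `&` (Lset k.+1 `&` Fut)) by exact: measurableI.
  suff e : fine (P (X `&` (Lset k.+1 `&` Fut))) = cF * fine (P (X `&` Lset k.+1)).
    by rewrite -(fineK (mu_fin Pf mXLF)) e EFinM (fineK (mu_fin Pf mXL)).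
  rewrite (fine_measure_partition Pf mXLF (mtype k.+1)).
  rewrite (fine_measure_partition Pf mXL (mtype k.+1)) mulr_sumr.
  apply: eq_bigr => j _; have [Cj|nCj] := pselect (C j).
    rewrite (_ : X `&` (Lset k.+1 `&` Fut) `&` [set w | ctype q k.+1 w = j] =
        D0 `&` Lset k.+1 `&` Fut `&` (S k @^-1` Z `&` [set w | ctype q k.+1 w = j])).
      rewrite (_ : X `&` Lset k.+1 `&` [set w | ctype q k.+1 w = j] =
          D0 `&` Lset k.+1 `&` (S k @^-1` Z `&` [set w | ctype q k.+1 w = j])).
        exact: indep_next.
      apply/seteqP; split => w /=; rewrite XE/=; first by move=> [[[[? ?] ?] ?] ->].
      by move=> [[? ?] [? h]]; rewrite h.
    apply/seteqP; split => w /=; rewrite XE/=; first by move=> [[[[? ?] ?] [? ?]] ->].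
    by move=> [[[? ?] ?] [? h]]; rewrite h.
  have e (Y : set T) : X `&` Y `&` [set w | ctype q k.+1 w = j] = set0.
    by apply/seteqP; split => w //=; rewrite XE/= => -[[[_ h] _] h']; rewrite h' in h.
  by rewrite !e measure0 mulr0.
- by move=> _; rewrite /m1/= /mrestr; apply: mu_lty => //; exact: measurableI.
- move: hD; apply: sub_sigma_algebra2 => X.
  have inh : history q pa pb k X -> G X.
    move=> hX; exists X, setT, setT; split => //.
    by apply/seteqP; split => w //= [[]].
  move=> [[x px Xx]|[l]].
    by apply: inh; apply: sub_sigma_algebra; left; exists x.
  rewrite /= ltnS leq_eqVlt => /orP[/eqP ->|lk] Xl; last first.
    by apply: inh; apply: sub_sigma_algebra; right; exists l.
  case: Xl => [[Z mZ <-]|[C _ <-]].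
    exists setT, Z, setT; split => //; first exact: historyT.
    by apply/seteqP; split => w //= [[]].
  exists setT, setT, C; split => //; first exact: historyT.
  by apply/seteqP; split => w //= [[]].
Qed.

(* The condition on [H] says that it belongs to the history stopped at the random
   index [first b]. *)
Lemma future_indep H : measurable H ->
  (forall k, exists2 D, history q pa pb k D &
     H `&` [set w | first q b w = k] = D `&` [set w | first q b w = k]) ->
  P (H `&` Fut) = (P H * P Fut)%E.
Proof.
move=> mH hH; have mF := measurable_future.
have mHF : measurable (H `&` Fut) by exact: measurableI.
rewrite PF -[LHS]fineK ?(mu_fin Pf)// -[P H]fineK ?(mu_fin Pf)// -EFinM mulrC.
congr EFin; apply: (eq_measure_countable Pf mHF mH (measurable_first q b)) => k.
have [D hD HD] := hH k.
have hDk : history q pa pb k (D `&` [set w | first q b w = k]).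
  by apply: historyI => //; exact: (@history_first k b [set x | x = k] (leqnn b)).
have DL : D `&` [set w | first q b w = k] `&` [set w | (k <= first q b w)%N] =
    D `&` [set w | first q b w = k].
  by apply/seteqP; split => w /= [] // h1 h2; do !split => //; rewrite h2.
have := history_indep hDk; rewrite DL -HD => h.
have -> : H `&` Fut `&` [set w | first q b w = k] =
    H `&` [set w | first q b w = k] `&` Fut by rewrite setIAC.
rewrite [X in fine X]h fineM ?(mu_fin Pf)//; first by rewrite mulrC.
by apply: measurableI => //; exact: measurable_fiber (measurable_first q b) k.
Qed.

End FutureInputs.

(** * Transforms for one batch *)

Section BatchTransforms.
Context (R : realType) (N : nat) (lambda : R).
Context (K Kstar : 'I_N -> 'I_N -> {measure set R -> \bar R}).
Context d (T : measurableType d) (P : probability T R) (q : queue P N).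
Hypothesis lambda_gt0 : 0 < lambda.
Hypothesis Hq : MXSM2_queue q lambda K Kstar.
Local Notation A := (interarrival q).
Local Notation I := (init_batches q).
Local Notation B := (batch_size q).
Local Notation S := (service q).
Let Pf : (P setT < +oo)%E := Pfin P.
Let mtype := mtype Hq.
Let mg := measurable_good q.
Let g0 := good_full lambda_gt0 Hq.
Let B1 w l : (1 <= B l w)%N. Proof. exact: (size_ge1 Hq). Qed.

Definition spacing n l : T -> measurableTypeR R := A (n.+1 + l)%N.

(** With the first [n.+1] interarrival times known, the spacings after batch [n] are future inputs.
    The number [b] of known sizes is [n] for waiting times and [n.+1] for sojourn times, which
    involve the size of batch [n]. *)
Lemma spacing_indep n b D (Y : T -> measurableTypeR R) : (b <= n.+1)%N ->
  measurable D -> measurable_fun setT Y ->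
  (forall X, measurable X -> forall k, exists2 D',
     history q (fun l => (l < n.+1)%N) (fun l => (l < b)%N) k D' &
     D `&` Y @^-1` X `&` [set w | first q b w = k] =
     D' `&` [set w | first q b w = k]) ->
  indep_spacings (exp_law q) P D Y (spacing n).
Proof.
move=> bn mD mY hD j X Z mX mZ.
pose fs : seq (nat + nat + unit) := [seq inl (inl (n.+1 + l)%N) | l <- iota 0 j].
pose Ef (x : nat + nat + unit) : set T :=
  if x is inl (inl i) then A i @^-1` Z (i - n.+1)%N else setT.
have ufs : uniq fs by rewrite map_inj_uniq ?iota_uniq// => x y [] /addnI.
have fsE x : x \in fs -> input_events q x (Ef x).
  move=> /mapP[l _ ->]; rewrite /Ef addKn; exists (Z l); first exact: mZ.
  by rewrite setTI.
have fsf x : x \in fs ->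
    ~ input_past (fun l => (l < n.+1)%N) (fun l => (l < b)%N) x.
  by move=> /mapP[l _ ->] /=; rewrite ltnNge leq_addr.
have FE : [set w | forall l, (l < j)%N -> Z l (spacing n l w)] = future_event fs Ef.
  apply/seteqP; split => w /= h.
    move=> x /= /mapP[l]; rewrite mem_iota add0n => /andP[_ lj] ->.
    by rewrite /Ef addKn; exact: h.
  move=> l lj; have := h (inl (inl (n.+1 + l)%N)); rewrite /Ef/= addKn; apply.
  by apply/mapP; exists l => //; rewrite mem_iota add0n.
have mDX : measurable (D `&` Y @^-1` X).
  by apply: measurableI => //; exact: measurable_preimageT.
rewrite FE; transitivity (P (D `&` Y @^-1` X) * P (future_event fs Ef))%E.
  exact: (future_indep lambda_gt0 Hq bn ufs fsE fsf mDX (hD X mX)).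
congr (_ * _)%E; rewrite (input_product Hq ufs fsE) /fs big_map.
rewrite (_ : iota 0 j = index_iota 0 j) ?big_mkord; last by rewrite /index_iota subn0.
by apply: eq_bigr => l _; rewrite /Ef addKn (inter_law Hq).
Qed.

(** A signed waiting time. Its positive part is the waiting time of the batch; when it is negative,
    its absolute value is the time the server has been idle. Its sign thus selects the kernel of the
    first service of the batch. *)
Definition slack n w : R := dep q (first q n w) w - batch_arrival q n w.

Lemma measurable_slack n : measurable_fun setT (slack n).
Proof.
apply: measurable_funB; last exact: measurable_batch_arrival.
by apply: measurable_random_index; [exact: measurable_dep|exact: measurable_first].
Qed.

Lemma arrival_first n w : arrival q (first q n w) w = batch_arrival q n w.
Proof.
congr (batch_arrival q _ w); exact: (g_batch_of_first (B := fun l => B l) (B1 w)).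
Qed.

Lemma arrival_member n r w : (r < B n w)%N ->
  arrival q (first q n w + r)%N w = batch_arrival q n w.
Proof.
move=> rB; congr (batch_arrival q _ w).
exact: (g_batch_of_member (B := fun l => B l) (B1 w) rB).
Qed.

Lemma sc_waitingE n w : sc_waiting q n w = Num.max (slack n w) 0.
Proof.
rewrite /sc_waiting /start arrival_first /slack maxC !maxEle subr_le0.
by case: ifP => // _; rewrite subrr.
Qed.

Lemma sc_waiting_ge0 n w : 0 <= sc_waiting q n w.
Proof. by rewrite sc_waitingE le_max lexx orbT. Qed.

Section OnGoodPaths.
Variable w : T.
Hypothesis gw : good q w.
Let A0 : forall l, 0 < A l w. Proof. by case: gw. Qed.
Let S0 : forall k, 0 <= S k w. Proof. by case: gw => _ []. Qed.

Lemma batch_arrival_le m n : (m <= n)%N -> batch_arrival q m w <= batch_arrival q n w.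
Proof. exact: (g_batch_arrival_mono (A := fun l => A l) I A0). Qed.

Lemma sc_num_leftP n x : sc_num_left q n w = x <->
  (x = 0%N \/ batch_arrival q (n + x).-1 w <= dep q (first q n w) w) /\
  dep q (first q n w) w < batch_arrival q (n + x) w.
Proof.
have h := g_card_left (A := fun l => A l) (I := I) A0 n x
  (good_unbounded (dep q (first q n w) w) gw).
exact: h.
Qed.

Lemma sc_num_left0P n : sc_num_left q n w = 0%N <-> slack n w < 0.
Proof. by rewrite sc_num_leftP addn0 /slack subr_lt0; split => [[]|] //; split => //; left. Qed.

Lemma dep_mono k k' : (k <= k')%N -> dep q k w <= dep q k' w.
Proof.
move=> /subnK <-; elim: (k' - k)%N => [|j IH] //.
rewrite addSn /= (le_trans IH)//.
apply: (@le_trans _ _ (Num.max (arrival q (j + k) w) (dep q (j + k) w))).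
  by rewrite le_max lexx orbT.
by rewrite lerDl.
Qed.

Lemma arrival_le_dep k : arrival q k w <= dep q k.+1 w.
Proof.
apply: (@le_trans _ _ (Num.max (arrival q k w) (dep q k w))).
  by rewrite le_max lexx.
by rewrite lerDl.
Qed.

Lemma batch_arrival_le_dep n r : (r < B n w)%N ->
  batch_arrival q n w <= dep q (first q n w + r).+1 w.
Proof. by move=> rB; rewrite -(arrival_member rB); exact: arrival_le_dep. Qed.

Lemma sc_sojourn_ge0 n : 0 <= sc_sojourn q n w.
Proof.
rewrite /sc_sojourn subr_ge0.
have b1 : (0 < B n w)%N := B1 w n.
apply: (le_trans (batch_arrival_le_dep b1)); apply: dep_mono.
by rewrite addn0 !firstE g_firstS -addn1 leq_add2l.
Qed.

Variable n : nat.
Hypothesis In : (I w <= n)%N.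

Let countE j y : count_in j y (fun l => spacing n l w) =
  [&& 0 <= y, batch_arrival q (n + j) w - batch_arrival q n w <= y &
      y < batch_arrival q (n + j.+1) w - batch_arrival q n w].
Proof. exact: (g_count_in (A := fun l => A l) A0 j y (leqW In)). Qed.

(** Batch [n] is itself among the batches left behind by its predecessor, which accounts for the
    shift by one; the other [j] arrived during the slack. *)
Lemma count_slack j : sc_num_left q n w = j.+1 <-> count_in j (slack n w) (spacing n ^~ w).
Proof.
rewrite sc_num_leftP countE /slack addnS /=; split.
  move=> [[//|h1] h2]; have h3 := batch_arrival_le (leq_addr j n).
  by apply/and3P; split; rewrite ?addnS; lra.
move=> /and3P[h1 h2]; rewrite ?addnS => h3; split; last lra.
by right; lra.
Qed.

(** If the server is busy this is the previous count. If it is idle, both sides force [j = 0]: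
    truncated subtraction gives 0 on the left, and on the right the waiting time is 0 while the
    spacings are positive. *)
Lemma count_waiting j : (sc_num_left q n w - 1)%N = j <->
  count_in j (sc_waiting q n w) (spacing n ^~ w).
Proof.
have aS : batch_arrival q n.+1 w = batch_arrival q n w + A n.+1 w.
  by rewrite batch_arrivalE g_batch_arrivalS (leqW In).
rewrite sc_waitingE; have [s0|s0] := ltP (slack n w) 0.
  have := (sc_num_left0P n).2 s0 => ->; rewrite sub0n countE lexx/=.
  split => [<-|/andP[h1 h2]].
    by rewrite addn0 subrr lexx/= addn1 aS addrAC subrr add0r.
  case: j h1 h2 => // j h1 h2.
  have : batch_arrival q n.+1 w <= batch_arrival q (n + j.+1) w.
    by apply: batch_arrival_le; rewrite -addn1 leq_add2l.
  rewrite aS => h; have := le_lt_trans h1 (A0 n.+1).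
  by rewrite ltrBlDl ltNge h.
have nz : sc_num_left q n w <> 0%N by move=> /sc_num_left0P; rewrite ltNge s0.
rewrite -count_slack; split; last by move=> ->; rewrite subn1.
by case: (sc_num_left q n w) nz => // x _ <-; rewrite subn1.
Qed.

(** When batch [n] leaves it is no longer counted, so there is no shift: the batches left behind are
    exactly those that arrived during its sojourn. *)
Lemma count_sojourn j : sc_num_left q n.+1 w = j <->
  count_in j (sc_sojourn q n w) (spacing n ^~ w).
Proof.
have s0 := sc_sojourn_ge0 n; rewrite sc_num_leftP countE s0/= addSn /=.
rewrite /sc_sojourn in s0 *; rewrite addnS; split.
  move=> [h1 h2]; apply/andP; split; last lra.
  case: h1 => [->|]; last lra.
  by rewrite addn0 subrr.
by move=> /andP[h1 h2]; split; [right; lra|lra].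
Qed.

End OnGoodPaths.

Section Transform.
Variables (z : R[i]) (z1 : `|z| <= 1).
Let s := ofR lambda * (1 - z).

Lemma Re_rate_ge0 : 0 <= complex.Re s.
Proof.
have -> : complex.Re s = lambda * (1 - complex.Re z).
  by rewrite /s; case: (z) => ? ? /=; ring.
by apply: mulr_ge0; [exact: ltW|rewrite subr_ge0 Re_le1].
Qed.

(** On good paths [X] is the number of points of the spacing process in [[0, Y]]. Since the spacings
    are independent of [Y], this number is mixed Poisson, and its generating function is the
    transform of [Y]. *)
Lemma count_transform n (D : set T) (Y : T -> R) (X : T -> nat) :
  measurable D -> measurable_fun setT Y -> measurable_fun setT X ->
  indep_spacings (exp_law q) P D Y (spacing n) ->
  (forall w, good q w -> D w -> 0 <= Y w ->
     forall j, X w = j <-> count_in j (Y w) (spacing n ^~ w)) ->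
  cint P (D `&` [set w | 0 <= Y w]) (fun w => z ^+ X w) =
  cint P (D `&` [set w | 0 <= Y w]) (fun w => decay s (Y w)).
Proof.
move=> mD mY mX ind hX.
have mY0 : measurable [set w | 0 <= Y w] by exact: measurable_set_le.
have mDY : measurable (D `&` [set w | 0 <= Y w]) by exact: measurableI.
have msp l : measurable_fun setT (spacing n l).
  by have : measurable_fun setT (A (n.+1 + l)%N) by [].
have mc j := measurable_count_in j mY msp.
apply: (poisson_transform lambda_gt0 Pf) => //; first by move=> w [].
move=> j; rewrite Rintegral_setI_indic//.
transitivity (\int[P]_(w in D) (\1_`[0, +oo[%classic (Y w) * pois lambda j (Y w))).
  rewrite -(poisson_law lambda_gt0 (exp_lawE Hq) Pf j mD mY msp ind); congr fine.
  have mXj : measurable [set w | X w = j] by exact: measurable_fiber.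
  apply: (eq_measure_full _ _ mg g0); [exact: measurableI|exact: measurableI|].
  move=> w gw; split => [[[Dw Y0] Xj]|[Dw cw]].
    by split => //; apply/(hX w gw Dw Y0).
  have Y0 : 0 <= Y w by case: (j) cw => [|j'] /= /andP[] // /andP[h1 h2] _; exact: le_trans h2.
  by do !split => //; apply/(hX w gw Dw Y0).
apply: eq_Rintegral => w _; rewrite [in RHS]indicE.
have -> : (w \in [set w | 0 <= Y w]) = (0 <= Y w)%R by exact: in_set_bool.
have -> : \1_`[0, +oo[%classic (Y w) = (0 <= Y w)%R%:R :> R.
  by rewrite indicE mem_setE in_itv/= andbT.
by case: (0 <= Y w)%R; rewrite ?mul1r ?mul0r.
Qed.

Let hist n b k := history q (fun l => (l < n.+1)%N) (fun l => (l < b)%N) k.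

Let hist_init n b k m : hist n b k [set w | (I w <= m)%N].
Proof.
have h := hmeasP (Y := [set x | (x <= m)%N])
  (@hmeas_init _ _ _ _ _ q (fun l => (l < n.+1)%N) (fun l => (l < b)%N) k) Logic.I.
exact: h.
Qed.

Lemma measurable_init n : measurable [set w | (I w <= n)%N].
Proof.
apply: measurable_set_bool; exact: (measurable_nat_comp (fun x => (x <= n)%N)).
Qed.

Let hist_fun n b k (f : R -> R -> R) (X : set R) :
  measurable_fun setT (fun x : R * R => f x.1 x.2) -> measurable X ->
  hist n b k [set w | X (f (g_dep (cutA q (fun l => (l < n.+1)%N)) I
                        (cutB q (fun l => (l < b)%N)) S k w)
                     (g_batch_arrival (cutA q (fun l => (l < n.+1)%N)) I n w))].
Proof.
move=> mf mX.
have h1 : hmeas q (fun l => (l < n.+1)%N) (fun l => (l < b)%N) k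
    (g_dep (cutA q (fun l => (l < n.+1)%N)) I (cutB q (fun l => (l < b)%N)) S k).
  exact: hmeas_dep.
have h2 : hmeas q (fun l => (l < n.+1)%N) (fun l => (l < b)%N) k
    (g_batch_arrival (cutA q (fun l => (l < n.+1)%N)) I n).
  exact: hmeas_batch_arrival.
have h3 := measurableT_comp mf (measurable_fun_pair h1 h2).
exact: (measurable_preimageT h3 mX).
Qed.

(** On [first b = k], neither [dep k] nor the arrival time of batch [n] changes when the inputs
    beyond the first [n.+1] interarrival times and [b] sizes are cut, and their cut versions are
    measurable for the history at [k]. *)
Lemma history_local n b (f : R -> R -> R) (D : set T) :
  (b <= n.+1)%N -> measurable_fun setT (fun x : R * R => f x.1 x.2) ->
  (forall k, exists2 D', hist n b k D' &
     D `&` [set w | first q b w = k] = D' `&` [set w | first q b w = k]) ->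
  forall X, measurable X -> forall k, exists2 D', hist n b k D' &
    D `&` (fun w => f (dep q (first q b w) w) (batch_arrival q n w)) @^-1` X `&`
      [set w | first q b w = k] = D' `&` [set w | first q b w = k].
Proof.
move=> bn mf hD X mX k; have [D' hD' DD'] := hD k.
exists (D' `&` [set w | X (f (g_dep (cutA q (fun l => (l < n.+1)%N)) I
                        (cutB q (fun l => (l < b)%N)) S k w)
                     (g_batch_arrival (cutA q (fun l => (l < n.+1)%N)) I n w))]).
  by have := historyI hD' (@hist_fun n b k f X mf mX); exact.
rewrite -setIA [X in _ `&` X]setIC setIA DD' -setIA [X in _ `&` X]setIC.
rewrite -[RHS]setIA; congr (_ `&` _); apply/seteqP; split => w /= [h1 h2]; split => //.
- rewrite -(dep_cut Hq bn (k := k)) ?h2// -(batch_arrival_cut _ _ (ltnSn n)).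
  by rewrite h2 in h1.
- move: h1; rewrite -(dep_cut Hq bn (k := k)) ?h2// -(batch_arrival_cut _ _ (ltnSn n)).
  by [].
Qed.

Lemma waiting_transform n :
  cint P [set w | (I w <= n)%N] (fun w => z ^+ (sc_num_left q n w - 1)) =
  cint P [set w | (I w <= n)%N] (fun w => decay s (sc_waiting q n w)).
Proof.
have E : [set w | (I w <= n)%N] = [set w | (I w <= n)%N] `&` [set w | 0 <= sc_waiting q n w].
  by apply/seteqP; split => w /= => [h|[]//]; split => //; exact: sc_waiting_ge0.
rewrite E; apply: (@count_transform n).
- exact: measurable_init.
- exact: measurable_sc_waiting.
- exact: (measurable_nat_comp (fun x => (x - 1)%N) (measurable_sc_num_left q n)).
- apply: (spacing_indep (b := n)) => //.
  + exact: measurable_init.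
  + exact: measurable_sc_waiting.
  have -> : sc_waiting q n = (fun w => Num.max (dep q (first q n w) w - batch_arrival q n w) 0).
    by apply/funext => w; exact: sc_waitingE.
  apply: (history_local (f := fun x y => Num.max (x - y) 0)) => //.
    apply: measurable_maxr; last exact: measurable_cst.
    by apply: measurable_funB; [exact: measurable_fst|exact: measurable_snd].
  by move=> k; exists [set w | (I w <= n)%N] => //; exact: hist_init.
- by move=> w gw In _ j; exact: count_waiting.
Qed.

Lemma sojourn_transform n :
  cint P ([set w | (I w <= n)%N] `&` [set w | 0 <= sc_sojourn q n w])
    (fun w => z ^+ sc_num_left q n.+1 w) =
  cint P ([set w | (I w <= n)%N] `&` [set w | 0 <= sc_sojourn q n w])
    (fun w => decay s (sc_sojourn q n w)).
Proof.
apply: (@count_transform n).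
- exact: measurable_init.
- exact: measurable_sc_sojourn.
- exact: measurable_sc_num_left.
- apply: (spacing_indep (b := n.+1)) => //.
  + exact: measurable_init.
  + exact: measurable_sc_sojourn.
  apply: (history_local (f := fun x y => x - y)) => //.
    by apply: measurable_funB; [exact: measurable_fst|exact: measurable_snd].
  by move=> k; exists [set w | (I w <= n)%N] => //; exact: hist_init.
- by move=> w gw In _ j; exact: count_sojourn.
Qed.

Lemma slack_transform n i :
  cint P ([set w | (I w <= n)%N] `&` [set w | sc_type q n w = i] `&` [set w | 0 <= slack n w])
    (fun w => z ^+ (sc_num_left q n w - 1)) =
  cint P ([set w | (I w <= n)%N] `&` [set w | sc_type q n w = i] `&` [set w | 0 <= slack n w])
    (fun w => decay s (slack n w)).
Proof.
have mD : measurable ([set w | (I w <= n)%N] `&` [set w | sc_type q n w = i]).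
  apply: measurableI; first exact: measurable_init.
  by apply: measurable_type_at => //; exact: measurable_first.
apply: (@count_transform n) => //.
- exact: measurable_slack.
- exact: (measurable_nat_comp (fun x => (x - 1)%N) (measurable_sc_num_left q n)).
- apply: (spacing_indep (b := n)) => //.
  + exact: measurable_slack.
  apply: (history_local (f := fun x y => x - y)) => //.
    by apply: measurable_funB; [exact: measurable_fst|exact: measurable_snd].
  move=> k; exists ([set w | (I w <= n)%N] `&` [set w | ctype q k w = i]).
    by apply: historyI; [exact: hist_init|exact: history_type].
  by apply/seteqP; split => w /= [[h1 h2] h3]; do !split => //; rewrite /sc_type ?h3 // -h3.
- move=> w gw [In _] Y0 j; rewrite -(count_slack gw In).
  have nz : sc_num_left q n w <> 0%N by move=> /(sc_num_left0P gw); rewrite ltNge Y0.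
  split; last by move=> ->; rewrite subn1.
  by case: (sc_num_left q n w) nz => // x _ <-; rewrite subn1.
Qed.

End Transform.

End BatchTransforms.

(** * The customers inside one batch *)

Section MemberTransforms.
Context (R : realType) (N : nat) (lambda : R).
Context (K Kstar : 'I_N -> 'I_N -> {measure set R -> \bar R}).
Context d (T : measurableType d) (P : probability T R) (q : queue P N).
Hypothesis lambda_gt0 : 0 < lambda.
Hypothesis Hq : MXSM2_queue q lambda K Kstar.
Local Notation A := (interarrival q).
Local Notation I := (init_batches q).
Local Notation B := (batch_size q).
Local Notation S := (service q).
Let Pf : (P setT < +oo)%E := Pfin P.
Let mtype := mtype Hq.
Let mg := measurable_good q.
Let g0 := good_full lambda_gt0 Hq.
Let B1 w l : (1 <= B l w)%N. Proof. exact: (size_ge1 Hq). Qed.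

Lemma measurable_batch_ge n m : measurable (batch_ge q n m).
Proof.
apply: measurable_set_bool; exact: (measurable_nat_comp (fun x => (m <= x)%N)).
Qed.

Lemma cint_good_null D F : measurable D -> cbm F -> D `&` good q = set0 ->
  cint P D F = 0.
Proof.
move=> mD bF D0; apply: cint_null => //; apply/eqP; rewrite -measure_le0.
rewrite -g0; apply: le_measure; rewrite ?inE//; first exact: measurableC.
by move=> w Dw gw; have : (D `&` good q) w by []; rewrite D0.
Qed.

Variable s : R[i].
Hypothesis s0 : 0 <= complex.Re s.

Lemma cint_kernel (L : 'I_N -> 'I_N -> {measure set R -> \bar R}) i j :
  semi_markov_kernel L -> cint (L i j) setT (decay s) = Gt L s i j.
Proof. by move=> sL; rewrite mxE (lst_decay s0 (@measurable_id _ _ setT) ((sL i).2 j)). Qed.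

Section FixedBatch.
Variables n m : nat.

(* For [r >= 1] this is the time from the arrival of batch [n] until its first
   [r] customers are served. *)
Definition elapsed r w : R := dep q (first q n w + r)%N w - batch_arrival q n w.

Definition position r w : nat := (first q n w + r)%N.

Lemma measurable_position r : measurable_fun setT (position r).
Proof. exact: (measurable_nat_comp (fun x => (x + r)%N) (measurable_first q n)). Qed.

Lemma measurable_elapsed r : measurable_fun setT (elapsed r).
Proof.
apply: measurable_funB; last exact: measurable_batch_arrival.
exact: (measurable_random_index (measurable_dep q) (measurable_position r)).
Qed.

Local Notation H := (batch_ge q n m).
Let mH := measurable_batch_ge n m.

(** The past of every service contains the sizes and arrival times of all batches, so the event on
    the size of batch [n] and the subtraction of its arrival time cause no conflict with the service
    law. *)
Lemma elapsed_past r Z : measurable Z ->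
  past_at q (position r) (H `&` elapsed r @^-1` Z).
Proof.
move=> mZ k; rewrite history_past.
have hp : history q xpredT xpredT k [set w | position r w = k].
  exact: (hmeasP (Y := [set x | (x + r)%N = k])
    (@hmeas_first _ _ _ _ _ q xpredT xpredT k n) Logic.I).
have hH : history q xpredT xpredT k H.
  exact: (hmeasP (Y := [set x | (m <= x)%N]) (@hmeas_size _ _ _ _ _ q xpredT xpredT k n isT) Logic.I).
have h1 : hmeas q xpredT xpredT k (fun w => dep q k w).
  exact: (@hmeas_dep _ _ _ _ _ q xpredT xpredT k k (leqnn k)).
have h2 : hmeas q xpredT xpredT k (fun w => batch_arrival q n w).
  exact: (@hmeas_batch_arrival _ _ _ _ _ q xpredT xpredT k n).
have h3 := hmeasP (measurable_funB h1 h2) mZ.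
have e : H `&` elapsed r @^-1` Z `&` [set w | position r w = k] =
  H `&` (fun w => dep q k w - batch_arrival q n w) @^-1` Z `&` [set w | position r w = k].
  by apply/seteqP; split => w /= [[h4 h5] h6]; move: h5; rewrite /elapsed -/(position r w) h6.
rewrite e; apply: (historyI _ hp); exact: (historyI hH h3).
Qed.

(** The transforms form a row vector indexed by the type of the customer in position [r], counted
    from 0, on which a service acts by multiplication with a matrix. The event on the batch size
    stays the same while [r] grows; position [r = m] may already lie in the next batch. *)
Definition member_vec r j : R[i] :=
  cint P (H `&` type_at q (position r) j) (fun w => decay s (elapsed r w)).

Lemma positionS r w : position r.+1 w = (position r w).+1.
Proof. by rewrite /position addnS. Qed.

Lemma cbm_elapsed r : cbm (fun w => decay s (elapsed r w)).
Proof. exact: (cbm_comp (cbm_decay s0) (measurable_elapsed r)). Qed.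

Let mty r i : measurable (type_at q (position r) i) :=
  measurable_type_from Hq (measurable_position r) i.
Let mbu r : measurable (busy_from q (position r)) :=
  measurable_busy_from q (measurable_position r).
Let mid r : measurable (idle_from q (position r)) :=
  measurable_idle_from q (measurable_position r).

Lemma elapsedS_busy r w : (r < m)%N -> good q w -> H w ->
  busy_from q (position r) w ->
  decay s (elapsed r.+1 w) = decay s (elapsed r w) * decay s (service_at q (position r) w).
Proof.
move=> rm gw Hw bw; have rB : (r < B n w)%N := leq_trans rm Hw.
have a := arrival_member Hq rB; rewrite /busy_from/= in bw.
have S0 : 0 <= S (position r w) w by case: gw => _ [].
rewrite -decayD//; last by rewrite /elapsed subr_ge0 -a.
by congr (decay s _); rewrite /elapsed addnS /= max_r// addrAC.
Qed.

Lemma elapsedS_idle r w : (r < m)%N -> good q w -> H w ->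
  idle_from q (position r) w ->
  decay s (elapsed r.+1 w) = 1 * decay s (service_at q (position r) w).
Proof.
move=> rm gw Hw bw; have rB : (r < B n w)%N := leq_trans rm Hw.
have a := arrival_member Hq rB; rewrite /idle_from/= in bw.
rewrite mul1r; congr (decay s _); rewrite /elapsed addnS /= max_l ?(ltW bw)//.
by rewrite a addrAC subrr add0r.
Qed.

(** Split by the type in position [r] and by the state of the server. After a busy start the service
    time adds to the elapsed time; after an idle start the service begins when the batch arrives, so
    the elapsed time is this service time alone and the remaining integrand is 1. *)
Lemma member_vecS r j : (r < m)%N -> member_vec r.+1 j =
  \sum_i (cint P (H `&` type_at q (position r) i `&` busy_from q (position r))
            (fun w => decay s (elapsed r w)) * Gt K s i j +
          cint P (H `&` type_at q (position r) i `&` idle_from q (position r))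
            (fun=> 1) * Gtstar Kstar s i j).
Proof.
move=> rm; rewrite /member_vec.
have mS : measurable (type_at q (position r.+1) j) := mty r.+1 j.
have bS := cbm_elapsed r.+1.
have bs : cbm (fun w => decay s (service_at q (position r) w)).
  exact: (cbm_comp (cbm_decay s0) (measurable_service_at q (measurable_position r))).
rewrite (cint_partition (J := fun w => ctype q (position r w) w) Pf _ (mty r) bS);
  last exact: measurableI.
apply: eq_bigr => i _; rewrite -/(type_at q (position r) i).
have mHi : measurable (H `&` type_at q (position r) i) by exact: measurableI.
rewrite (cint_setU (A := busy_from q (position r)) Pf _ _ bS) //; last first.
  by apply: measurableI => //; exact: measurableI.
have eS : type_at q (position r.+1) j = type_at q (fun w => (position r w).+1) j.
  by apply/seteqP; split => w /=; rewrite /type_at/= positionS.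
have eC : ~` busy_from q (position r) = idle_from q (position r).
  by apply/seteqP; split => w /=; rewrite /busy_from /idle_from/= ltNge => /negP.
have mN : measurable (type_at q (fun w => (position r w).+1) j) by rewrite -eS.
congr (_ + _).
  rewrite -(cint_kernel _ _ (K_kernel Hq)).
  rewrite -(cint_service_busy lambda_gt0 Hq (measurable_position r)
    (measurable_elapsed r) (elapsed_past r))//; try exact: (cbm_decay s0).
  rewrite eS (_ : H `&` type_at q (fun w => (position r w).+1) j `&` type_at q (position r) i `&`
    busy_from q (position r) = H `&` type_at q (position r) i `&` busy_from q (position r) `&`
    type_at q (fun w => (position r w).+1) j); last by apply/seteqP; split => w /=; tauto.
  apply: (eq_cint_ae Pf _ mg bS _ g0); first by do 3 apply: measurableI => //.
    by apply: cbmM => //; exact: cbm_elapsed.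
  by move=> w [[[Hw _] bw] _] gw; exact: elapsedS_busy.
rewrite eC -[Gtstar Kstar s i j]/(Gt Kstar s i j) -(cint_kernel _ _ (Kstar_kernel Hq)).
rewrite -(cint_service_idle lambda_gt0 Hq (measurable_position r)
  (measurable_elapsed r) (elapsed_past r) i j (cbm_cst _ (1 : R[i])) (cbm_decay s0)).
rewrite eS (_ : H `&` type_at q (fun w => (position r w).+1) j `&` type_at q (position r) i `&`
    idle_from q (position r) = H `&` type_at q (position r) i `&` idle_from q (position r) `&`
  type_at q (fun w => (position r w).+1) j); last by apply/seteqP; split => w /=; tauto.
apply: (eq_cint_ae Pf _ mg bS _ g0); first by do 3 apply: measurableI => //.
  by apply: cbmM => //; exact: cbm_cst.
by move=> w [[[Hw _] bw] _] gw; exact: elapsedS_idle.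
Qed.

Lemma busy_inside_batch r w : (0 < r < m)%N -> good q w -> H w ->
  busy_from q (position r) w.
Proof.
case: r => // r /= rm gw Hw; rewrite /busy_from/= /position.
rewrite (arrival_member Hq (leq_trans rm Hw)) addnS.
by apply: (batch_arrival_le_dep Hq gw); exact: leq_trans (ltnW rm) Hw.
Qed.

(** For [r >= 1] the previous customer belongs to the same batch and departs no earlier than the
    batch arrives. The idle term is therefore null and the busy condition costs nothing. *)
Lemma member_vec_step r j : (0 < r < m)%N ->
  member_vec r.+1 j = \sum_i member_vec r i * Gt K s i j.
Proof.
move=> rm; have /andP[_ rm'] := rm; rewrite member_vecS//; apply: eq_bigr => i _.
have mHi : measurable (H `&` type_at q (position r) i) by exact: measurableI.
rewrite [X in _ + X * _](cint_good_null _ (cbm_cst _ (1 : R[i]))); last 2 first.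
- exact: measurableI.
- apply/seteqP; split => w //= [[[Hw _] iw] gw].
  have := busy_inside_batch rm gw Hw; rewrite /busy_from/=.
  by rewrite leNgt; move: iw; rewrite /idle_from/= => ->.
rewrite mul0r addr0 /member_vec.
rewrite (cint_setU (A := busy_from q (position r)) Pf mHi _ (cbm_elapsed r))//.
rewrite [X in (_ + X) * _](cint_good_null _ (cbm_elapsed r)) ?addr0//.
  by apply: measurableI => //; exact: measurableC.
by apply/seteqP; split => w //= [[[Hw _] iw] gw]; apply: iw; exact: busy_inside_batch.
Qed.

Lemma member_vec_expr r j : (r < m)%N ->
  member_vec r.+1 j = \sum_i member_vec 1 i * (Gt K s ^+ r) i j.
Proof.
elim: r j => [|r IH] j rm.
  rewrite (bigD1 j)//= big1 ?addr0; last first.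
    by move=> i ij; rewrite expr0 mxE (negbTE ij) mulr0.
  by rewrite expr0 mxE eqxx mulr1.
rewrite member_vec_step//.
under eq_bigr do rewrite IH ?(ltnW rm)// mulr_suml.
rewrite exchange_big/=; apply: eq_bigr => i _.
rewrite exprSr mxE mulr_sumr; apply: eq_bigr => k _; by rewrite mulrA.
Qed.

Lemma member_waitingE w r : (0 < r < m)%N -> good q w -> H w ->
  waiting q (member q n r.+1 w) w = elapsed r w.
Proof.
move=> rm gw Hw; have := busy_inside_batch rm gw Hw; rewrite /busy_from/= => bw.
rewrite /waiting /start /member /= -/(position r w) max_r//.
have rB : (r < B n w)%N by case/andP: rm => _ rm; exact: leq_trans Hw.
by rewrite /elapsed -/(position r w) /position (arrival_member Hq rB).
Qed.

Lemma member_sojournE w r : (r < m)%N -> H w ->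
  sojourn q (member q n r.+1 w) w = elapsed r.+1 w.
Proof.
move=> rm Hw.
have a := arrival_member Hq (leq_trans rm Hw).
by rewrite /sojourn (_ : member q n r.+1 w = first q n w + r)%N// a /elapsed addnS.
Qed.

Lemma measurable_member r : measurable_fun setT (member q n r).
Proof. exact: (measurable_position r.-1). Qed.

Lemma measurable_member_waiting r :
  measurable_fun setT (fun w => waiting q (member q n r w) w).
Proof. by apply: (measurable_random_index (measurable_waiting q)); exact: measurable_member. Qed.

Lemma cint_member_waiting r : (0 < r < m)%N ->
  cint P H (fun w => decay s (waiting q (member q n r.+1 w) w)) =
  \sum_j member_vec r j.
Proof.
move=> rm; have bE := cbm_elapsed r.
rewrite (eq_cint_ae (G := fun w => decay s (elapsed r w)) Pf mH mg _ bE g0); last 2 first.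
- exact: (cbm_comp (cbm_decay s0) (measurable_member_waiting r.+1)).
- by move=> w Hw gw; rewrite member_waitingE.
exact: (cint_partition (J := fun w => ctype q (position r w) w) Pf mH (mty r) bE).
Qed.

Lemma cint_member_sojourn r : (r < m)%N ->
  cint P H (fun w => decay s (sojourn q (member q n r.+1 w) w)) =
  \sum_j member_vec r.+1 j.
Proof.
move=> rm; have bE := cbm_elapsed r.+1.
transitivity (cint P H (fun w => decay s (elapsed r.+1 w))).
  by apply: eq_cint; move=> w; rewrite inE => Hw; rewrite member_sojournE.
exact: (cint_partition (J := fun w => ctype q (position r.+1 w) w) Pf mH (mty r.+1) bE).
Qed.

(** The history with [b = n] does not contain the size of batch [n], which is thus independent of
    [D] and [Y]. The second factor in the product law is a one-point space: only the constant, the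
    probability of the size event, matters. *)
Lemma cint_batch_ge D (Y : T -> R) F : measurable D -> measurable_fun setT Y ->
  (forall X, measurable X -> forall k, exists2 D',
     history q (fun l => (l < n.+1)%N) (fun l => (l < n)%N) k D' &
     D `&` Y @^-1` X `&` [set w | first q n w = k] =
     D' `&` [set w | first q n w = k]) ->
  cbm F ->
  cint P (D `&` H) (fun w => F (Y w)) = ofR (fine (P H)) * cint P D (fun w => F (Y w)).
Proof.
move=> mD mY hD bF.
pose fs : seq (nat + nat + unit) := [:: inl (inr n)].
pose Ef (x : nat + nat + unit) : set T := H.
have fsE x : x \in fs -> input_events q x (Ef x).
  by rewrite inE => /eqP ->; exists [set x | (m <= x)%N] => //; rewrite setTI.
have fsf x : x \in fs -> ~ input_past (fun l => (l < n.+1)%N) (fun l => (l < n)%N) x.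
  by rewrite inE => /eqP -> /=; rewrite ltnn.
have FE : future_event fs Ef = H.
  apply/seteqP; split => w /= => [h|Hw x _//].
  by apply: (h (inl (inr n))); rewrite /= inE.
pose c : {nonneg R} := NngNum (fine_ge0 (measure_ge0 P H)).
pose nu : {measure set unit -> \bar R} := \d_tt.
have pl X Z : measurable X -> measurable Z ->
    P (D `&` H `&` Y @^-1` X `&` (fun=> tt) @^-1` Z) =
    (P (D `&` Y @^-1` X) * (c%:num%:E * nu Z))%E.
  move=> mX mZ; have mDX : measurable (D `&` Y @^-1` X).
    by apply: measurableI => //; exact: measurable_preimageT.
  have ind := future_indep lambda_gt0 Hq (leqW (leqnn n)) (isT : uniq fs) fsE fsf mDX (hD X mX).
  rewrite FE in ind; rewrite /= fineK ?(mu_fin Pf)// /nu diracE.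
  have [Zt|Zt] := boolP (tt \in Z); last first.
    rewrite !mule0 (_ : _ `&` _ = set0) ?measure0//.
    by apply/seteqP; split => w //= [_ h]; rewrite notin_setE in Zt.
  rewrite mule1 -[RHS]ind; congr (P _); rewrite inE in Zt.
  by apply/seteqP; split => w /=; tauto.
have nu1 : nu setT = 1%E by rewrite /nu /= diracE in_setT.
have nufin : (nu setT < +oo)%E by rewrite nu1 ltry.
have mDH : measurable (D `&` H) by exact: measurableI.
have := cproduct_law Pf nufin mDH mD mY (measurable_cst tt) pl bF (cbm_cst _ (1 : R[i])).
have -> : cint nu setT (fun=> 1 : R[i]) = 1 by rewrite cint_cst// mul1r nu1.
rewrite mulr1 => <-.
by apply: eq_cint => w _; rewrite mulr1.
Qed.

Let hist_type i k : history q (fun l => (l < n.+1)%N) (fun l => (l < n)%N) k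
  [set w | ctype q k w = i].
Proof. exact: history_type. Qed.

Lemma member_vec1 j : (0 < m)%N -> member_vec 1 j = ofR (fine (P H)) *
  \sum_i (cint P ([set w | sc_type q n w = i] `&` [set w | 0 <= slack q n w])
            (fun w => decay s (slack q n w)) * Gt K s i j +
          ofR (fine (P ([set w | sc_type q n w = i] `&` [set w | slack q n w < 0]))) *
            Gtstar Kstar s i j).
Proof.
move=> m0; rewrite member_vecS// mulr_sumr; apply: eq_bigr => i _.
have E0 : elapsed 0 = slack q n by apply/funext => w; rewrite /elapsed addn0.
have ty : type_at q (position 0) i = [set w | sc_type q n w = i].
  by apply/seteqP; split => w; rewrite /type_at/= /position addn0.
have bu : busy_from q (position 0) = [set w | 0 <= slack q n w].
  apply/seteqP; split => w; rewrite /busy_from/= /position addn0 (arrival_first Hq) /slack;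
    by rewrite subr_ge0.
have idl : idle_from q (position 0) = [set w | slack q n w < 0].
  apply/seteqP; split => w; rewrite /idle_from/= /position addn0 (arrival_first Hq) /slack;
    by rewrite subr_lt0.
have m1 : measurable [set w | sc_type q n w = i] by rewrite -ty.
have m2 : measurable [set w | 0 <= slack q n w] by rewrite -bu.
have m3 : measurable [set w | slack q n w < 0] by rewrite -idl.
have mS := measurable_slack q n.
have mf : measurable_fun setT (fun x : R * R => x.1 - x.2).
  by apply: measurable_funB; [exact: measurable_fst|exact: measurable_snd].
have hD (C : set R) : measurable C -> forall X, measurable X -> forall k, exists2 D',
     history q (fun l => (l < n.+1)%N) (fun l => (l < n)%N) k D' &
     ([set w | sc_type q n w = i] `&` slack q n @^-1` C) `&` slack q n @^-1` X `&`
       [set w | first q n w = k] =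
     D' `&` [set w | first q n w = k].
  move=> mC X mX k.
  have hl := @history_local _ _ _ _ _ _ _ _ q Hq n n (fun x y => x - y)
    [set w | sc_type q n w = i] (leqW (leqnn n)) mf.
  (* The sign condition on the slack is moved into the test set, so that only the type has to be an
     event of the history. *)
  have [|D' hD' e] := hl _ (C `&` X) (measurableI _ _ mC mX) k.
    move=> k'; exists [set w | ctype q k' w = i] => //.
    by apply/seteqP; split => w /= [h1 h2]; split => //; move: h1; rewrite /sc_type h2.
  by exists D' => //; rewrite -e -!setIA.
have h0 : measurable [set x : R | 0 <= x].
  by rewrite -set_itvcy; exact: measurable_itv.
have h1 : measurable [set x : R | x < 0].
  by rewrite -set_itvNyo; exact: measurable_itv.
rewrite E0 ty bu idl !mulrDr !mulrA; congr (_ * _ + _ * _).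
  rewrite -(cint_batch_ge (measurableI _ _ m1 m2) mS (hD _ h0) (cbm_decay s0)).
  by congr (cint P _ _); apply/seteqP; split => w /=; tauto.
have := cint_batch_ge (measurableI _ _ m1 m3) mS (hD _ h1) (cbm_cst _ (1 : R[i])).
have m13 : measurable ([set w | sc_type q n w = i] `&` [set w | slack q n w < 0]).
  exact: measurableI.
have m13H : measurable ([set w | sc_type q n w = i] `&` [set w | slack q n w < 0] `&` H).
  exact: measurableI.
have mHi : measurable (H `&` [set w | sc_type q n w = i] `&` [set w | slack q n w < 0]).
  by apply: measurableI => //; exact: measurableI.
rewrite !cint_cst// !mul1r => <-.
by congr (ofR (fine (P _))); apply/seteqP; split => w /=; tauto.
Qed.

End FixedBatch.

End MemberTransforms.

(** * Stationary limits *)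

Section ComplexConvergence.
Context {R : realType}.
Implicit Types (u v : nat -> R[i]) (l : R[i]).
Local Notation Re := complex.Re.
Local Notation Im := complex.Im.

Definition ccvg u l := Re (u n) @[n --> \oo] --> Re l /\ Im (u n) @[n --> \oo] --> Im l.

Lemma ccvg_unique u l l' : ccvg u l -> ccvg u l' -> l = l'.
Proof.
move=> [h1 h2] [h3 h4]; apply: eq_complexP.
  exact: (cvg_unique (@Rhausdorff R) h1 h3).
exact: (cvg_unique (@Rhausdorff R) h2 h4).
Qed.

Lemma ccvg_cst l : ccvg (fun=> l) l.
Proof. by split; exact: cvg_cst. Qed.

Lemma ccvgD u v l l' : ccvg u l -> ccvg v l' -> ccvg (fun n => u n + v n) (l + l').
Proof.
move=> [h1 h2] [h3 h4]; split.
  by under eq_fun do rewrite cReD; rewrite cReD; exact: cvgD.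
by under eq_fun do rewrite cImD; rewrite cImD; exact: cvgD.
Qed.

Lemma ccvgM u v l l' : ccvg u l -> ccvg v l' -> ccvg (fun n => u n * v n) (l * l').
Proof.
move=> [h1 h2] [h3 h4]; split.
  by under eq_fun do rewrite cReM; rewrite cReM; apply: cvgB; exact: cvgM.
by under eq_fun do rewrite cImM; rewrite cImM; apply: cvgD; exact: cvgM.
Qed.

Lemma ccvg_sum J (s : seq J) (u : J -> nat -> R[i]) (l : J -> R[i]) :
  (forall j, ccvg (u j) (l j)) ->
  ccvg (fun n => \sum_(j <- s) u j n) (\sum_(j <- s) l j).
Proof.
move=> ul; elim: s => [|j s IH].
  by under [X in ccvg X]eq_fun do rewrite big_nil; rewrite big_nil; exact: ccvg_cst.
by under [X in ccvg X]eq_fun do rewrite big_cons; rewrite big_cons; exact: ccvgD.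
Qed.

Lemma ccvgS u l : ccvg u l -> ccvg (fun n => u n.+1) l.
Proof.
move=> [h1 h2]; split.
  by move: h1; rewrite -(cvg_shiftS (fun n => Re (u n))).
by move: h2; rewrite -(cvg_shiftS (fun n => Im (u n))).
Qed.

Lemma ccvg_ofR (u : nat -> R) (l : R) : u n @[n --> \oo] --> l ->
  ccvg (fun n => ofR (u n)) (ofR l).
Proof. by move=> ul; split => //; exact: cvg_cst. Qed.

End ComplexConvergence.

Section StationaryLimits.
Context (R : realType) (N : nat) (lambda : R).
Context (K Kstar : 'I_N -> 'I_N -> {measure set R -> \bar R}).
Context d (T : measurableType d) (P : probability T R) (q : queue P N).
Context d' (T' : measurableType d') (Q : probability T' R).
Variables (Xd : {RV Q >-> nat}) (Jd : T' -> 'I_N).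
Hypothesis lambda_gt0 : 0 < lambda.
Hypothesis Hq : MXSM2_queue q lambda K Kstar.
Hypothesis mJ : forall i, measurable [set v | Jd v = i].
Hypothesis state_limit : sc_state_limit q Q Xd Jd.
Variables (z s : R[i]) (z1 : `|z| <= 1) (sE : s = ofR lambda * (1 - z)).
Local Notation I := (init_batches q).
Local Notation B := (batch_size q).
Local Notation Re := complex.Re.
Local Notation Im := complex.Im.
Let Pf : (P setT < +oo)%E := Pfin P.
Let Qf : (Q setT < +oo)%E := Pfin Q.
Let mg := measurable_good q.
Let g0 := good_full lambda_gt0 Hq.

Let s0 : 0 <= Re s. Proof. by rewrite sE; exact: Re_rate_ge0. Qed.

Lemma rate_expr : 1 - s / ofR lambda = z.
Proof. by rewrite sE mulrAC divff ?mul1r ?subKr// ofR_eq0 gt_eqF. Qed.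

Lemma cvg_late_init : fine (P (~` [set w | (I w <= n)%N])) @[n --> \oo] --> (0 : R).
Proof.
have mI n : measurable (~` [set w | (I w <= n)%N]).
  by apply: measurableC; exact: measurable_init.
rewrite -[X in _ --> X]/(fine 0%E); apply: fine_cvg; rewrite fineK//.
have := @nonincreasing_cvg_mu _ _ _ P (fun n => ~` [set w | (I w <= n)%N]).
rewrite (_ : \bigcap_n _ = set0) ?measure0; last first.
  by apply/seteqP; split => w //= /(_ (I w) Logic.I) /=; rewrite leqnn.
apply => //; first by rewrite (le_lt_trans _ (ltry (1 : R)))// probability_le1.
move=> m n mn; apply/subsetPset => w /=; apply: contra_not => h.
exact: leq_trans mn.
Qed.

Lemma cvg_late (F : nat -> T -> R) (D : nat -> set T) :
  (forall n, measurable (D n)) -> (forall n, bmfun (F n)) ->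
  (forall n w, `|F n w| <= 1) ->
  (\int[P]_(w in D n) F n w - \int[P]_(w in D n `&` [set w | (I w <= n)%N]) F n w)
    @[n --> \oo] --> (0 : R).
Proof.
move=> mD bF F1; have mI n := measurable_init q n.
apply/norm_cvg0P; apply: (squeeze_cvgr _ (cvg_cst 0) cvg_late_init).
near=> n; rewrite normr_ge0/= (bRintegral_setU Pf (mD n) (mI n) (bF n)) addrAC subrr add0r.
have mDI : measurable (D n `&` ~` [set w | (I w <= n)%N]).
  by apply: measurableI => //; exact: measurableC.
apply: (le_trans (le_norm_bRintegral Pf mDI (bF n) (fun w _ => F1 n w))).
rewrite mul1r fine_le ?(mu_fin Pf)//; first exact: measurableC.
by apply: le_measure; rewrite ?inE//; exact: measurableC.
Unshelve. all: by end_near. Qed.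

Lemma ccvg_late (F G : nat -> T -> R[i]) (D : nat -> set T) l :
  (forall n, measurable (D n)) -> (forall n, cbm (F n)) -> (forall n, cbm (G n)) ->
  (forall n w, `|Re (F n w)| <= 1 /\ `|Im (F n w)| <= 1) ->
  (forall n w, `|Re (G n w)| <= 1 /\ `|Im (G n w)| <= 1) ->
  (forall n, cint P (D n `&` [set w | (I w <= n)%N]) (F n) =
             cint P (D n `&` [set w | (I w <= n)%N]) (G n)) ->
  ccvg (fun n => cint P (D n) (F n)) l -> ccvg (fun n => cint P (D n) (G n)) l.
Proof.
move=> mD bF bG F1 G1 FG [h1 h2].
have key (f g : nat -> T -> R) (c : R) : (forall n, bmfun (f n)) -> (forall n, bmfun (g n)) ->
    (forall n w, `|f n w| <= 1) -> (forall n w, `|g n w| <= 1) ->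
    (forall n, \int[P]_(w in D n `&` [set w | (I w <= n)%N]) f n w =
       \int[P]_(w in D n `&` [set w | (I w <= n)%N]) g n w) ->
    \int[P]_(w in D n) f n w @[n --> \oo] --> c ->
    \int[P]_(w in D n) g n w @[n --> \oo] --> c.
  move=> bf bg f1 g1 fg hf.
  have h3 : (\int[P]_(w in D n) f n w -
      ((\int[P]_(w in D n) f n w - \int[P]_(w in D n `&` [set w | (I w <= n)%N]) f n w) -
       (\int[P]_(w in D n) g n w - \int[P]_(w in D n `&` [set w | (I w <= n)%N]) g n w)))
      @[n --> \oo] --> c - (0 - 0).
    by apply: cvgB; [exact: hf|apply: cvgB; exact: cvg_late].
  move: h3; rewrite subrr subr0; apply: cvg_trans; apply: near_eq_cvg; near=> n.
  by rewrite /= fg; ring.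
split.
- apply: (key (fun n w => Re (F n w)) (fun n w => Re (G n w))) => //.
  + by move=> n; case: (bF n).
  + by move=> n; case: (bG n).
  + by move=> n w; case: (F1 n w).
  + by move=> n w; case: (G1 n w).
  + by move=> n; exact: (congr1 (@Re R) (FG n)).
- apply: (key (fun n w => Im (F n w)) (fun n w => Im (G n w))) => //.
  + by move=> n; case: (bF n).
  + by move=> n; case: (bG n).
  + by move=> n w; case: (F1 n w).
  + by move=> n w; case: (G1 n w).
  + by move=> n; exact: (congr1 (@Im R) (FG n)).
Unshelve. all: by end_near. Qed.

Lemma measurable_sc_type n i : measurable [set w | sc_type q n w = i].
Proof. by apply: (measurable_type_at (mtype Hq)); exact: measurable_first. Qed.

Lemma ccvg_state (h : nat -> 'I_N -> R[i]) :
  (forall x i, `|Re (h x i)| <= 1 /\ `|Im (h x i)| <= 1) ->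
  ccvg (fun n => cint P setT (fun w => h (sc_num_left q n w) (sc_type q n w)))
       (cint Q setT (fun v => h (Xd v) (Jd v))).
Proof.
move=> h1; have mX : measurable_fun setT Xd by [].
split.
  apply: (discrete_law_cvg (h := fun x i => Re (h x i)) (measurable_sc_num_left q)
    measurable_sc_type mX mJ state_limit (C := 1)) => x i; exact: (h1 x i).1.
apply: (discrete_law_cvg (h := fun x i => Im (h x i)) (measurable_sc_num_left q)
  measurable_sc_type mX mJ state_limit (C := 1)) => x i; exact: (h1 x i).2.
Qed.

Let expr_le1 k : `|Re (z ^+ k)| <= 1 /\ `|Im (z ^+ k)| <= 1.
Proof. by split; [exact: Re_expr_le1|exact: Im_expr_le1]. Qed.

Lemma ccvg_sc_waiting :
  ccvg (fun n => cint P setT (fun w => decay s (sc_waiting q n w)))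
    (cint Q setT (fun v => z ^+ Xbs Xd v)).
Proof.
have h := @ccvg_state (fun x _ => z ^+ (x - 1)) (fun x _ => expr_le1 _).
apply: (ccvg_late _ _ _ _ _ _ h) => //.
- move=> n; apply: cbm_expr => //.
  exact: (measurable_nat_comp (fun x => (x - 1)%N) (measurable_sc_num_left q n)).
- by move=> n; exact: (cbm_comp (cbm_decay s0) (measurable_sc_waiting q n)).
- by move=> n w; exact: decay_le1.
- by move=> n; rewrite setTI sE; exact: (waiting_transform lambda_gt0 Hq z1 n).
Qed.

Lemma ccvg_sc_sojourn :
  ccvg (fun n => cint P setT (fun w => decay s (sc_sojourn q n w)))
    (cint Q setT (fun v => z ^+ Xd v)).
Proof.
(* The number left behind by batch [n] is [sc_num_left n.+1], hence the shifted sequence. *)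
have h := ccvgS (@ccvg_state (fun x _ => z ^+ x) (fun x _ => expr_le1 _)).
have bz n : cbm (fun w => z ^+ sc_num_left q n.+1 w).
  by apply: cbm_expr => //; exact: measurable_sc_num_left.
have bd n : cbm (fun w => decay s (sc_sojourn q n w)).
  exact: (cbm_comp (cbm_decay s0) (measurable_sc_sojourn q n)).
apply: (ccvg_late _ bz bd _ _ _ h) => //; first by move=> n w; exact: decay_le1.
move=> n; rewrite setTI.
have mI := measurable_init q n.
have mS : measurable [set w | 0 <= sc_sojourn q n w].
  by apply: measurable_set_le => //; exact: measurable_sc_sojourn.
have e F : cbm F -> cint P [set w | (I w <= n)%N] F =
    cint P ([set w | (I w <= n)%N] `&` [set w | 0 <= sc_sojourn q n w]) F.
  move=> bF; rewrite (cint_setU Pf mI mS bF) [X in _ + X](cint_good_null lambda_gt0 Hq _ bF).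
  - by rewrite addr0.
  - by apply: measurableI => //; exact: measurableC.
  - apply/seteqP; split => w //= [[_ h1] gw]; apply: h1; exact: (sc_sojourn_ge0 Hq gw).
by rewrite !e// sE; exact: (sojourn_transform lambda_gt0 Hq z1 n).
Qed.

Let measurable_cell_slack n i :
  measurable ([set w | sc_type q n w = i] `&` [set w | 0 <= slack q n w]).
Proof.
apply: measurableI; first exact: measurable_sc_type.
by apply: measurable_set_le => //; exact: measurable_slack.
Qed.

(** On good paths [sc_num_left] is positive exactly when the slack is nonnegative. The functional of
    the state whose limit is [c_coef] is therefore the left side of [slack_transform], up to the
    batches present at time 0. *)
Lemma ccvg_busy i :
  ccvg (fun n => cint P ([set w | sc_type q n w = i] `&` [set w | 0 <= slack q n w])
          (fun w => decay s (slack q n w)))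
    (c_coef lambda Q Xd Jd i s).
Proof.
pose h x i' : R[i] := z ^+ (x - 1) * (i' == i)%:R * (1 <= x)%N%:R.
have h1 x i' : `|Re (h x i')| <= 1 /\ `|Im (h x i')| <= 1.
  rewrite /h; case: (i' == i); case: (1 <= x)%N; rewrite ?mulr1 ?mulr0 //=;
    by rewrite !normr0 ler01.
have -> : c_coef lambda Q Xd Jd i s = cint Q setT (fun v => h (Xd v) (Jd v)).
  by rewrite /c_coef rate_expr.
have bz n : cbm (fun w => z ^+ (sc_num_left q n w - 1)).
  apply: cbm_expr => //.
  exact: (measurable_nat_comp (fun x => (x - 1)%N) (measurable_sc_num_left q n)).
have bd n : cbm (fun w => decay s (slack q n w)).
  exact: (cbm_comp (cbm_decay s0) (measurable_slack q n)).
have e n : cint P setT (fun w => h (sc_num_left q n w) (sc_type q n w)) =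
    cint P ([set w | sc_type q n w = i] `&` [set w | 0 <= slack q n w])
      (fun w => z ^+ (sc_num_left q n w - 1)).
  rewrite -[X in _ = cint P X _]setTI cint_setI_indic//.
  apply: (eq_cint_ae Pf _ mg _ _ g0) => //.
  - have bJ : bmfun (fun w => \1_[set w | sc_type q n w = i] w : R).
      by apply: bmfun_indic; exact: measurable_sc_type.
    have mX : measurable [set w | (1 <= sc_num_left q n w)%N].
      apply: measurable_set_bool.
      exact: (measurable_nat_comp (fun x => (1 <= x)%N) (measurable_sc_num_left q n)).
    have := cbmM (cbmM (bz n) (cbm_ofR bJ)) (cbm_ofR (bmfun_indic R mX)).
    congr (cbm _); apply/funext => w; rewrite /h !indicE in_set_bool.
    rewrite (_ : (w \in [set w | sc_type q n w = i]) = (sc_type q n w == i)); last first.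
      by apply/idP/eqP; rewrite inE.
    by case: (_ == i); case: (1 <= _)%N.
  - by apply: cbmM; [apply: cbm_ofR; exact: bmfun_indic|exact: bz].
  - move=> w _ gw; rewrite /h indicE.
    have nl0 := sc_num_left0P gw n.
    have e1 : (1 <= sc_num_left q n w)%N = (0 <= slack q n w).
      rewrite lt0n leNgt; congr (~~ _); apply/eqP/idP; exact: nl0.1 || exact: nl0.2.
    have -> : (w \in [set w | sc_type q n w = i] `&` [set w | 0 <= slack q n w]) =
        (sc_type q n w == i) && (1 <= sc_num_left q n w)%N.
      apply/idP/andP; rewrite inE/= e1; first by move=> [-> ->].
      by move=> [/eqP -> ->].
    by case: (_ == i); case: (1 <= _)%N; rewrite ?mulr1 ?mulr0 ?mul0r ?mul1r.
have := ccvg_state h1; under [X in ccvg X]eq_fun do rewrite e.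
apply: (ccvg_late _ bz bd) => //; first by move=> n w; exact: decay_le1.
move=> n; rewrite setIC setIA sE; exact: (slack_transform lambda_gt0 Hq z1 n i).
Qed.

Lemma ccvg_idle i :
  ccvg (fun n => ofR (fine (P ([set w | sc_type q n w = i] `&` [set w | slack q n w < 0]))))
    (a_coef Q Xd Jd i).
Proof.
apply: ccvg_ofR.
have mXd : measurable [set v | Xd v = 0%N /\ Jd v = i] by exact: (measurable_cell _ mJ).
have sl : P [set w | sc_num_left q n w = 0%N /\ sc_type q n w = i] @[n --> \oo] -->
    (fine (Q [set v | Xd v = 0%N /\ Jd v = i]))%:E.
  by rewrite fineK ?(mu_fin Qf)//; exact: state_limit.
rewrite (_ : (fun n => _) =
    (fun n => fine (P [set w | sc_num_left q n w = 0%N /\ sc_type q n w = i]))).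
  exact: (fine_cvg sl).
apply/funext => n /=; congr fine; apply: (eq_measure_full _ _ mg g0).
- apply: measurableI; first exact: measurable_sc_type.
  by apply: measurable_set_lt => //; exact: measurable_slack.
- exact: (measurable_cell (measurable_sc_num_left q n) (measurable_sc_type n)).
- by move=> w gw /=; have := sc_num_left0P gw n; rewrite /sc_type; tauto.
Qed.

End StationaryLimits.

Section MemberLimits.
Context (R : realType) (N : nat) (lambda : R).
Context (K Kstar : 'I_N -> 'I_N -> {measure set R -> \bar R}).
Context d (T : measurableType d) (P : probability T R) (q : queue P N).
Context d' (T' : measurableType d') (Q : probability T' R).
Variables (Xd : {RV Q >-> nat}) (Jd : T' -> 'I_N).
Hypothesis lambda_gt0 : 0 < lambda.
Hypothesis Hq : MXSM2_queue q lambda K Kstar.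
Hypothesis mJ : forall i, measurable [set v | Jd v = i].
Hypothesis state_limit : sc_state_limit q Q Xd Jd.
Variables (z s : R[i]) (z1 : `|z| <= 1) (sE : s = ofR lambda * (1 - z)).
Local Notation B := (batch_size q).
Local Notation Re := complex.Re.
Local Notation Im := complex.Im.
Let Pf : (P setT < +oo)%E := Pfin P.
Let mg := measurable_good q.
Let g0 := good_full lambda_gt0 Hq.

Let s0 : 0 <= Re s. Proof. by rewrite sE; exact: Re_rate_ge0. Qed.

Lemma waiting_ge0 k w : 0 <= waiting q k w.
Proof. by rewrite /waiting subr_ge0 le_max lexx. Qed.

Lemma sojourn_ge0 k w : good q w -> 0 <= sojourn q k w.
Proof. by move=> gw; rewrite /sojourn subr_ge0; exact: arrival_le_dep. Qed.

(** Identical distribution is assumed for point masses only; general sets follow by summing over the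
    values of the size. *)
Lemma size_law n (X : set nat) : P (B n @^-1` X) = P (B 0%N @^-1` X).
Proof.
have mX k : measurable (B k @^-1` X) by exact: measurable_preimageT.
rewrite -[LHS]fineK ?(mu_fin Pf)// -[RHS]fineK ?(mu_fin Pf)//; congr EFin.
have h k := measure_countable_partition Pf (mX k) (measurable_funPT (B k)).
apply: (cvg_unique (@Rhausdorff R) (h n)); rewrite (_ : (fun n => _) =
  (fun M => \sum_(0 <= k < M) fine (P (B 0%N @^-1` X `&` [set w | B 0%N w = k])))).
  exact: h.
apply/funext => M; apply: eq_bigr => k _; congr fine.
have e l : B l @^-1` X `&` [set w | B l w = k] = if k \in X then [set w | B l w = k] else set0.
  case: ifPn; rewrite ?inE ?notin_setE => Xk; apply/seteqP; split => w //=.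
  - by move=> [].
  - by move=> h1; rewrite h1.
  - by move=> [+ h1]; rewrite h1.
rewrite !e; case: ifP => _; rewrite ?measure0//.
by transitivity (batch_pmf q k); [|symmetry]; exact: (batch_size_idd Hq).
Qed.

Lemma batch_ge_law n m : P (batch_ge q n m) = P (batch_ge q 0 m).
Proof. exact: (size_law n [set x | (m <= x)%N]). Qed.

Lemma batch_ge_full n m : (m <= 1)%N -> batch_ge q n m = setT.
Proof.
by move=> m1; apply/seteqP; split => w //= _; exact: leq_trans m1 (size_ge1 Hq n w).
Qed.

Section LimitTransforms.
Variables (V : nat -> T -> R) (Y : {RV Q >-> R}).
Hypotheses (mV : forall k, measurable_fun setT (V k)).
Hypotheses (V0 : forall k w, good q w -> 0 <= V k w).

Let int0 (D : set T) (U : T -> R) (f : R -> R) : measurable D -> measurable_fun setT U ->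
  (forall w, D w -> good q w -> 0 <= U w) -> continuous f -> bounded_fun f ->
  (forall y, 0 <= y -> f y = 0) -> \int[P]_(w in D) f (U w) = 0.
Proof.
move=> mD mU U0 cf bf f0; have bmf : bmfun f.
  split; first exact: continuous_measurable_fun.
  have [M [Mr hM]] := bf; exists (`|M| + 1) => y; apply: hM => //.
  by rewrite (le_lt_trans (ler_norm M))// ltrDl.
rewrite (eq_bRintegral_ae Pf mD mg (bmfun_comp bmf mU) (bmfun_cst _ 0) g0).
  by rewrite Rintegral_cst// mul0r.
by move=> w Dw gw; rewrite f0//; exact: U0.
Qed.

Lemma sc_limit_lst : sc_limit P Q V Y ->
  ccvg (fun n => cint P setT (fun w => decay s (V n w))) (lst Q s Y).
Proof.
move=> LY; have Y0 : Q [set v | Y v < 0] = 0%E.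
  apply: (law_limit_ge0 LY) => n f cf bf f0.
  by apply: int0 => // w _ gw; exact: V0.
by have [h1 h2] := lst_limit LY s0 Y0; split.
Qed.

Lemma member_limit_lst m : (1 <= m)%N -> member_limit q Q V m Y ->
  ccvg (fun n => ofR (fine (P (batch_ge q 0 m)))^-1 *
    cint P (batch_ge q n m) (fun w => decay s (V (member q n m w) w))) (lst Q s Y).
Proof.
move=> m1 LY.
have mVm n : measurable_fun setT (fun w => V (member q n m w) w).
  by apply: (measurable_random_index mV); exact: measurable_member.
have Y0 : Q [set v | Y v < 0] = 0%E.
  apply: (law_limit_ge0 LY) => n f cf bf f0.
  rewrite (int0 _ (mVm n))// ?mulr0//; first exact: measurable_batch_ge.
  by move=> w _ gw; exact: V0.
have [h1 h2] := lst_limit LY s0 Y0; split.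
- rewrite (_ : (fun n => _) = (fun n => (fine (P (batch_ge q n m)))^-1 *
    \int[P]_(w in batch_ge q n m) Re (decay s (V (member q n m w) w)))) //.
  by apply/funext => n; rewrite batch_ge_law cReM/= mul0r subr0.
- rewrite (_ : (fun n => _) = (fun n => (fine (P (batch_ge q n m)))^-1 *
    \int[P]_(w in batch_ge q n m) Im (decay s (V (member q n m w) w)))) //.
  by apply/funext => n; rewrite batch_ge_law cImM/= mul0r addr0.
Qed.

End LimitTransforms.
End MemberLimits.

Section SuperCustomersAndMembers.
Context (R : realType) (N : nat) (lambda : R).
Context (K Kstar : 'I_N -> 'I_N -> {measure set R -> \bar R}).
Context d (T : measurableType d) (P : probability T R) (q : queue P N).
Context d' (T' : measurableType d') (Q : probability T' R).
Variables (Xd : {RV Q >-> nat}) (Jd : T' -> 'I_N).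
Hypothesis lambda_gt0 : 0 < lambda.
Hypothesis Hq : MXSM2_queue q lambda K Kstar.
Hypothesis mJ : forall i, measurable [set v | Jd v = i].
Hypothesis state_limit : sc_state_limit q Q Xd Jd.
Variables (z s : R[i]) (z1 : `|z| <= 1) (sE : s = ofR lambda * (1 - z)).
Local Notation B := (batch_size q).
Local Notation Re := complex.Re.
Local Notation Im := complex.Im.
Let Pf : (P setT < +oo)%E := Pfin P.

Let s0 : 0 <= Re s. Proof. by rewrite sE; exact: Re_rate_ge0. Qed.

Lemma sc_waiting_limit (Y : {RV Q >-> R}) : sc_limit P Q (sc_waiting q) Y ->
  lst Q s Y = cintegral Q (fun v => (1 - s / ofR lambda) ^+ Xbs Xd v).
Proof.
move=> LY; rewrite (rate_expr lambda_gt0 sE).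
have h1 := sc_limit_lst lambda_gt0 Hq z1 sE (measurable_sc_waiting q)
  (fun k w _ => sc_waiting_ge0 Hq k w) LY.
exact: (ccvg_unique h1 (ccvg_sc_waiting lambda_gt0 Hq mJ state_limit z1 sE)).
Qed.

Lemma sc_sojourn_limit (Y : {RV Q >-> R}) : sc_limit P Q (sc_sojourn q) Y ->
  lst Q s Y = cintegral Q (fun v => (1 - s / ofR lambda) ^+ Xd v).
Proof.
move=> LY; rewrite (rate_expr lambda_gt0 sE).
have h1 := sc_limit_lst lambda_gt0 Hq z1 sE (measurable_sc_sojourn q)
  (fun k w gw => sc_sojourn_ge0 Hq gw k) LY.
exact: (ccvg_unique h1 (ccvg_sc_sojourn lambda_gt0 Hq mJ state_limit z1 sE)).
Qed.

(** Of the factor [Gt ^ r] that follows [c_coef], one [Gt] is split off. Both terms then share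
    [Gt ^ r.-1], and the inner sum is the row vector after the first service of the batch. *)
Lemma w_transform_expand r : (0 < r)%N ->
  w_transform lambda K Kstar Q Xd Jd r.+1 s =
  \sum_j \sum_k (\sum_i (c_coef lambda Q Xd Jd i s * Gt K s i k +
                         a_coef Q Xd Jd i * Gtstar Kstar s i k)) * (Gt K s ^+ r.-1) k j.
Proof.
case: r => // r _; rewrite /w_transform !subSS !subn0.
under [RHS]eq_bigr do under eq_bigr do rewrite big_split/= mulrDl.
under [RHS]eq_bigr do rewrite big_split/=.
rewrite big_split/= addrC; congr (_ + _).
  rewrite exchange_big/=; apply: eq_bigr => j _; apply: eq_bigr => k _.
  by rewrite mulr_suml.
apply: eq_bigr => j _; under [RHS]eq_bigr do rewrite mulr_suml.
rewrite exchange_big/=; apply: eq_bigr => i _; rewrite exprS mxE mulr_sumr.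
by apply: eq_bigr => k _; rewrite mulrA.
Qed.

(** Used with [r = m - 1] for waiting times and [r = m] for sojourn times. Thus the formula with
    index [m + 1] describes the sojourn of the [m]-th member even if no batch has [m + 1]
    customers. *)
Lemma ccvg_member_vec m r : (0 < r <= m)%N -> (0 < P (batch_ge q 0 m))%E ->
  ccvg (fun n => ofR (fine (P (batch_ge q 0 m)))^-1 *
          \sum_j member_vec q s n m r j)
    (w_transform lambda K Kstar Q Xd Jd r.+1 s).
Proof.
move=> /andP[r0 rm] Pm; rewrite w_transform_expand//.
have p0 : fine (P (batch_ge q 0 m)) != 0.
  rewrite gt_eqF// fine_gt0// Pm/=; apply: le_lt_trans (ltry (1 : R)).
  by apply: probability_le1; exact: measurable_batch_ge.
pose u n i k : R[i] := cint P ([set w | sc_type q n w = i] `&` [set w | 0 <= slack q n w])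
    (fun w => decay s (slack q n w)) * Gt K s i k +
  ofR (fine (P ([set w | sc_type q n w = i] `&` [set w | slack q n w < 0]))) *
    Gtstar Kstar s i k.
have -> : (fun n => ofR (fine (P (batch_ge q 0 m)))^-1 * \sum_j member_vec q s n m r j) =
    (fun n => \sum_j \sum_k (\sum_i u n i k) * (Gt K s ^+ r.-1) k j).
  apply/funext => n; rewrite mulr_sumr; apply: eq_bigr => j _.
  rewrite -[r in LHS](prednK r0) (member_vec_expr lambda_gt0 Hq s0); last by rewrite prednK.
  rewrite mulr_sumr; apply: eq_bigr => k _.
  rewrite (member_vec1 lambda_gt0 Hq s0) ?(leq_trans r0)// (batch_ge_law Hq) !mulrA.
  by rewrite -ofRM mulVf// ofR1 mul1r.
apply: ccvg_sum => j; apply: ccvg_sum => k; apply: ccvgM; last exact: ccvg_cst.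
apply: ccvg_sum => i; apply: ccvgD; (apply: ccvgM; last exact: ccvg_cst).
  exact: (ccvg_busy lambda_gt0 Hq mJ state_limit z1 sE).
exact: (ccvg_idle lambda_gt0 Hq mJ state_limit).
Qed.

Lemma member_waiting_limit m (Y : {RV Q >-> R}) : (1 <= m)%N ->
  (0 < P (batch_ge q 0 m))%E -> member_limit q Q (waiting q) m Y ->
  lst Q s Y = w_transform lambda K Kstar Q Xd Jd m s.
Proof.
move=> m1 Pm LY.
have h1 := member_limit_lst lambda_gt0 Hq z1 sE (measurable_waiting q)
  (fun k w _ => waiting_ge0 q k w) m1 LY.
case: m m1 Pm LY h1 => // -[_ _ _|m _ Pm _] h1; last first.
  have lm : (0 < m.+1 <= m.+2)%N by rewrite leqnSn.
  apply: (ccvg_unique h1); have := ccvg_member_vec lm Pm; congr (ccvg _ _).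
  apply/funext => n; congr (_ * _).
  by rewrite (cint_member_waiting lambda_gt0 Hq s0)//= ltnSn.
(* Case [m = 1]: the condition on the batch size is void, and the first member waits exactly as long
   as its batch. *)
rewrite /= (rate_expr lambda_gt0 sE).
have h2 := ccvg_sc_waiting lambda_gt0 Hq mJ state_limit z1 sE.
apply: (ccvg_unique h1); move: h2; congr (ccvg _ _); apply/funext => n.
rewrite !(batch_ge_full Hq)// probability_setT invr1 ofR1 mul1r.
congr (cint P _ _); apply/funext => w.
by rewrite /member addn0 /waiting (arrival_first Hq).
Qed.

Lemma member_sojourn_limit m (Y : {RV Q >-> R}) : (1 <= m)%N ->
  (0 < P (batch_ge q 0 m))%E -> member_limit q Q (sojourn q) m Y ->
  lst Q s Y = w_transform lambda K Kstar Q Xd Jd m.+1 s.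
Proof.
move=> m1 Pm LY.
have h1 := member_limit_lst lambda_gt0 Hq z1 sE (measurable_sojourn q)
  (fun k w gw => sojourn_ge0 k gw) m1 LY.
case: m m1 Pm LY h1 => // m _ Pm _ h1.
have lm : (0 < m.+1 <= m.+1)%N by rewrite leqnn.
apply: (ccvg_unique h1); have := ccvg_member_vec lm Pm; congr (ccvg _ _).
apply/funext => n; congr (_ * _).
by rewrite (cint_member_sojourn Hq s0).
Qed.

End SuperCustomersAndMembers.

(** * The arbitrary customer *)

Section BatchSizes.
Context (R : realType) (N : nat) (lambda : R).
Context (K Kstar : 'I_N -> 'I_N -> {measure set R -> \bar R}).
Context d (T : measurableType d) (P : probability T R) (q : queue P N).
Hypothesis Hq : MXSM2_queue q lambda K Kstar.
Local Notation B := (batch_size q).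
Let Pf : (P setT < +oo)%E := Pfin P.

Let Rintegral_cstT (c : R) : \int[P]_w c = c.
Proof. by rewrite Rintegral_cst// -[X in c * X]/(fine (P setT)) probability_setT mulr1. Qed.

Definition tail_prob m : R := fine (P (batch_ge q 0 m)).

(** The tail-sum formula for the mean of [min B c]; see [size_min_mean]. *)
Definition truncated_mean c : R := \sum_(0 <= m < c) tail_prob m.+1.

Lemma measurable_size_fun (g : nat -> R) l : measurable_fun setT (fun w => g (B l w)).
Proof. exact: measurable_nat_comp. Qed.

Lemma size_integral (g : nat -> R) l : (forall x, 0 <= g x) ->
  (\int[P]_w (g (B l w))%:E = \int[P]_w (g (B 0%N w))%:E)%E.
Proof.
move=> g0; have mB k : measurable_fun setT (B k) by [].
have mg : measurable_fun setT (fun x => (g x)%:E) by [].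
have h k : (\int[P]_w (g (B k w))%:E = \int[pushforward P (B k)]_x (g x)%:E)%E.
  by rewrite ge0_integral_pushforward// => x _; rewrite lee_fin.
rewrite !h; apply: eq_measure_integral => X mX _; exact: (size_law Hq l X).
Qed.

Lemma integrable_size (g : nat -> R) l : (forall x, 0 <= g x <= x%:R) ->
  P.-integrable setT (fun w => (g (B l w))%:E).
Proof.
move=> g0; have gg x : 0 <= g x by have /andP[] := g0 x.
apply/integrableP; split; first by apply/measurable_EFinP; exact: measurable_size_fun.
under eq_integral do rewrite gee0_abs ?lee_fin//.
rewrite size_integral//; apply: le_lt_trans (mean_batch_fin Hq).
rewrite /mean_batch unlock; apply: ge0_le_integral => //.
- by move=> w _; rewrite lee_fin.
- by apply/measurable_EFinP; exact: measurable_size_fun.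
- by apply/measurable_EFinP; exact: (measurable_size_fun (fun x => x%:R)).
- by move=> w _; rewrite lee_fin; have /andP[] := g0 (B 0%N w).
Qed.

Lemma size_Rintegral (g : nat -> R) l : (forall x, 0 <= g x) ->
  \int[P]_w g (B l w) = \int[P]_w g (B 0%N w).
Proof. by move=> g0; congr fine; exact: size_integral. Qed.

Definition excess c x : R := (x - c)%N%:R.

Lemma excess_bound c x : 0 <= excess c x <= x%:R.
Proof. by rewrite /excess ler0n ler_nat leq_subr. Qed.

Definition mean_excess c : R := \int[P]_w excess c (B 0%N w).

Lemma indicator_batch_ge l m w : \1_(batch_ge q l m) w = (m <= B l w)%N%:R :> R.
Proof. by rewrite indicE; congr (_%:R); congr nat_of_bool; exact: in_set_bool. Qed.

Lemma minn_sum c x : (minn x c)%:R = \sum_(0 <= m < c) (m.+1 <= x)%N%:R :> R.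
Proof.
elim: c => [|c IH]; first by rewrite big_nil minn0.
rewrite big_nat_recr//= -IH -natrD; congr (_%:R); lia.
Qed.

Lemma size_min_mean c l : \int[P]_w (minn (B l w) c)%:R = truncated_mean c.
Proof.
transitivity (\int[P]_w \sum_(0 <= m < c) (\1_(batch_ge q l m.+1) w : R)).
  by apply: eq_Rintegral => w _; rewrite minn_sum; apply: eq_bigr => m _;
    rewrite indicator_batch_ge.
rewrite (bRintegral_sum Pf)//; last first.
  by move=> m; apply: bmfun_indic; exact: measurable_batch_ge.
apply: eq_bigr => m _; rewrite Rintegral_indicE//; last exact: measurable_batch_ge.
by rewrite setTI /tail_prob; congr fine; exact: (batch_ge_law Hq).
Qed.

Lemma mean_split c : fine (mean_batch q) = truncated_mean c + mean_excess c.
Proof.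
rewrite -(size_min_mean c 0) /mean_excess -RintegralD//.
- rewrite /mean_batch unlock; congr fine; apply: eq_integral => w _.
  by congr EFin; rewrite -natrD; congr (_%:R); lia.
- have h := @integrable_size (fun x => (minn x c)%:R) 0.
  by apply: h => x; rewrite ler0n ler_nat geq_minl.
- exact: (integrable_size 0 (excess_bound c)).
Qed.

Lemma mean_excess_cvg0 : mean_excess c @[c --> \oo] --> (0 : R).
Proof.
rewrite -[X in _ --> X]/(fine 0%E); apply: fine_cvg; rewrite fineK//.
have mf c : measurable_fun setT (fun w => (excess c (B 0%N w))%:E).
  by apply/measurable_EFinP; exact: (measurable_size_fun (excess c)).
have fcv : {ae P, forall w, setT w ->
    (fun c => (excess c (B 0%N w))%:E) @ \oo --> cst 0%E w}.
  apply: aeW => w _; apply: cvg_near_cst; exists (B 0%N w) => // c /= Bc.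
  by rewrite /excess (eqP Bc).
have ib : P.-integrable setT (fun w => (B 0%N w)%:R%:E).
  have h := @integrable_size (fun x => x%:R) 0.
  by apply: h => x; rewrite ler0n lexx.
have fle : {ae P, forall w c, setT w ->
    (`|(excess c (B 0%N w))%:E| <= (B 0%N w)%:R%:E)%E}.
  apply: aeW => w c _; have /andP[e0 e1] := excess_bound c (B 0%N w).
  by rewrite gee0_abs lee_fin.
have [_ _] := dominated_convergence measurableT mf (measurable_cst _) fcv ib fle.
by rewrite integral0.
Qed.

Lemma size_uncorrelated (h : nat -> R) l l' : l != l' -> bmfun h ->
  \int[P]_w h (B 0%N w) = 0 -> \int[P]_w (h (B l w) * h (B l' w)) = 0.
Proof.
move=> ll' bh h0; have mB k : measurable_fun setT (B k) by [].
pose nu := law measurableT Pf (mB l').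
have nuf : (nu setT < +oo)%E by rewrite ltey_eq fin_num_measure.
pose c : {nonneg R} := NngNum (@ler01 R).
have pl X Y : measurable X -> measurable Y ->
    P (setT `&` B l @^-1` X `&` B l' @^-1` Y) =
    (P (setT `&` B l @^-1` X) * (c%:num%:E * nu Y))%E.
  move=> mX mY; rewrite mul1e /nu /law !setTI.
  pose Ef (x : nat + nat + unit) : set T :=
    if x is inl (inr k) then (if k == l then B l @^-1` X else B l' @^-1` Y) else setT.
  have us : uniq [:: inl (inr l); inl (inr l') : nat + nat + unit].
    by rewrite /= inE andbT; apply/eqP => -[] /eqP; exact/negP.
  have E1 : Ef (inl (inr l)) = B l @^-1` X by rewrite /Ef eqxx.
  have E2 : Ef (inl (inr l')) = B l' @^-1` Y by rewrite /Ef eq_sym (negbTE ll').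
  have sE x : x \in [:: inl (inr l); inl (inr l')] -> input_events q x (Ef x).
    rewrite !inE => /orP[] /eqP ->; rewrite ?E1 ?E2.
      by exists X => //; rewrite setTI.
    by exists Y => //; rewrite setTI.
  have := input_product Hq us sE; rewrite !big_cons big_nil mule1 E1 E2 => <-.
  congr (P _); apply/seteqP; split => w /=.
    by move=> [h1 h2] x /=; rewrite !inE => /orP[] /eqP ->; rewrite ?E1 ?E2.
  move=> h1; split.
    by have := h1 (inl (inr l)); rewrite E1; apply; rewrite /= inE eqxx.
  by have := h1 (inl (inr l')); rewrite E2; apply; rewrite /= !inE eqxx orbT.
have := Rproduct_law Pf nuf measurableT measurableT (mB l) (mB l') pl bh bh.
rewrite Rintegral_law// mul1r => ->.
have [C hC] := bh.2.
(* [h] changes sign, while the equality in law of the sizes is used for nonnegative functions; hence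
   the shift by the bound [C]. *)
have hl : \int[P]_w h (B l w) = 0.
  have e k : \int[P]_w (h (B k w) + C) = \int[P]_w h (B k w) + C.
    rewrite (bRintegralD Pf)//; last 2 first.
    - exact: (bmfun_comp bh).
    - exact: bmfun_cst.
    by rewrite Rintegral_cstT.
  apply: (@addIr _ C); rewrite -e (@size_Rintegral (fun x => h x + C) l); last first.
    by move=> x; move: (hC x); rewrite ler_norml => /andP[h1 _]; lra.
  by rewrite e h0.
by rewrite hl mul0r.
Qed.

Definition truncated_first c n w : R := \sum_(0 <= l < n) (minn (B l w) c)%:R.

Lemma bmfun_min c l : bmfun (fun w => (minn (B l w) c)%:R : R).
Proof.
split; first exact: (measurable_size_fun (fun x => (minn x c)%:R)).
by exists c%:R => w; rewrite ger0_norm ?ler0n// ler_nat geq_minr.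
Qed.

Lemma tail_prob_le1 m : 0 <= tail_prob m <= 1.
Proof.
rewrite /tail_prob fine_ge0//= -lee_fin fineK ?(mu_fin Pf)//; last exact: measurable_batch_ge.
by apply: probability_le1; exact: measurable_batch_ge.
Qed.

Lemma truncated_mean_bound c : 0 <= truncated_mean c <= c%:R.
Proof.
rewrite sumr_ge0/=; last by move=> m _; case/andP: (tail_prob_le1 m.+1).
apply: (@le_trans _ _ (\sum_(0 <= m < c) 1)).
  by apply: ler_sum => m _; case/andP: (tail_prob_le1 m.+1).
by rewrite big_const_nat subn0 iter_addr_0.
Qed.

(** Only the mean of [B] is known to be finite, and truncation at [c] supplies a second moment.
    Distinct batches are uncorrelated, which leaves [n] diagonal terms of size at most [c ^ 2]. *)
Lemma truncated_first_variance c n :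
  \int[P]_w (truncated_first c n w - n%:R * truncated_mean c) ^+ 2 <= n%:R * c%:R ^+ 2.
Proof.
pose h x : R := (minn x c)%:R - truncated_mean c.
have hc x : `|h x| <= c%:R.
  have /andP[m0 mc] := truncated_mean_bound c.
  have x0 : (0 : R) <= (minn x c)%:R by exact: ler0n.
  have xc : (minn x c)%:R <= c%:R :> R by rewrite ler_nat geq_minr.
  by rewrite ler_norml /h; apply/andP; split; lra.
have bh : bmfun h by split => //; exists c%:R.
have bhB l : bmfun (fun w => h (B l w)) by exact: (bmfun_comp bh).
have h0 : \int[P]_w h (B 0%N w) = 0.
  rewrite (bRintegralB Pf)//; [|exact: bmfun_min|exact: bmfun_cst].
  rewrite size_min_mean Rintegral_cstT.
  by rewrite subrr.
have e w : (truncated_first c n w - n%:R * truncated_mean c) ^+ 2 =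
    \sum_(0 <= l < n) \sum_(0 <= l' < n) h (B l w) * h (B l' w).
  rewrite expr2; have -> : truncated_first c n w - n%:R * truncated_mean c =
      \sum_(0 <= l < n) h (B l w).
    by rewrite big_split/= sumrN big_const_nat subn0 iter_addr_0 mulr_natl.
  by rewrite mulr_suml; apply: eq_bigr => l _; rewrite mulr_sumr.
under eq_Rintegral do rewrite e.
have b2 l l' : bmfun (fun w => h (B l w) * h (B l' w)) by exact: bmfunM.
rewrite (bRintegral_sum Pf)//; last by move=> l; exact: bmfun_sum.
rewrite mulr_natl -[n in _ *+ n]subn0 -sumr_const_nat; apply: ler_sum_nat => l /= ln.
rewrite (bRintegral_sum Pf)// (bigD1_seq l) ?mem_index_iota ?iota_uniq//=.
rewrite big1 ?addr0; last by move=> l' l'l; apply: size_uncorrelated; rewrite // eq_sym.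
apply: (le_trans (ler_norm _)).
have hle w : `|h (B l w) * h (B l w)| <= c%:R ^+ 2.
  by rewrite normrM expr2 ler_pM.
apply: (le_trans (le_norm_bRintegral Pf measurableT (b2 l l) (fun w _ => hle w))).
by rewrite -[fine _]/(fine (P setT)) probability_setT mulr1.
Qed.

(** From [|x| <= t + x^2 / t] with [t = e n] and the variance bound. After division by [n] the
    second term vanishes in the limit and the first is the arbitrary [e]. *)
Lemma truncated_first_deviation c n (e : R) : (0 < n)%N -> 0 < e ->
  \int[P]_w `|truncated_first c n w - n%:R * truncated_mean c| <=
  e * n%:R + c%:R ^+ 2 / e.
Proof.
move=> n0 e0; have n0' : (0 : R) < n%:R by rewrite ltr0n.
pose X w := truncated_first c n w - n%:R * truncated_mean c.
have bX : bmfun X.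
  apply: bmfunB; last exact: bmfun_cst.
  by apply: bmfun_sum => l; exact: bmfun_min.
have bX2 : bmfun (fun w => (e * n%:R)^-1 * X w ^+ 2).
  by apply: bmfunM; [exact: bmfun_cst|apply: bmfunM].
have en : 0 < e * n%:R by exact: mulr_gt0.
apply: (@le_trans _ _ (\int[P]_w (e * n%:R + (e * n%:R)^-1 * X w ^+ 2))).
  apply: (le_bRintegral Pf) => //.
  - exact: bmfun_norm.
  - by apply: bmfunD => //; exact: bmfun_cst.
  move=> w _; rewrite -[X in X <= _]/(`|X w|).
  rewrite -(ler_pM2l en) mulrDr mulVKf ?gt_eqF// -real_normK ?num_real//.
  rewrite -subr_ge0; have := sqr_ge0 (e * n%:R - `|X w|).
  have : 0 <= e * n%:R * `|X w| by rewrite mulr_ge0// ltW.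
  nra.
rewrite (bRintegralD Pf)//; last exact: bmfun_cst.
rewrite Rintegral_cstT lerD2l.
rewrite (bRintegralZl Pf)//; last exact: bmfunM.
rewrite ler_pdivrMl//; apply: (le_trans (truncated_first_variance c n)).
by rewrite le_eqVlt; apply/orP; left; apply/eqP; field; rewrite gt_eqF.
Qed.

Lemma r_weightE m : r_weight q m = (fine (mean_batch q))^-1 * tail_prob m.
Proof.
rewrite /r_weight /tail_prob; congr (_ * fine _).
pose F k : set T := if (m <= k)%N then [set w | B 0%N w = k] else set0.
have mF k : measurable (F k).
  by rewrite /F; case: ifP => // _; exact: measurable_fiber.
have tF : trivIset setT F.
  by move=> i j _ _ [w []]; rewrite /F; case: ifP => // _ /= <-; case: ifP => // _ /= <-.
have FE : batch_ge q 0 m = \bigcup_k F k.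
  apply/seteqP; split => w /=.
    by move=> mB; exists (B 0%N w) => //; rewrite /F mB.
  by move=> [k _]; rewrite /F; case: ifP => // mk /= Bk; rewrite /batch_ge/= Bk.
have := measure_semi_sigma_additive F mF tF (bigcupT_measurable _ mF).
rewrite -FE => /(_ _ P) h; rewrite -(cvg_lim _ h)//; congr (limn _); apply/funext => n.
rewrite big_geq_mkord big_mkord [RHS]big_mkcond/= big_mkcond/=; apply: eq_bigr => k _.
by rewrite /F/=; case: ifP => // _; rewrite measure0.
Qed.

End BatchSizes.

(** * Sums over customers compared with sums over batches, path by path *)

Section BlockSums.
Context (R : realType) (a : nat -> R) (b : nat -> nat).
Hypothesis a1 : forall k, `|a k| <= 1.

Let bf n : nat := (\sum_(0 <= l < n) b l)%N.

Lemma block_sum n : \sum_(0 <= k < bf n) a k =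
  \sum_(0 <= l < n) \sum_(0 <= r < b l) a (bf l + r)%N.
Proof.
elim: n => [|n IH]; first by rewrite /bf !big_nil.
have bS : bf n.+1 = (bf n + b n)%N by rewrite /bf big_nat_recr.
rewrite big_nat_recr//= -IH bS (@big_cat_nat _ _ _ (bf n))//= ?leq_addr//; congr (_ + _).
rewrite -{1}[bf n]add0n big_addn addKn; apply: eq_bigr => r _; by rewrite addnC.
Qed.

Lemma dist_partial_sums (f : nat -> R) x y : (forall k, `|f k| <= 1) ->
  `|\sum_(0 <= k < x) f k - \sum_(0 <= k < y) f k| <= `|x%:R - y%:R|.
Proof.
move=> f1; wlog xy : x y / (y <= x)%N => [hw|].
  have [h|/ltnW h] := leqP y x; first exact: hw.
  by rewrite distrC [leRHS]distrC; exact: hw.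
rewrite (@big_cat_nat _ _ _ y)//= addrAC subrr add0r -natrB// normr_nat.
apply: (le_trans (ler_norm_sum _ _ _)).
apply: (le_trans (ler_sum _ (fun k _ => f1 k))).
by rewrite big_const_nat iter_addr_0.
Qed.

Lemma truncated_block (f : nat -> R) x c : (forall k, `|f k| <= 1) ->
  `|\sum_(0 <= r < x) f r - \sum_(0 <= r < c) (r < x)%N%:R * f r| <= (x - c)%N%:R.
Proof.
move=> f1; have -> : \sum_(0 <= r < c) (r < x)%N%:R * f r = \sum_(0 <= r < minn x c) f r.
  elim: c => [|c IH]; first by rewrite minn0 !big_nil.
  rewrite big_nat_recr//= IH; case: ltnP => cx.
    by rewrite (minn_idPr cx) big_nat_recr//= mul1r.
  by rewrite mul0r addr0 (minn_idPl (leqW cx)).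
apply: (le_trans (dist_partial_sums _ _ f1)).
by rewrite -natrB ?geq_minl// normr_nat ler_nat; lia.
Qed.

(* Both sides differ from the sum over the customers of the first [n] batches
   by at most the total excess of the batches, up to the fluctuations of the
   number of customers. *)
Lemma dist_truncated_sum n c M :
  `|\sum_(0 <= l < n) \sum_(0 <= r < c) (r < b l)%N%:R * a (bf l + r)%N -
    \sum_(0 <= k < M) a k| <=
  2 * \sum_(0 <= l < n) (b l - c)%N%:R +
  `|\sum_(0 <= l < n) (minn (b l) c)%:R - M%:R|.
Proof.
set G := \sum_(0 <= l < n) \sum_(0 <= r < c) _; set X := \sum_(0 <= l < n) (minn _ _)%:R.
set D := \sum_(0 <= l < n) (b l - c)%N%:R.
have h1 : `|\sum_(0 <= k < bf n) a k - G| <= D.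
  rewrite block_sum /G -sumrB; apply: (le_trans (ler_norm_sum _ _ _)).
  by apply: ler_sum => l _; apply: truncated_block.
have h2 := dist_partial_sums (bf n) M a1.
have h3 : (bf n)%:R = X + D.
  by rewrite /bf natr_sum -big_split/=; apply: eq_bigr => l _; rewrite -natrD; congr (_%:R); lia.
have h4 : `|(bf n)%:R - M%:R| <= D + `|X - M%:R|.
  have D0 : 0 <= D by apply: sumr_ge0.
  by rewrite h3 addrAC addrC (le_trans (ler_normD _ _))// ger0_norm.
rewrite (_ : G - _ = (\sum_(0 <= k < bf n) a k - \sum_(0 <= k < M) a k) -
  (\sum_(0 <= k < bf n) a k - G)); last by ring.
apply: (le_trans (ler_normB _ _)); lra.
Qed.

End BlockSums.

Section ArbitraryCustomer.
Context (R : realType) (N : nat) (lambda : R).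
Context (K Kstar : 'I_N -> 'I_N -> {measure set R -> \bar R}).
Context d (T : measurableType d) (P : probability T R) (q : queue P N).
Hypothesis Hq : MXSM2_queue q lambda K Kstar.
Local Notation B := (batch_size q).
Let Pf : (P setT < +oo)%E := Pfin P.

Variables (F : nat -> T -> R).
Hypotheses (mF : forall k, measurable_fun setT (F k)) (F1 : forall k w, `|F k w| <= 1).

Let bF k : bmfun (F k). Proof. by split; [exact: mF|exists 1]. Qed.

Let Fm l m w := F (member q l m w) w.

Let bFm l m : bmfun (Fm l m).
Proof.
split; last by exists 1 => w; exact: F1.
by apply: (measurable_random_index mF); exact: measurable_member.
Qed.

Let G c n w := \sum_(0 <= l < n) \sum_(0 <= r < c) (r < B l w)%N%:R * F (first q l w + r)%N w.

Let GE c n w : G c n w =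
  \sum_(0 <= l < n) \sum_(0 <= r < c) \1_(batch_ge q l r.+1) w * Fm l r.+1 w.
Proof.
apply: eq_bigr => l _; apply: eq_bigr => r _; by rewrite indicator_batch_ge.
Qed.

Let bG1 l r : bmfun (fun w => \1_(batch_ge q l r.+1) w * Fm l r.+1 w).
Proof. by apply: bmfunM => //; apply: bmfun_indic; exact: measurable_batch_ge. Qed.

Let bG c n : bmfun (G c n).
Proof.
rewrite (funext (GE c n)); apply: bmfun_sum => l; apply: bmfun_sum => r; exact: bG1.
Qed.

Let intG c n : \int[P]_w G c n w =
  \sum_(0 <= l < n) \sum_(0 <= r < c) \int[P]_(w in batch_ge q l r.+1) Fm l r.+1 w.
Proof.
under eq_Rintegral do rewrite GE.
rewrite (bRintegral_sum Pf)//; last by move=> l; apply: bmfun_sum => r; exact: bG1.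
apply: eq_bigr => l _; rewrite (bRintegral_sum Pf)//; apply: eq_bigr => r _.
by rewrite -Rintegral_setI_indic ?setTI//; exact: measurable_batch_ge.
Qed.

(** A deterministic substitute for the truncated number of customers in the first [n] batches: the
    limit for an arbitrary customer concerns sums up to deterministic indices. *)
Let M c n : nat := Num.truncn (n%:R * truncated_mean q c).

Let M_bound c n : (M c n)%:R <= n%:R * truncated_mean q c < (M c n)%:R + 1.
Proof.
have m0 : 0 <= n%:R * truncated_mean q c.
  by rewrite mulr_ge0//; case/andP: (truncated_mean_bound q c).
by have := truncn_itv m0; rewrite -/(M c n) -natr1.
Qed.

Let total_excess c n :
  P.-integrable setT (fun w => (\sum_(0 <= l < n) excess R c (B l w))%:E) /\
  \int[P]_w (\sum_(0 <= l < n) excess R c (B l w)) = n%:R * mean_excess q c.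
Proof.
elim: n => [|n [i1 IH]].
  under eq_fun do rewrite big_nil; under eq_Rintegral do rewrite big_nil.
  by rewrite mul0r Rintegral_cst// mul0r; split => //; exact: integrable0.
have i2 := integrable_size Hq n (excess_bound R c).
under eq_fun do rewrite big_nat_recr//= EFinD.
under eq_Rintegral do rewrite big_nat_recr//=.
split; first exact: integrableD.
rewrite RintegralD// IH (size_Rintegral Hq n (g := excess R c)); last first.
  by move=> x; case/andP: (excess_bound R c x).
by rewrite -natr1 mulrDl mul1r.
Qed.

(** The first term is the integrated excess from [dist_truncated_sum], the second the mean deviation
    of the truncated number of customers, and 1 pays for the rounding in [M]. *)
Let dist_bound c n (e : R) : (0 < n)%N -> 0 < e ->
  `|\int[P]_w G c n w - \sum_(0 <= k < M c n) \int[P]_w F k w| <=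
  n%:R * (2 * mean_excess q c) + (e * n%:R + c%:R ^+ 2 / e) + 1.
Proof.
move=> n0 e0; rewrite -(bRintegral_sum Pf)// -(bRintegralB Pf)//; last exact: bmfun_sum.
have bd : bmfun (fun w => G c n w - \sum_(0 <= k < M c n) F k w).
  by apply: bmfunB => //; exact: bmfun_sum.
apply: (le_trans (le_normr_Rintegral measurableT (bmfun_integrable Pf measurableT bd))).
pose X w := truncated_first q c n w - n%:R * truncated_mean q c.
have bX : bmfun X.
  apply: bmfunB; last exact: bmfun_cst.
  by apply: bmfun_sum => l; exact: bmfun_min.
have [iD intD] := total_excess c n.
pose D w := \sum_(0 <= l < n) excess R c (B l w); rewrite -/D in iD intD.
have b1 : bmfun (fun w => `|X w| + 1) by apply: bmfunD; [exact: bmfun_norm|exact: bmfun_cst].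
have i1 := bmfun_integrable Pf measurableT b1.
have i2 : P.-integrable setT (fun w => (2 * D w)%:E).
  by under eq_fun do rewrite EFinM; exact: integrableZl.
apply: (@le_trans _ _ (\int[P]_w (2 * D w + (`|X w| + 1)))).
  apply: le_Rintegral => //.
  - exact: (bmfun_integrable Pf measurableT (bmfun_norm bd)).
  - rewrite (_ : EFin \o _ = (fun w => (2 * D w)%:E + (`|X w| + 1)%:E)%E) //.
    exact: integrableD.
  move=> w _; have := dist_truncated_sum (a := F ^~ w) (fun l => B l w) (F1 ^~ w) n c (M c n).
  move=> h; apply: (le_trans h); rewrite lerD2l -/(truncated_first q c n w).
  have /andP[m1 m2] := M_bound c n.
  have -> : truncated_first q c n w - (M c n)%:R = X w + (n%:R * truncated_mean q c - (M c n)%:R).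
    by rewrite /X; ring.
  apply: (le_trans (ler_normD _ _)); rewrite lerD2l ger0_norm ?subr_ge0//; lra.
rewrite RintegralD// RintegralZl// intD (bRintegralD Pf)//; last 2 first.
- exact: bmfun_norm.
- exact: bmfun_cst.
rewrite Rintegral_cst// -[X in 1 * X]/(fine (P setT)) probability_setT mulr1.
have := truncated_first_deviation Hq c n0 e0; rewrite -/X; lra.
Qed.

(** [A] is the limit mean over an arbitrary customer. [t r] belongs to the member of rank [r + 1]
    and is not normalised: it includes the probability that this member exists. *)
Variables (A : R) (t : nat -> R).
Hypothesis cvg_arbitrary :
  n%:R^-1 * \sum_(0 <= k < n) \int[P]_w F k w @[n --> \oo] --> A.
Hypothesis cvg_member : forall r,
  \int[P]_(w in batch_ge q n r.+1) F (member q n r.+1 w) w @[n --> \oo] --> t r.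

Let cvg_blocks c : n%:R^-1 * \int[P]_w G c n w @[n --> \oo] --> \sum_(0 <= r < c) t r.
Proof.
rewrite -(cvg_shiftS (fun n => n%:R^-1 * \int[P]_w G c n w)).
pose u l := \sum_(0 <= r < c) \int[P]_(w in batch_ge q l r.+1) Fm l r.+1 w.
have hu : u l @[l --> \oo] --> \sum_(0 <= r < c) t r.
  by apply: cvg_sum_seq => r; exact: cvg_member.
rewrite (_ : [sequence _]_n = arithmetic_mean u); first exact: cesaro.
by apply/funext => n; rewrite /= intG.
Qed.

Let cvg_count c : n%:R^-1 * (M c n)%:R @[n --> \oo] --> truncated_mean q c.
Proof.
have h0 : truncated_mean q c - n%:R^-1 @[n --> \oo] --> truncated_mean q c.
  rewrite -[X in _ --> X]subr0; apply: cvgB; first exact: cvg_cst.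
  by rewrite -(cvg_shiftS (fun n => n%:R^-1 : R)); exact: cvg_harmonic.
apply: (squeeze_cvgr _ h0 (cvg_cst _)); near=> n.
have n0 : (0 : R) < n%:R by rewrite ltr0n; near: n; exact: nbhs_infty_gt.
have /andP[m1 m2] := M_bound c n.
rewrite ler_pdivrMl// m1 andbT -(ler_pM2l n0) mulrBr mulfV ?gt_eqF// mulrA mulfV ?gt_eqF// mul1r.
by rewrite lerBlDr ltW.
Unshelve. all: by end_near. Qed.

Let cvg_M c : (0 < truncated_mean q c) -> M c n @[n --> \oo] --> \oo.
Proof.
move=> m0; apply/cvgnyPge => m; near=> n.
have /andP[m1 m2] := M_bound c n.
have : (m%:R : R) < (M c n).+1%:R.
  rewrite -natr1; apply: le_lt_trans m2.
  rewrite -ler_pdivrMr//; near: n; exact: nbhs_infty_ger.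
by rewrite ltr_nat.
Unshelve. all: by end_near. Qed.

(** The averages over customers are taken along [M c n], which tends to infinity, and rescaled by
    the limit of [M c n / n]. *)
Let cvg_customers c : 0 < truncated_mean q c ->
  n%:R^-1 * \sum_(0 <= k < M c n) \int[P]_w F k w @[n --> \oo] --> truncated_mean q c * A.
Proof.
move=> m0; have h1 := cvg_comp _ _ (cvg_M m0) cvg_arbitrary.
have h2 : (n%:R^-1 * (M c n)%:R) * ((M c n)%:R^-1 * \sum_(0 <= k < M c n) \int[P]_w F k w)
    @[n --> \oo] --> truncated_mean q c * A.
  by apply: cvgM; [exact: cvg_count|exact: h1].
apply: cvg_trans h2; apply: near_eq_cvg; near=> n.
have Mn0 : ((M c n)%:R : R) != 0.
  rewrite pnatr_eq0 -lt0n; near: n; have /cvgnyPgt/(_ 0%N) := cvg_M m0; exact.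
by rewrite mulrA -[X in X * _]mulrA mulfV// mulr1.
Unshelve. all: by end_near. Qed.

(** Order of the limits: [n] goes to infinity with [c] and [e] fixed, which removes [c ^ 2 / e] and
    the rounding; then [e] goes to 0. *)
Lemma member_sum_bound c : 0 < truncated_mean q c ->
  `|\sum_(0 <= r < c) t r - truncated_mean q c * A| <= 2 * mean_excess q c.
Proof.
move=> m0; apply/ler_addgt0Pr => e e0.
have h1 : `|n%:R^-1 * \int[P]_w G c n w -
      n%:R^-1 * \sum_(0 <= k < M c n) \int[P]_w F k w| @[n --> \oo] -->
    `|\sum_(0 <= r < c) t r - truncated_mean q c * A|.
  by apply: cvg_norm; apply: cvgB; [exact: cvg_blocks|exact: cvg_customers].
pose rhs n : R := 2 * mean_excess q c + e + (c%:R ^+ 2 / e + 1) * n%:R^-1.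
have h2 : rhs n @[n --> \oo] --> 2 * mean_excess q c + e.
  rewrite -[X in _ --> X]addr0; apply: cvgD; first exact: cvg_cst.
  rewrite -[X in _ --> X](mulr0 (c%:R ^+ 2 / e + 1)); apply: cvgM; first exact: cvg_cst.
  by rewrite -(cvg_shiftS (fun n => n%:R^-1 : R)); exact: cvg_harmonic.
apply: (ler_cvg_to h1 h2); near=> n.
have n0 : (0 < n)%N by near: n; exact: nbhs_infty_gt.
have n0' : (0 : R) < n%:R by rewrite ltr0n.
rewrite /= -mulrBr normrM ger0_norm ?invr_ge0 ?ler0n// ler_pdivrMl//.
apply: (le_trans (dist_bound c n0 e0)); rewrite /rhs !mulrDr.
rewrite [X in _ <= _ + X]mulrCA mulfV ?gt_eqF// mulr1 -!addrA lerD2l [n%:R * e]mulrC.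
by rewrite addrA.
Unshelve. all: by end_near. Qed.

Lemma cvg_member_sum : \sum_(0 <= r < c) t r @[c --> \oo] --> fine (mean_batch q) * A.
Proof.
have cm : truncated_mean q c @[c --> \oo] --> fine (mean_batch q).
  rewrite (_ : (fun c => _) = (fun c => fine (mean_batch q) - mean_excess q c)).
    rewrite -[X in _ --> X]subr0; apply: cvgB; first exact: cvg_cst.
    exact: (mean_excess_cvg0 Hq).
  by apply/funext => c; rewrite (mean_split Hq c) addrK.
have c1 : (\sum_(0 <= r < c) t r - truncated_mean q c * A) @[c --> \oo] --> (0 : R).
  have hz : 2 * mean_excess q c @[c --> \oo] --> (0 : R).
    rewrite -[X in _ --> X](mulr0 2); apply: cvgM; first exact: cvg_cst.
    exact: (mean_excess_cvg0 Hq).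
  apply/norm_cvg0P; apply: (squeeze_cvgr _ (cvg_cst 0) hz); near=> c.
  rewrite normr_ge0/=; apply: member_sum_bound.
  (* Batches are nonempty: the first summand is 1, so the truncated mean is positive as soon as
     [c >= 1]. *)
  near: c; exists 1%N => // c /= c1.
  rewrite /truncated_mean; case: c c1 => // c _; rewrite big_nat_recl//=.
  rewrite ltr_wpDr//; first by apply: sumr_ge0 => m _; case/andP: (tail_prob_le1 q m.+2).
  by rewrite /tail_prob (batch_ge_full Hq)// probability_setT.
have : (\sum_(0 <= r < c) t r - truncated_mean q c * A) + truncated_mean q c * A
    @[c --> \oo] --> 0 + fine (mean_batch q) * A.
  by apply: cvgD => //; apply: cvgM => //; exact: cvg_cst.
by rewrite add0r; under eq_fun do rewrite subrK.
Unshelve. all: by end_near. Qed.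

End ArbitraryCustomer.

Lemma ccvg_complex_cvg (R : realType) (u : nat -> R[i]) (l : R[i]) : ccvg u l ->
  (u n : R[i]^o) @[n --> \oo] --> (l : R[i]^o).
Proof.
move=> [h1 h2]; apply/cvgrPdist_lt => e e0.
have [eIm eRe] : complex.Im e = 0 /\ 0 < complex.Re e.
  by move: e0; rewrite ltcE/= => /andP[/eqP -> ->].
have e2 : 0 < complex.Re e / 2 by exact: divr_gt0.
near=> n.
have d1 : `|complex.Re l - complex.Re (u n)| < complex.Re e / 2.
  by near: n; move/cvgrPdist_lt : h1; exact.
have d2 : `|complex.Im l - complex.Im (u n)| < complex.Re e / 2.
  by near: n; move/cvgrPdist_lt : h2; exact.
rewrite -[X in X < _]/(`|l - u n|) normc_def ltcE/= eIm eqxx/=.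
rewrite cReB cImB; set a := complex.Re l - _ in d1 *; set b := complex.Im l - _ in d2 *.
have ab : 0 <= `|a| * `|b| by exact: mulr_ge0.
have h : a ^+ 2 + b ^+ 2 <= (`|a| + `|b|) ^+ 2.
  rewrite -(real_normK (num_real a)) -(real_normK (num_real b)); nra.
apply: (le_lt_trans (ler_wsqrtr h)); rewrite sqrtr_sqr ger0_norm ?addr_ge0//; lra.
Unshelve. all: by end_near. Qed.

Section ArbitraryLimit.
Context (R : realType) (N : nat) (lambda : R).
Context (K Kstar : 'I_N -> 'I_N -> {measure set R -> \bar R}).
Context d (T : measurableType d) (P : probability T R) (q : queue P N).
Context d' (T' : measurableType d') (Q : probability T' R).
Hypothesis lambda_gt0 : 0 < lambda.
Hypothesis Hq : MXSM2_queue q lambda K Kstar.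
Variables (z s : R[i]) (z1 : `|z| <= 1) (sE : s = ofR lambda * (1 - z)).
Local Notation B := (batch_size q).
Local Notation Re := complex.Re.
Local Notation Im := complex.Im.
Let Pf : (P setT < +oo)%E := Pfin P.
Let mg := measurable_good q.
Let g0 := good_full lambda_gt0 Hq.

Let s0 : 0 <= Re s. Proof. by rewrite sE; exact: Re_rate_ge0. Qed.

Variables (V : nat -> T -> R) (Y : {RV Q >-> R}) (Ym : nat -> {RV Q >-> R}).
Hypotheses (mV : forall k, measurable_fun setT (V k)).
Hypotheses (V0 : forall k w, good q w -> 0 <= V k w).
Hypothesis LY : arbitrary_limit P Q V Y.
Hypothesis LYm : forall m, (1 <= m)%N -> (0 < P (batch_ge q 0 m))%E ->
  member_limit q Q V m (Ym m).

Lemma mean_batch_gt0 : 0 < fine (mean_batch q).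
Proof.
rewrite (mean_split Hq 1) /truncated_mean big_nat1 /tail_prob (batch_ge_full Hq)//.
rewrite probability_setT ltr_wpDr// /mean_excess; apply: Rintegral_ge0 => w _.
by case/andP: (excess_bound R 1 (B 0%N w)).
Qed.

(** The product with the tail probability makes sense for every [m]. If no batch reaches size [m],
    nothing is assumed on [Ym m], but both sides are 0; otherwise the conditional limit is
    multiplied back by the probability of the condition. *)
Lemma ccvg_member m : (1 <= m)%N ->
  ccvg (fun n => cint P (batch_ge q n m) (fun w => decay s (V (member q n m w) w)))
    (ofR (tail_prob q m) * lst Q s (Ym m)).
Proof.
move=> m1; have mB n : measurable (batch_ge q n m) by exact: measurable_batch_ge.
have [p0|p0] := eqVneq (P (batch_ge q 0 m)) 0%E.
  rewrite /tail_prob p0 mul0r (_ : (fun n => _) = fun=> 0); first exact: ccvg_cst.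
  apply/funext => n; apply: cint_null => //; last first.
    by transitivity (P (batch_ge q 0 m)); [exact: (batch_ge_law Hq)|exact: p0].
  apply: (cbm_comp (cbm_decay s0)).
  by apply: (measurable_random_index mV); exact: measurable_member.
have p1 : (0 < P (batch_ge q 0 m))%E by rewrite lt0e p0/=.
have p2 : tail_prob q m != 0.
  by rewrite /tail_prob fine_eq0// (mu_fin Pf).
have h := member_limit_lst lambda_gt0 Hq z1 sE mV V0 m1 (LYm m1 p1).
have := ccvgM (ccvg_cst (ofR (tail_prob q m))) h; congr (ccvg _ _).
by apply/funext => n; rewrite mulrA -ofRM mulfV// ofR1 mul1r.
Qed.

Let bV k : cbm (fun w => decay s (V k w)).
Proof. exact: (cbm_comp (cbm_decay s0) (mV k)). Qed.

(** The comparison of averages is applied to the real and imaginary parts of [decay s]. Division by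
    the mean batch size turns the tail probabilities into the weights [r_weight]; ranks start at 1
    here and at 0 there. *)
Lemma arbitrary_transform :
  (\sum_(1 <= m < n) ofR (r_weight q m) * lst Q s (Ym m) : R[i]^o) @[n --> \oo]
    --> (lst Q s Y : R[i]^o).
Proof.
have Y0 : Q [set v | Y v < 0] = 0%E.
  apply: (law_limit_ge0 LY) => n f cf bf f0.
  rewrite big1 ?mulr0// => k _; have bmf : bmfun f.
    split; first exact: continuous_measurable_fun.
    have [M [Mr hM]] := bf; exists (`|M| + 1) => y; apply: hM => //.
    by rewrite (le_lt_trans (ler_norm M))// ltrDl.
  rewrite (eq_bRintegral_ae Pf measurableT mg (bmfun_comp bmf (mV k)) (bmfun_cst _ 0) g0).
    by rewrite Rintegral_cst// mul0r.
  by move=> w Dw gw; rewrite f0//; exact: V0.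
have [hRe hIm] := lst_limit LY s0 Y0.
have cRe := @cvg_member_sum _ _ _ _ _ _ _ _ q Hq (fun k w => Re (decay s (V k w)))
  (fun k => (bV k).1.1) (fun k w => (decay_le1 s0 (V k w)).1) _ _ hRe
  (fun r => (ccvg_member (ltn0Sn r)).1).
have cIm := @cvg_member_sum _ _ _ _ _ _ _ _ q Hq (fun k w => Im (decay s (V k w)))
  (fun k => (bV k).2.1) (fun k w => (decay_le1 s0 (V k w)).2) _ _ hIm
  (fun r => (ccvg_member (ltn0Sn r)).2).
have h : ccvg (fun c => \sum_(0 <= r < c) ofR (tail_prob q r.+1) * lst Q s (Ym r.+1))
    (ofR (fine (mean_batch q)) * lst Q s Y).
  split.
    by under eq_fun do rewrite cRe_sum; rewrite cReM/= mul0r subr0.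
  by under eq_fun do rewrite cIm_sum; rewrite cImM/= mul0r addr0.
have mu0 := mean_batch_gt0.
apply: ccvg_complex_cvg.
have := ccvgM (ccvg_cst (ofR (fine (mean_batch q))^-1)) h.
rewrite mulrA -ofRM mulVf ?gt_eqF// ofR1 mul1r.
set u := (fun n => _ * _) => hu.
have uE n : \sum_(1 <= m < n.+1) ofR (r_weight q m) * lst Q s (Ym m) = u n.
  rewrite big_add1/= /u mulr_sumr; apply: eq_bigr => r _.
  by rewrite r_weightE ofRM mulrA.
case: hu => hu1 hu2; split.
  rewrite -(cvg_shiftS (fun n => Re (\sum_(1 <= m < n) ofR (r_weight q m) * lst Q s (Ym m)))).
  by under eq_fun do rewrite uE.
rewrite -(cvg_shiftS (fun n => Im (\sum_(1 <= m < n) ofR (r_weight q m) * lst Q s (Ym m)))).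
by under eq_fun do rewrite uE.
Qed.

End ArbitraryLimit.

Theorem mainTheorem2 (R : realType) (N : nat) (lambda : R)
  (K Kstar : 'I_N -> 'I_N -> {measure set R -> \bar R})
  (d : measure_display) (T : measurableType d) (P : probability T R)
  (q : queue P N)
  (d' : measure_display) (T' : measurableType d') (Q : probability T' R)
  (Xd : {RV Q >-> nat}) (Jd : T' -> 'I_N)
  (Wsc Ssc : {RV Q >-> R}) (Wm Sm : nat -> {RV Q >-> R}) (W S : {RV Q >-> R}) :
  0 < lambda ->
  MXSM2_queue q lambda K Kstar ->
  (forall i, measurable [set v | Jd v = i]) ->
  sc_state_limit q Q Xd Jd ->
  sc_limit P Q (sc_waiting q) Wsc ->
  sc_limit P Q (sc_sojourn q) Ssc ->
  (forall m, (1 <= m)%N -> (0 < P (batch_ge q 0 m))%E ->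
     member_limit q Q (waiting q) m (Wm m) /\
     member_limit q Q (sojourn q) m (Sm m)) ->
  arbitrary_limit P Q (waiting q) W ->
  arbitrary_limit P Q (sojourn q) S ->
  forall z s : R[i], `|z| <= 1 -> s = ofR lambda * (1 - z) ->
  [/\ lst Q s Wsc = cintegral Q (fun v => (1 - s / ofR lambda) ^+ Xbs Xd v) /\
      lst Q s Ssc = cintegral Q (fun v => (1 - s / ofR lambda) ^+ Xd v),
      forall m, (1 <= m)%N -> (0 < P (batch_ge q 0 m))%E ->
        lst Q s (Wm m) = w_transform lambda K Kstar Q Xd Jd m s /\
        lst Q s (Sm m) = w_transform lambda K Kstar Q Xd Jd m.+1 s
    & ((\sum_(1 <= m < n) ofR (r_weight q m) * lst Q s (Wm m) : R[i]^o) @[n --> \oo]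
         --> (lst Q s W : R[i]^o)) /\
      ((\sum_(1 <= m < n) ofR (r_weight q m) * lst Q s (Sm m) : R[i]^o) @[n --> \oo]
         --> (lst Q s S : R[i]^o))].
Proof.
move=> lambda0 Hq mJ Hst Hwsc Hssc Hm Hw Hs z s z1 sE; split.
- split.
    exact: (sc_waiting_limit lambda0 Hq mJ Hst z1 sE Hwsc).
  exact: (sc_sojourn_limit lambda0 Hq mJ Hst z1 sE Hssc).
- move=> m m1 Pm; have [HW HS] := Hm m m1 Pm; split.
    exact: (member_waiting_limit lambda0 Hq mJ Hst z1 sE m1 Pm HW).
  exact: (member_sojourn_limit lambda0 Hq mJ Hst z1 sE m1 Pm HS).
- split.
    exact: (arbitrary_transform lambda0 Hq z1 sE (measurable_waiting q)
      (fun k w _ => waiting_ge0 q k w) Hw (fun m m1 Pm => (Hm m m1 Pm).1)).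
  exact: (arbitrary_transform lambda0 Hq z1 sE (measurable_sojourn q)
    (fun k w gw => sojourn_ge0 k gw) Hs (fun m m1 Pm => (Hm m m1 Pm).2)).
Qed.
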